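(* Let $Q(x,y,z)$ be an irreducible quadratic form with real coefficients and let $k$ be a natural number. The multipole space $\mathcal M^{\mathbb R}(k)$, which parametrizes completely factorable real homogeneous polynomials of degree $k$, is a space of an $\mathbb R^\ast$-bundle over the real variety $Sym^k(\mathbb{RP}^2)$. The $\mathbb R^\ast$-equivariant map $\Phi_Q^{\mathbb R}$ induces a surjective mapping $\Psi_Q^{\mathbb R}:Sym^k(\mathbb{RP}^2)\to\mathbb{RP}^{2k}=\mathbb{RP}(V_Q^\perp(k;\mathbb R))$ of degree one. Unless $Q$ is a definite form, the map $\Phi_Q^{\mathbb R}$ is ramified over the discriminant variety $\mathcal D(\Phi_Q^{\mathbb R})$ of codimension one. Here $\mathcal D(\Phi_Q^{\mathbb R})$ is comprised of homogeneous polynomials $P$ of degree $k$ on the real cone $\{Q=0\}$ for which the surfaces $\{P=0\}$ and $\{Q=0\}$ share a line of multiplicity at least two (equivalently, the curves $\mathcal P=\{P=0\}$ and $\mathcal Q=\{Q=0\}$ in $\mathbb{RP}^2_\ast$ share a point of multiplicity at least two).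
   Context: Irreducible means irreducible over $\mathbb C$ (equivalently, non-degenerate). A real homogeneous polynomial is completely factorable if it is a product of real linear forms. $V(k;\mathbb R)$ is the space of real homogeneous polynomials of degree $k$ in $x,y,z$; $V_Q(k;\mathbb R)=Q\cdot V(k-2;\mathbb R)$; $V_Q^\perp(k;\mathbb R)$ is its orthogonal complement for a Euclidean inner product, identified with $V(k;\mathbb R)/V_Q(k;\mathbb R)$, of dimension $2k+1$; if $Q$ is not definite it is identified with the degree $k$ homogeneous polynomial functions on the real cone $\{Q=0\}\subset\mathbb R^3$. $V^\circ=V\setminus\{0\}$. $\mathbb{RP}^2_\ast$ has homogeneous coordinates $[x:y:z]$; $\mathbb{RP}^2$ is the dual plane of real linear forms up to proportionality; $Sym^k(X)=X^k/S_k$. $H_k^{\mathbb R}=\{(\lambda_i)\in(\mathbb R^\ast)^k:\prod\lambda_i=1\}$; $\Sigma_k^{\mathbb R}$ is the group generated by $H_k^{\mathbb R}$ (rescaling) and $S_k$ (permuting); $\mathcal M^{\mathbb R}(k)=[\mathbb R^3\setminus\{0\}]^k/\Sigma^{\mathbb R}_k$, where $(a,b,c)$ encodes the form $ax+by+cz$. $\mathbb R^\ast$ acts on $\mathcal M^{\mathbb R}(k)$ by multiplying one of the vectors by a scalar, with quotient $Sym^k(\mathbb{RP}^2)$. $\Phi_Q^{\mathbb R}:\mathcal M^{\mathbb R}(k)\to V_Q^\perp(k;\mathbb R)^\circ$ sends the class of $(L_1,\dots,L_k)$ to the class of $\prod L_i$ modulo $Q$. $\Psi_Q^{\mathbb R}$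 is the map induced by $\Phi_Q^{\mathbb R}$ on $\mathbb R^\ast$-quotients. The ramification set of a finite-fiber map $f:X\to Y$ is the set of $y_0\in Y$ such that for every open neighborhood $U$ of $y_0$ the cardinality of $f^{-1}(y)$, $y\in U$, is not constant.
   Formalization: The ramification set is not all of D: it is D minus those P whose only real line shared with {Q=0} has multiplicity exactly two, since near these P every fiber is a single point (for k=1 nothing is ramified); D, and for k≥2 the ramification set, has codimension one. Here k≥1. *)

(* Defs.v *)
From HB Require Import structures.
From mathcomp Require Export all_boot all_order all_algebra all_fingroup.
From mathcomp Require Export sesquilinear generic_quotient.
From mathcomp Require Export all_classical reals topology normedtype.
From mathcomp.real_closed Require Export complex.
(* The notations of mpoly and of mathcomp-analysis are incompatible. *)
From mathcomp Require Export -(notations) mpoly.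

Set Implicit Arguments.
Unset Strict Implicit.
Unset Printing Implicit Defensive.

Import Order.TTheory GRing.Theory Num.Theory.
Import numFieldTopology.Exports numFieldNormedType.Exports.
Local Open Scope classical_set_scope.
Local Open Scope ring_scope.
Local Open Scope quotient_scope.

Notation form R k := (dhomog 3 R k).

(* V(k;R) carries the topology of coefficientwise convergence, which is its
   topology as a finite-dimensional real vector space. *)
Definition coefs (R : realType) (k : nat) (P : form R k) :
  {ptws (multinom 3) -> R} := fun m => mcoeff m P.

HB.instance Definition _ (R : realType) (k : nat) :=
  Topological.copy (form R k) (initial_topology (@coefs R k)).

Definition evalp (R : realType) (P : mpoly 3 R) (x : 'rV[R]_3) : R :=
  meval (fun i => x 0 i) P.

Definition linear_form (R : realType) (v : 'rV[R]_3) : mpoly 3 R :=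
  \sum_i v 0 i *: mpolyX R (mnm1 i).

Lemma linear_form_homog (R : realType) (v : 'rV[R]_3) :
  linear_form v \is @ishomog1 3 R 1 mdeg.
Proof.
apply: rpred_sum => i _; apply: rpredZ.
by rewrite dhomogX /= mdeg1.
Qed.

Definition completely_factorable (R : realType) (P : mpoly 3 R) : Prop :=
  exists s : seq 'rV[R]_3, P = \prod_(v <- s) linear_form v.

Definition irreducible_mpoly (F : idomainType) (n : nat) (P : mpoly n F) :
  Prop :=
  P != 0 /\ P \isn't a GRing.unit /\
  forall S T : mpoly n F, P = S * T ->
    S \is a GRing.unit \/ T \is a GRing.unit.

Definition irreducible_over_C (R : realType) (P : mpoly 3 R) : Prop :=
  irreducible_mpoly (map_mpoly (fun t : R => t%:C%C) P).

Definition definite (R : realType) (Q : form R 2) : Prop :=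
  (forall x, x != 0 -> 0 < evalp Q x) \/ (forall x, x != 0 -> evalp Q x < 0).

Definition mulQ (R : realType) (Q : form R 2) (j : nat) (A : form R j) :
  form R j.+2 :=
  DHomog (dhomogM (dhomog_is_dhomog Q) (dhomog_is_dhomog A)).

Lemma mulQ_is_linear (R : realType) (Q : form R 2) (j : nat) :
  linear (@mulQ R Q j).
Proof. by move=> c S T; apply: val_inj; rewrite /= mulrDr -scalerAr. Qed.

HB.instance Definition _ (R : realType) (Q : form R 2) (j : nat) :=
  GRing.isLinear.Build R (form R j) (form R j.+2) _ (@mulQ R Q j)
    (@mulQ_is_linear R Q j).

Definition VQ (R : realType) (Q : form R 2) (k : nat) : {vspace form R k} :=
  match k return {vspace form R k} with
  | j.+2 => limg (linfun (@mulQ R Q j))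
  | _ => 0%VS
  end.

Definition VQperp (R : realType) (k : nat) (B : {dot (form R k) for idfun})
  (Q : form R 2) : {vspace form R k} := orthov B (VQ Q k).

Definition VQperp0 (R : realType) (k : nat) (B : {dot (form R k) for idfun})
  (Q : form R 2) : set (form R k) := [set P | P \in VQperp B Q /\ P != 0].

Definition Rstar (R : realType) : set R := [set t | t != 0].
Arguments Rstar : clear implicits.

Definition nzvec (R : realType) : set 'rV[R]_3 := [set v | v != 0].
Arguments nzvec : clear implicits.

Definition mk_Rstar (R : realType) (t : R) (t0 : t != 0) : Rstar R :=
  exist (fun x => x \in Rstar R) t (mem_set t0).

Definition mk_nzvec (R : realType) (v : 'rV[R]_3) (v0 : v != 0) : nzvec R :=
  exist (fun x => x \in nzvec R) v (mem_set v0).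

Section Proportional.
Variables (R : realType) (V : lmodType R) (T : Type) (f : T -> V).

Definition proportional (u v : T) : bool :=
  `[< exists2 t : R, t != 0 & f v = t *: f u >].

Lemma proportional_refl : reflexive proportional.
Proof. by move=> u; apply/asboolP; exists 1; rewrite ?oner_eq0 ?scale1r. Qed.

Lemma proportional_sym : ssrbool.symmetric proportional.
Proof.
suff H u v : proportional u v -> proportional v u.
  by move=> u v; apply/idP/idP; apply: H.
move=> /asboolP[t t0 e]; apply/asboolP; exists t^-1; first by rewrite invr_eq0.
by rewrite e scalerA mulVf // scale1r.
Qed.

Lemma proportional_trans : transitive proportional.
Proof.
move=> v u w /asboolP[t t0 e] /asboolP[s s0 e']; apply/asboolP.
by exists (s * t); rewrite ?mulf_neq0 // e' e scalerA.
Qed.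

Definition proportional_equiv :=
  EquivRel proportional proportional_refl proportional_sym proportional_trans.

End Proportional.

(* The plane of nonzero linear forms ax + by + cz up to proportionality. *)
Definition RP2 (R : realType) : Type :=
  quotient_topology
    {eq_quot (proportional_equiv (fun v : nzvec R => \val v))}.

HB.instance Definition _ (R : realType) := Quotient.on (RP2 R).
HB.instance Definition _ (R : realType) := Topological.on (RP2 R).

Definition RP_VQperp (R : realType) (k : nat) (B : {dot (form R k) for idfun})
  (Q : form R 2) : Type :=
  quotient_topology
    {eq_quot (proportional_equiv (fun P : VQperp0 B Q => \val P))}.

HB.instance Definition _ (R : realType) (k : nat)
  (B : {dot (form R k) for idfun}) (Q : form R 2) :=
  Quotient.on (RP_VQperp B Q).
HB.instance Definition _ (R : realType) (k : nat)
  (B : {dot (form R k) for idfun}) (Q : form R 2) :=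
  Topological.on (RP_VQperp B Q).

Section Sym.
Variables (k : nat) (X : topologicalType).

Definition permuted (f g : {ptws 'I_k -> X}) : bool :=
  `[< exists s : 'S_k, forall i, g i = f (s i) >].

Lemma permuted_refl : reflexive permuted.
Proof. by move=> f; apply/asboolP; exists 1%g => i; rewrite perm1. Qed.

Lemma permuted_sym : ssrbool.symmetric permuted.
Proof.
suff H f g : permuted f g -> permuted g f.
  by move=> f g; apply/idP/idP; apply: H.
move=> /asboolP[s e]; apply/asboolP; exists s^-1%g => i.
by rewrite e permKV.
Qed.

Lemma permuted_trans : transitive permuted.
Proof.
move=> g f h /asboolP[s e] /asboolP[t e']; apply/asboolP.
by exists (t * s)%g => i; rewrite e' e permM.
Qed.

Definition permuted_equiv :=
  EquivRel permuted permuted_refl permuted_sym permuted_trans.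

Definition Sym : Type := quotient_topology {eq_quot permuted_equiv}.

HB.instance Definition _ := Quotient.on Sym.
HB.instance Definition _ := Topological.on Sym.

End Sym.

Lemma Rstar_neq0 (R : realType) (t : Rstar R) : \val t != 0.
Proof. exact: set_mem (valP t). Qed.

Lemma nzscale_subproof (R : realType) (t : Rstar R) (v : nzvec R) :
  \val t *: \val v != 0.
Proof.
rewrite scaler_eq0 negb_or Rstar_neq0 /=; exact: set_mem (valP v).
Qed.

Definition nzscale (R : realType) (t : Rstar R) (v : nzvec R) : nzvec R :=
  mk_nzvec (nzscale_subproof t v).

Notation vectors R k := {ptws 'I_k -> nzvec R}.

Section Multipole.
Variables (R : realType) (k : nat).

(* Every element of Sigma_k is a permutation followed by a rescaling by an
   element of H_k, since H_k is normalized by the permutations. *)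
Definition Sigma_equivalent (A A' : vectors R k) : bool :=
  `[< exists (l : 'I_k -> Rstar R) (s : 'S_k),
        \prod_i \val (l i) = 1 /\
        forall i, A' i = nzscale (l i) (A (s i)) >].

Lemma Sigma_refl : reflexive Sigma_equivalent.
Proof.
move=> A; apply/asboolP.
exists (fun=> mk_Rstar (oner_neq0 R)), 1%g; split; first by rewrite big1.
by move=> i; apply: val_inj; rewrite /= scale1r perm1.
Qed.

Lemma Sigma_sym : ssrbool.symmetric Sigma_equivalent.
Proof.
suff H A A' : Sigma_equivalent A A' -> Sigma_equivalent A' A.
  by move=> A A'; apply/idP/idP; apply: H.
move=> /asboolP[l [s [pl e]]]; apply/asboolP.
have inv0 i : (\val (l i))^-1 != 0 by rewrite invr_eq0 Rstar_neq0.
exists (fun i => mk_Rstar (inv0 (s^-1%g i))), s^-1%g; split.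
  rewrite (reindex_inj (@perm_inj _ s)) /=.
  under eq_bigr do rewrite permK.
  by rewrite prodfV pl invr1.
move=> i; apply: val_inj; rewrite /= e /= permKV scalerA mulVf ?scale1r //.
exact: Rstar_neq0.
Qed.

Lemma Sigma_trans : transitive Sigma_equivalent.
Proof.
move=> A' A A'' /asboolP[l [s [pl e]]] /asboolP[m [t [pm e']]]; apply/asboolP.
have mul0 i : \val (m i) * \val (l (t i)) != 0.
  by rewrite mulf_neq0 ?Rstar_neq0.
exists (fun i => mk_Rstar (mul0 i)), (t * s)%g; split.
  by rewrite big_split /= pm mul1r -[RHS]pl [RHS](reindex_inj (@perm_inj _ t)).
by move=> i; apply: val_inj; rewrite e' /= e /= scalerA permM.
Qed.

Definition Sigma_equiv :=
  EquivRel Sigma_equivalent Sigma_refl Sigma_sym Sigma_trans.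

Definition multipole : Type := quotient_topology {eq_quot Sigma_equiv}.

HB.instance Definition _ := Quotient.on multipole.
HB.instance Definition _ := Topological.on multipole.

Definition prod_linear (A : vectors R k) : mpoly 3 R :=
  \prod_i linear_form (\val (A i)).

Lemma prod_linear_homog (A : vectors R k) :
  prod_linear A \is @ishomog1 3 R k mdeg.
Proof.
rewrite /prod_linear.
have : \prod_i linear_form (\val (A i)) \is
    @ishomog1 3 R (\sum_(i < k) 1)%N mdeg.
  elim/big_rec2: _ => [|i d p _ hp]; first exact: dhomog1.
  by apply: dhomogM => //; exact: linear_form_homog.
by rewrite sum1_card card_ord.
Qed.

Definition prod_form (A : vectors R k) : form R k :=
  DHomog (prod_linear_homog A).

Definition scale_at (i : 'I_k) (t : Rstar R) (A : vectors R k) : vectors R k :=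
  fun j => if j == i then nzscale t (A j) else A j.

End Multipole.

Section Topology.

Definition principal_Rstar_bundle (R : realType) (E X : topologicalType)
  (act : Rstar R -> E -> E) (p : E -> X) : Prop :=
  [/\ (forall t e, \val t = 1 -> act t e = e),
      (forall s t st e, \val st = \val s * \val t ->
         act st e = act s (act t e)),
      continuous (fun te : Rstar R * E => act te.1 te.2),
      continuous p &
      (forall t e, p (act t e) = p e) /\
      forall b : X, exists U : set X, open_nbhs b U /\
        exists (phi : E -> Rstar R) (psi : X * Rstar R -> E),
          [/\ {within p @^-1` U, continuous phi},
              {within U `*` setT, continuous psi},
              (forall e, U (p e) -> psi (p e, phi e) = e),
              (forall x t, U x -> p (psi (x, t)) = x /\ phi (psi (x, t)) = t) &
              (forall t e, U (p e) ->
                 \val (phi (act t e)) = \val t * \val (phi e))]].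

Variables X Y : topologicalType.

Definition finite_fibers (f : X -> Y) : Prop :=
  forall y, finite_set (f @^-1` [set y]).

Definition ramification_set (f : X -> Y) : set Y :=
  [set y0 | forall U, open_nbhs y0 U ->
     ~ (forall y y', U y -> U y' ->
          (f @^-1` [set y] #= f @^-1` [set y'])%card)].

(* y has an open neighborhood U such that the preimage of U is the disjoint
   union of n open sets (the images of the sections s i), each of which is
   mapped homeomorphically onto U when f is continuous. *)
Definition evenly_covered (f : X -> Y) (n : nat) (y : Y) : Prop :=
  exists U : set Y, open_nbhs y U /\
  exists s : 'I_n -> Y -> X,
    [/\ (forall i, {within U, continuous (s i)}),
        (forall i, open (s i @` U)),
        (forall i z, U z -> f (s i z) = z),
        (forall i j z, U z -> s i z = s j z -> i = j) &
        f @^-1` U = \bigcup_i (s i @` U)].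

(* For a map f between closed manifolds of the same dimension, the number of
   sheets over an evenly covered value modulo 2 is the degree modulo 2 of f.
   RP^(2k) is not orientable, so an integral degree is only defined up to sign,
   with coefficients in the orientation local system (or as the absolute degree
   of Hopf); it is then 1 as soon as some value is evenly covered by exactly
   one sheet. *)
Definition degree_one (f : X -> Y) : Prop :=
  [/\ continuous f,
      (exists y, evenly_covered f 1 y) &
      (forall n y, evenly_covered f n y -> odd n)].

End Topology.

Section Dimension.
Variables (R : realType) (W : vectType R).

Definition poly_function (F : mpoly (\dim {:W}) R) (w : W) : R :=
  meval (fun i => coord (vbasis {:W}) i w) F.

Definition alg_independent_on (S : set W) (d : nat)
  (F : 'I_d -> mpoly (\dim {:W}) R) : Prop :=
  forall G : mpoly d R,
    (forall w, S w -> meval (fun i => poly_function (F i) w) G = 0) -> G = 0.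

(* The dimension of a semialgebraic set S, i.e. the Krull dimension of the ring
   of polynomial functions on S, computed as the maximal number of
   algebraically independent elements of this finitely generated algebra. *)
Definition has_dimension (S : set W) (d : nat) : Prop :=
  (exists F : 'I_d -> mpoly (\dim {:W}) R, alg_independent_on S F) /\
  (forall F : 'I_d.+1 -> mpoly (\dim {:W}) R, ~ alg_independent_on S F).

Definition codimension_one_in (U : {vspace W}) (S : set W) : Prop :=
  exists2 d, \dim U = d.+1 & has_dimension S d.

End Dimension.

Section Multiplicity.
Variable R : realType.

(* The length of the localization of R[x,y,z]/(P,Q) at the prime ideal of the
   line spanned by a is at least m: there is a chain of m strict inclusions
   (P,Q) < (P,Q,g_0) < (P,Q,g_0,g_1) < ... of ideals of the local ring. *)
Definition line_mult_ge (P Q : mpoly 3 R) (a : nzvec R) (m : nat) : Prop :=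
  exists g : 'I_m -> mpoly 3 R, forall (i : 'I_m) (h : mpoly 3 R),
    (exists t : R, evalp h (t *: \val a) != 0) ->
    ~ exists (u v : mpoly 3 R) (c : 'I_m -> mpoly 3 R),
        h * g i = u * P + v * Q + \sum_(j < m | (j < i)%N) c j * g j.

(* The real dimension of the quotient by (P,Q) of the local ring of the
   projective plane at the point [a] is at least m: the germs f_i / f (f any
   form of degree d with f(a) != 0) are linearly independent modulo (P,Q). *)
Definition point_mult_ge (P Q : mpoly 3 R) (a : nzvec R) (m : nat) : Prop :=
  exists (d : nat) (f : 'I_m -> form R d), forall (c : 'I_m -> R),
    (exists i, c i != 0) ->
    forall (e : nat) (h : form R e), evalp h (\val a) != 0 ->
    ~ exists u v : mpoly 3 R,
        (h : mpoly 3 R) * (\sum_i c i *: (f i : mpoly 3 R)) = u * P + v * Q.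

Variables (k : nat) (B : {dot (form R k) for idfun}) (Q : form R 2).

Definition discriminant : set (VQperp0 B Q) :=
  [set P | exists a, line_mult_ge (\val P : form R k) Q a 2].

Definition discriminant_curves : set (VQperp0 B Q) :=
  [set P | exists a, point_mult_ge (\val P : form R k) Q a 2].

(* The only real line shared by {P = 0} and {Q = 0} has multiplicity two. *)
Definition single_double_line : set (VQperp0 B Q) :=
  [set P | exists a,
    [/\ line_mult_ge (\val P : form R k) Q a 2, ~ line_mult_ge (\val P) Q a 3 &
        forall b, line_mult_ge (\val P : form R k) Q b 1 ->
          proportional (fun v : nzvec R => \val v) a b]].

End Multiplicity.
Arguments discriminant {R k} B Q _.
Arguments discriminant_curves {R k} B Q _.
Arguments single_double_line {R k} B Q _.

(* Main.v *)
From HB Require Import structures.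
Require Import Defs.
From mathcomp Require Import ring lra zify.

Set Implicit Arguments.
Unset Strict Implicit.
Unset Printing Implicit Defensive.

Import Order.TTheory GRing.Theory Num.Theory.
Import numFieldTopology.Exports numFieldNormedType.Exports.
Local Open Scope classical_set_scope.
Local Open Scope ring_scope.
Local Open Scope quotient_scope.

(** The forms of degree k modulo Q are the functions on the cone Q = 0, so a
    class in V(k) / V_Q(k) has a product of k linear forms as a representative
    exactly when its restriction to the cone factors accordingly; everything is
    read off from the way in which a real polynomial factors.

    If Q is not definite, the conic Q = 0 has a real point (indefinite_isotropic)
    and irreducibility makes it nondegenerate (irr_nondegenerate). In suitable
    coordinates Q is proportional to y^2 - x z (exists_conic_frame) and the conic
    is parametrized by t as (1, t, t^2), with one point b at infinity. Restriction
    to it identifies V(k) / V_Q(k) with the polynomials of degree at most 2 k in t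
    (restr_lift, restr_eq0), and linear forms with the polynomials of degree at
    most 2. Representing a class by a product of linear forms thus means grouping
    the 2 k roots of a real polynomial into k pairs stable under conjugation.
    This is always possible (indefinite_factorization), whence the surjectivity
    of Psi. A nonreal root can only be paired with its conjugate; if the real
    roots are 2 m in number and distinct, there are (2 m - 1)!! ways to pair them.
    This is the number of points in the fiber of Phi (card_factor_set); it is odd.

    If Q is definite, the complex conic still meets every curve P = 0, and the
    real line through a common point and its conjugate splits off a linear factor
    (definite_split_linear). In both cases a factor that vanishes on a line
    missing the real conic, called elliptic here, occurs in every factorization
    (elliptic_factor), so that a product with at most one non-elliptic factor is
    the only one in its class (linear_factors_uniq_modQ, card_Phi_elliptic).

    The bundle is trivial over the classes of products that do not vanish at a
    given point, since there each form can be scaled to take the value 1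
    (multipole_bundle). Multiplying a multipole by a scalar multiplies its image
    under Phi, hence a fiber of Psi has as many points as one of Phi
    (card_Phi_Psi).

    As Sym^k(RP^2) is compact and the projective space Hausdorff, Psi is closed,
    so open conditions on the members of a fiber persist nearby (fiber_condition).
    A product of elliptic forms is alone in its fiber and remains so, which gives
    a value evenly covered by one sheet (evenly_covered_one). When n sheets cover
    a neighbourhood, this neighbourhood contains a polynomial whose real roots are
    simple, so n is odd (evenly_covered_odd): the degree of Psi is one.

    The multiplicity of a common line of P = 0 and Q = 0 is the multiplicity of
    the corresponding root (line_mult_geP, point_mult_ge2P), because the quotient
    by Q of the local ring of a line of the cone is a discrete valuation ring.
    Hence the discriminant consists of the classes with a multiple real root. Off
    it the fiber has a locally constant number of points (near_card_uniq). At a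
    class with a multiple root, one may separate the real roots, getting 2 m
    simple ones, or move two equal ones off the real axis, getting 2 m - 2; the
    fibers have (2 m - 1)!! and (2 m - 3)!! points, which differ unless m = 1
    (ramified). If m = 1, the only real roots form one double root; the number of
    points is then 1 all around (near_card_single), which is why these classes are
    taken out of the discriminant.

    Finally the discriminant has dimension 2 k. A polynomial with a double root is
    given by 2 k parameters, the root and the cofactor, and n + 1 polynomials in n
    variables are algebraically dependent (algebraic_dependence,
    discriminant_dependent). Conversely the 2 k coefficients of positive degree
    are independent on the discriminant: a polynomial close to X^(2 k) has a
    critical point, where changing the constant term creates a double root
    (discriminant_independent). Starting from X^(2 k) - 2 X^2 instead, there
    remains another real root and the class is ramified
    (ramification_independent). *)

(** * Evaluating polynomials *)

Lemma infinite_field_nonroot (R : numDomainType) (p : {poly R}) :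
  p != 0 -> exists x, ~~ root p x.
Proof.
move=> p0; pose s : seq R := [seq i%:R | i <- iota 0 (size p)].
have us : uniq s.
  by rewrite map_inj_uniq ?iota_uniq // => i j /eqP; rewrite eqr_nat => /eqP.
have [al|/allPn[x _ px]] := boolP (all (root p) s); last by exists x.
by have := max_poly_roots p0 al us; rewrite size_map size_iota ltnn.
Qed.

(** Induction on the number of variables: some coefficient of P, seen as a
    polynomial in its last variable, does not vanish at some point, and then
    the univariate polynomial obtained there has a non-root. *)
Lemma mpoly_eq0_of_meval n (R : realType) (P : mpoly n R) :
  (forall v, meval v P = 0) -> P = 0.
Proof.
suff H : P != 0 -> exists v, meval v P != 0.
  move=> P0; apply/eqP; apply: contraT => /H[v].
  by rewrite P0 eqxx.
elim: n P => [|n IH] P P0.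
  exists (fun=> 0); rewrite -(mpolyKC P) mevalC.
  by apply: contraNneq P0 => h; rewrite -(mpolyKC P) h mpolyC0.
have [j mj] : exists j, (muni P)`_j != 0.
  suff : muni P != 0 by move=> h; exists (size (muni P)).-1; rewrite -lead_coefE lead_coef_eq0.
  apply: contraNneq P0 => P0; apply/eqP/mpolyP => m.
  have := congr1 (fun q : {poly mpoly n R} =>
     mcoeff (Multinom (mktuple (fun i => m (widen_ord (leqnSn n) i)))) (q`_(m ord_max))) P0.
  rewrite /= => e; rewrite coef0 !mcoeff0 in e *; rewrite -e {e}. rewrite muniE coef_sum raddf_sum /=.
  rewrite {1}(mpolyE P) raddf_sum /=; apply: eq_bigr => m' _.
  rewrite !mcoeffZ !coefZ !coefXn mcoeffX -scalerAl mcoeffZ; congr (_ * _).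
  rewrite mulr_natr mcoeffMn mcoeffX; case: eqP => [->|ne].
    by rewrite !eqxx mulr1n.
  case: (m ord_max =P _) => [e|_]; last by rewrite mulr0n.
  case: eqP => [e'|_]; last by rewrite mul0rn.
  case: ne; apply/mnmP => i.
  have [->|/eqP ni] := eqVneq i ord_max; first by rewrite e.
  have li : (i < n)%N.
    by have := ltn_ord i; rewrite ltnS leq_eqVlt => /orP[/eqP h|//]; case: ni; apply/val_inj.
  have := congr1 (fun m : multinom n => m (Ordinal li)) e'.
  rewrite !mnmE; have -> : widen_ord (leqnSn n) (Ordinal li) = i by apply/val_inj.
  by [].
have [v hv] := IH _ mj.
have q0 : map_poly (meval v) (muni P) != 0.
  by apply: contraNneq hv => h; rewrite -coef_map h coef0.
have [x hx] := infinite_field_nonroot q0.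
pose w (i : 'I_n.+1) := if insub (val i) is Some j then v j else x.
exists w; rewrite mevalE; apply: contra hx => /eqP s0; apply/rootP; rewrite -{}[RHS]s0.
rewrite muniE raddf_sum /= horner_sum; apply: eq_bigr => m _.
rewrite map_polyZ hornerZ -mulr_algl -scalerAl mul1r.
rewrite /= mevalZ mevalX map_polyXn hornerXn -mulrA; congr (_ * _).
rewrite big_ord_recr /=; congr (_ * _).
  apply: eq_bigr => i _; rewrite mnmE /w /= insubT //= => li.
  by congr (v _ ^+ _); apply/val_inj.
by rewrite /w /= insubF // ltnn.
Qed.

Lemma meval_line (R : realType) n (P : mpoly n R) (x y : 'I_n -> R) :
  exists p : {poly R}, forall t, p.[t] = meval (fun i => x i + t * y i) P.
Proof.
exists (mmap (@polyC R) (fun i => (x i)%:P + (y i) *: 'X) P) => t.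
elim/mpolyind: P => [|c m p _ _ ih]; first by rewrite rmorph0 horner0 meval0.
rewrite rmorphD /= hornerD ih mevalD; congr (_ + _).
rewrite mmapZ mmapX hornerM hornerC mevalZ mevalX /mmap1 horner_prod.
congr (_ * _); apply: eq_bigr => i _.
by rewrite horner_exp !hornerE mulrC.
Qed.

(** * Linear forms *)

Definition divides (A : comNzRingType) (p q : A) : Prop := exists t, q = p * t.

Section Divides.
Variable A : comNzRingType.
Implicit Types p q r : A.

Lemma dividesD p q r : divides p q -> divides p r -> divides p (q + r).
Proof. by move=> [a ->] [b ->]; exists (a + b); rewrite mulrDr. Qed.

Lemma dividesN p q : divides p q -> divides p (- q).
Proof. by move=> [a ->]; exists (- a); rewrite mulrN. Qed.

Lemma dividesB p q r : divides p q -> divides p r -> divides p (q - r).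
Proof. by move=> pq pr; apply: dividesD => //; apply: dividesN. Qed.

Lemma divides_mull p q r : divides p q -> divides p (r * q).
Proof. by move=> [a ->]; exists (r * a); rewrite mulrCA. Qed.

Lemma divides_mulr p q r : divides p q -> divides p (q * r).
Proof. by move=> pq; rewrite mulrC; apply: divides_mull. Qed.

Lemma divides0 p : divides p 0.
Proof. by exists 0; rewrite mulr0. Qed.

Lemma dividesxx p : divides p p.
Proof. by exists 1; rewrite mulr1. Qed.

Lemma divides_mulB p a b a' b' :
  divides p (a - a') -> divides p (b - b') -> divides p (a * b - a' * b').
Proof.
move=> [s ha] [t hb]; exists (s * b + a' * t).
by rewrite mulrDr mulrA -ha mulrCA -hb; ring.
Qed.

Lemma divides_expB p a a' n : divides p (a - a') -> divides p (a ^+ n - a' ^+ n).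
Proof.
move=> h; elim: n => [|n IH]; first by rewrite subrr; apply: divides0.
by rewrite !exprS; apply: divides_mulB.
Qed.

(** Substituting congruent values gives congruent results. *)
Lemma divides_mmapB n (R : comNzRingType) (f : {rmorphism R -> A})
    (h h' : 'I_n -> A) d (P : mpoly n R) :
  (forall i, divides d (h i - h' i)) ->
  divides d (mmap f h P - mmap f h' P).
Proof.
move=> hh; elim/mpolyind: P => [|c m p _ _ ih].
  by rewrite !rmorph0 subrr; apply: divides0.
rewrite !rmorphD /= opprD addrACA; apply: dividesD => //.
rewrite !mmapZ -mulrBr; apply: divides_mull; rewrite !mmapX /mmap1.
elim/big_rec2: _ => [|i y1 y2 _ ih']; first by rewrite subrr; apply: divides0.
by apply: divides_mulB => //; apply: divides_expB.
Qed.

End Divides.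

Lemma dividesZ (R : comNzRingType) n (p q : mpoly n R) c :
  divides p q -> divides p (c *: q).
Proof. by move=> [t ->]; exists (c *: t); rewrite scalerAr. Qed.

Lemma divides0P (A : comNzRingType) (q : A) : divides 0 q <-> q = 0.
Proof. by split=> [[t ->]|->]; [rewrite mul0r|apply: divides0]. Qed.

Section LinearForms.
Variable R : realType.
Implicit Types (v w x : 'rV[R]_3) (P S T : mpoly 3 R).

Definition dotv v x : R := \sum_i v 0 i * x 0 i.

Lemma dotvC v x : dotv v x = dotv x v.
Proof. by apply: eq_bigr => i _; rewrite mulrC. Qed.

Lemma dotvDr v x y : dotv v (x + y) = dotv v x + dotv v y.
Proof. by rewrite -big_split /=; apply: eq_bigr => i _; rewrite mxE mulrDr. Qed.

Lemma dotvZr v c x : dotv v (c *: x) = c * dotv v x.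
Proof. by rewrite mulr_sumr; apply: eq_bigr => i _; rewrite mxE mulrCA. Qed.

Lemma dotvDl v x y : dotv (x + y) v = dotv x v + dotv y v.
Proof. by rewrite dotvC dotvDr !(dotvC v). Qed.

Lemma dotvZl v c x : dotv (c *: x) v = c * dotv x v.
Proof. by rewrite dotvC dotvZr dotvC. Qed.

Lemma dotv0r v : dotv v 0 = 0.
Proof. by rewrite -(scale0r 0) dotvZr mul0r. Qed.

Lemma dotv_delta v i : dotv v (delta_mx 0 i) = v 0 i.
Proof.
rewrite /dotv (bigD1 i) //= mxE !eqxx mulr1 big1 ?addr0 // => j ji.
by rewrite mxE eqxx (negbTE ji) mulr0.
Qed.

Lemma dotv_self_gt0 v : v != 0 -> 0 < dotv v v.
Proof.
move=> v0; rewrite lt_def; apply/andP; split; last first.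
  by apply: sumr_ge0 => i _; rewrite -expr2 sqr_ge0.
apply: contra v0; rewrite psumr_eq0; last by move=> i _; rewrite -expr2 sqr_ge0.
move=> /allP h; apply/eqP/rowP => i; rewrite mxE; apply/eqP.
by have := h i (mem_index_enum _); rewrite mulf_eq0 orbb.
Qed.

Lemma mmap_linear_form (S : comNzRingType) (f : {rmorphism R -> S}) h v :
  mmap f h (linear_form v) = \sum_i f (v 0 i) * h i.
Proof.
rewrite raddf_sum /=; apply: eq_bigr => i _.
by rewrite mmapZ mmapX mmap1U.
Qed.

Lemma evalpM x P S : evalp (P * S) x = evalp P x * evalp S x.
Proof. exact: mevalM. Qed.
Lemma evalpD x P S : evalp (P + S) x = evalp P x + evalp S x.
Proof. exact: mevalD. Qed.
Lemma evalpB x P S : evalp (P - S) x = evalp P x - evalp S x.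
Proof. exact: mevalB. Qed.
Lemma evalpZ x c P : evalp (c *: P) x = c * evalp P x.
Proof. exact: mevalZ. Qed.
Lemma evalp0 x : evalp 0 x = 0 :> R.
Proof. exact: meval0. Qed.
Lemma evalp1 x : evalp 1 x = 1 :> R.
Proof. exact: meval1. Qed.

Lemma evalp_prod I (r : seq I) (F : I -> mpoly 3 R) x :
  evalp (\prod_(i <- r) F i) x = \prod_(i <- r) evalp (F i) x.
Proof. exact: (rmorph_prod (meval (fun i => x 0 i))). Qed.

Lemma evalp_linear_form v x : evalp (linear_form v) x = dotv v x.
Proof. by rewrite /evalp /meval (mmap_linear_form idfun). Qed.

Lemma evalp_homog k P x t : P \is @ishomog1 3 R k mdeg ->
  evalp P (t *: x) = t ^+ k * evalp P x.
Proof.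
move=> /dhomogP hP; rewrite /evalp !mevalE mulr_sumr big_seq [RHS]big_seq.
apply: eq_bigr => m /hP mk.
have {}mk : mdeg m = k := mk.
rewrite mulrCA -{}mk mdegE -prodrXr -big_split /=; congr (_ * _).
by apply: eq_bigr => i _; rewrite mxE exprMn.
Qed.

Lemma evalp_eq0 P : (forall x, evalp P x = 0) -> P = 0.
Proof.
move=> P0; apply: mpoly_eq0_of_meval => v.
have := P0 (\row_i v i); rewrite /evalp => <-.
by apply: meval_eq => i; rewrite mxE.
Qed.

Lemma linear_formE c v w :
  linear_form (c *: v + w) = c *: linear_form v + linear_form w.
Proof.
rewrite scaler_sumr -big_split /=; apply: eq_bigr => i _.
by rewrite !mxE scalerDl scalerA.
Qed.

Lemma linear_form0 : linear_form 0 = 0 :> mpoly 3 R.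
Proof. by apply: big1 => i _; rewrite mxE scale0r. Qed.

Lemma linear_formZ c v : linear_form (c *: v) = c *: linear_form v.
Proof. by rewrite -[c *: v]addr0 linear_formE linear_form0 addr0. Qed.

Lemma linear_form_eq0 v : (linear_form v == 0) = (v == 0).
Proof.
apply/eqP/eqP => [h|->]; last exact: linear_form0.
apply/rowP => i; rewrite mxE -(dotv_delta v i) -evalp_linear_form h.
exact: evalp0.
Qed.

Lemma prod_linear_form_neq0 (vs : seq 'rV[R]_3) :
  all (fun v => v != 0) vs -> \prod_(v <- vs) linear_form v != 0.
Proof.
by move=> h; rewrite prodf_seq_neq0; apply: sub_all h => v; rewrite linear_form_eq0.
Qed.

Lemma row_neq0 v : v != 0 -> exists i, v 0 i != 0.
Proof.
move=> v0; apply/existsP; apply: contraT => /existsPn h0; case/eqP: v0.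
by apply/rowP => i; rewrite mxE; apply/eqP; have := h0 i; rewrite negbK.
Qed.

(** Substituting for one coordinate the projection along its axis onto the
    plane {v = 0} kills exactly the multiples of the linear form of v. *)
Lemma linear_form_retraction v : v != 0 ->
  exists (s : {rmorphism mpoly 3 R -> mpoly 3 R}) (u : 'rV[R]_3),
    [/\ dotv v u = 1,
        (forall P x, evalp (s P) x = evalp P (x - dotv v x *: u)),
        (forall P, divides (linear_form v) (P - s P)) &
        (forall P, divides (linear_form v) P <-> s P = 0)].
Proof.
move=> v0; have [i0 vi0] := row_neq0 v0.
pose hs (i : 'I_3) : mpoly 3 R :=
  mpolyX R (mnm1 i) - (if i == i0 then (v 0 i0)^-1 *: linear_form v else 0).
pose s : {rmorphism mpoly 3 R -> mpoly 3 R} := mmap (@mpolyC 3 R) hs.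
pose u : 'rV[R]_3 := (v 0 i0)^-1 *: delta_mx 0 i0.
have vu : dotv v u = 1 by rewrite dotvZr dotv_delta mulVf.
have sE P x : evalp (s P) x = evalp P (x - dotv v x *: u).
  elim/mpolyind: P => [|a m p _ _ ih]; first by rewrite rmorph0 !evalp0.
  rewrite rmorphD /= evalpD ih [in RHS]evalpD; congr (_ + _).
  rewrite mmapZ mmapX evalpM /evalp mevalC mevalZ; congr (_ * _).
  rewrite mevalX /mmap1 rmorph_prod; apply: eq_bigr => i _ /=.
  rewrite rmorphXn /=; congr (_ ^+ _); rewrite mevalB mevalXU !mxE /=.
  case: eqP => _ /=; last by rewrite meval0 !mulr0.
  by rewrite mevalZ -/(evalp _ _) evalp_linear_form mulr1 mulrC.
have sd P : divides (linear_form v) (P - s P).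
  have {1}<- : mmap (@mpolyC 3 R) (fun i => mpolyX R (mnm1 i)) P = P.
    elim/mpolyind: P => [|c m p _ _ ih]; first by rewrite rmorph0.
    by rewrite rmorphD /= ih mmapZ mmapX mul_mpolyC mmap1_id.
  apply: divides_mmapB => i; rewrite /hs opprB addrCA subrr addr0.
  by case: eqP => _; [apply: dividesZ; apply: dividesxx|apply: divides0].
exists s, u; split=> // P; split=> [[T ->]|sP].
  rewrite rmorphM /=; have -> : s (linear_form v) = 0; last by rewrite mul0r.
  apply: evalp_eq0 => x; rewrite sE evalp_linear_form -scaleNr dotvDr dotvZr.
  by rewrite vu mulr1 subrr.
by have := sd P; rewrite sP subr0.
Qed.

(** The retraction onto the plane sends P to the polynomial function
    obtained by composing P with the projection to that plane. *)
Lemma linear_form_dvdP v P : v != 0 ->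
  divides (linear_form v) P <-> (forall x, dotv v x = 0 -> evalp P x = 0).
Proof.
move=> v0; split=> [[T ->] x vx|h].
  by rewrite evalpM evalp_linear_form vx mul0r.
have [s [u [vu sE _ sP]]] := linear_form_retraction v0.
apply/sP/evalp_eq0 => x; rewrite sE h //.
by rewrite -scaleNr dotvDr dotvZr vu mulr1 subrr.
Qed.

Lemma linear_form_prime v S T : v != 0 ->
  divides (linear_form v) (S * T) ->
  divides (linear_form v) S \/ divides (linear_form v) T.
Proof.
move=> /linear_form_retraction[s [_ [_ _ _ sP]]] /sP; rewrite rmorphM /= => /eqP.
by rewrite mulf_eq0 => /orP[] /eqP /sP; [left|right].
Qed.

Lemma linear_form_dvd_linear v w : v != 0 ->
  divides (linear_form v) (linear_form w) -> exists c, w = c *: v.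
Proof.
move=> v0 /(linear_form_dvdP _ v0) h; have [i0 vi0] := row_neq0 v0.
exists (w 0 i0 / v 0 i0); apply/rowP => j; rewrite mxE.
have := h (v 0 i0 *: delta_mx 0 j + (- v 0 j) *: delta_mx 0 i0).
rewrite evalp_linear_form !dotvDr !dotvZr !dotv_delta.
rewrite mulrC mulNr mulrC subrr => /(_ erefl) e.
apply: (mulIf vi0); rewrite mulrAC divfK //; lra.
Qed.

(** The normalised multiple of a vector, whose first nonzero coordinate is 1:
    a representative of its projective class. *)
Definition cano v : 'rV[R]_3 :=
  if [pick i | v 0 i != 0] is Some i then (v 0 i)^-1 *: v else v.

Lemma canoZ c v : c != 0 -> cano (c *: v) = cano v.
Proof.
move=> c0; rewrite /cano (eq_pick (Q := fun i => v 0 i != 0)); last first.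
  by move=> i; rewrite mxE mulf_eq0 (negbTE c0).
case: pickP => [i vi|h].
  by rewrite mxE scalerA invfM mulrAC mulVf // mul1r.
have -> : v = 0 by apply/rowP => i; rewrite mxE; apply/eqP; have /negbFE := h i.
by rewrite scaler0.
Qed.

Lemma cano_scale v : v != 0 -> exists2 c, c != 0 & cano v = c *: v.
Proof.
move=> v0; rewrite /cano; case: pickP => [i vi|_]; last by exists 1; rewrite ?oner_eq0 ?scale1r.
by exists (v 0 i)^-1; rewrite ?invr_eq0.
Qed.

Lemma cano_eqP v w : v != 0 -> w != 0 ->
  cano v = cano w <-> exists2 c, c != 0 & w = c *: v.
Proof.
move=> v0 w0; split=> [|[c c0 ->]]; last by rewrite canoZ.
have [a a0 ->] := cano_scale v0; have [b b0 ->] := cano_scale w0 => e.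
exists (b^-1 * a); first by rewrite mulf_neq0 ?invr_eq0.
by rewrite -scalerA e scalerA mulVf ?scale1r.
Qed.

(** Matching one factor at a time, a product of linear forms determines its
    factors modulo [d] up to order and scalars, as soon as all of them but one
    at most ([E]) have to occur in every product of linear forms that they
    divide modulo [d]; the last factor is found because [d] divides no linear
    form. *)
Lemma linear_factors_uniq (d : mpoly 3 R) (E : pred 'rV[R]_3)
    (d_reg : forall v S, v != 0 -> divides d (linear_form v * S) -> divides d S)
    (d_lin : forall v, divides d (linear_form v) -> v = 0)
    (E_mem : forall v c ws T, E v -> v != 0 -> c != 0 -> all (fun w => w != 0) ws ->
       divides d (c *: \prod_(w <- ws) linear_form w - linear_form v * T) ->
       exists2 w, w \in ws & cano w = cano v) vs ws c :
  all (fun w => w != 0) vs -> all (fun w => w != 0) ws -> size vs = size ws ->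
  c != 0 -> (count (predC E) vs <= 1)%N ->
  divides d (c *: \prod_(w <- ws) linear_form w - \prod_(v <- vs) linear_form v) ->
  perm_eq (map cano vs) (map cano ws).
Proof.
have [n] := ubnP (size vs); elim: n => // n IH in vs ws c * => sn vs0 ws0 sz c0 nE dvd.
have [/hasP[v vvs Ev]|/hasPn nE'] := boolP (has E vs).
  have v0 := allP vs0 v vvs.
  have pvs := perm_to_rem vvs.
  have dvd' := dvd; rewrite (perm_big _ pvs) /= big_cons in dvd'.
  have [w wws e] := E_mem v c ws _ Ev v0 c0 ws0 dvd'.
  have pws := perm_to_rem wws; have w0 := allP ws0 w wws.
  have [b b0 wE] := (cano_eqP v0 w0).1 (esym e).
  rewrite (permPl (perm_map cano pvs)) (permPr (perm_map cano pws)) /= e perm_cons.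
  apply: (IH _ _ (c * b)).
  - by rewrite size_rem // -ltnS (leq_trans _ sn) // ltnS prednK // -has_predT; apply/hasP; exists v.
  - by apply/allP => u /mem_rem /(allP vs0).
  - by apply/allP => u /mem_rem /(allP ws0).
  - by rewrite !size_rem // sz.
  - by rewrite mulf_neq0.
  - by rewrite (leq_trans _ nE) // (seq.permP pvs) /= Ev.
  - apply: (d_reg v) => //; move: dvd'; rewrite (perm_big _ pws) /= big_cons wE.
    by rewrite linear_formZ -!scalerAl scalerA mulrBr -scalerAr.
move: vs0 nE dvd sz; case: vs sn nE' => [|v [|u vs]] sn nE'.
- by case: ws ws0.
- case: ws ws0 => [|w [|? ?]] //= /andP[w0 _] /andP[v0 _] _.
  rewrite !big_seq1 => dvd _.
  have : c *: w + (-1) *: v = 0.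
    by apply: d_lin; rewrite linear_formE linear_formZ scaleN1r.
  by rewrite scaleN1r => /subr0_eq <-; rewrite canoZ.
- by rewrite /= (nE' v) ?mem_head // (nE' u) // inE mem_head orbT.
Qed.

End LinearForms.

Arguments cano {R} v.
Arguments dotv {R} v x.

(** * Forms modulo a quadratic form *)

Lemma evalp_line (R : realType) (P : mpoly 3 R) (x y : 'rV[R]_3) :
  exists p : {poly R}, forall t, p.[t] = evalp P (x + t *: y).
Proof.
have [p pE] := meval_line P (fun i => x 0 i) (fun i => y 0 i).
by exists p => t; rewrite pE; apply: meval_eq => i; rewrite !mxE.
Qed.

Lemma poly_eq0_off0 (R : numDomainType) (p : {poly R}) :
  (forall t, t != 0 -> p.[t] = 0) -> p = 0.
Proof.
move=> h; apply/eqP; apply: contraT => p0.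
have [|x] := @infinite_field_nonroot R ('X * p); first by rewrite mulf_neq0 ?polyX_eq0.
rewrite /root hornerM hornerX mulf_eq0 negb_or => /andP[/h ->].
by rewrite eqxx.
Qed.

Lemma pihomog_mul (R : realType) d e (Q T : mpoly 3 R) :
  Q \is @ishomog1 3 R d mdeg ->
  pihomog mdeg (d + e) (Q * T) = Q * pihomog mdeg e T.
Proof.
move=> hQ; rewrite {1}(pihomog_partitionE (mf := mdeg) (leqnn (msize T))).
have -> : pihomog mdeg e T = \sum_(j < msize T) pihomog mdeg e (pihomog mdeg j T).
  by rewrite {1}(pihomog_partitionE (mf := mdeg) (leqnn (msize T))) raddf_sum.
rewrite !mulr_sumr raddf_sum; apply: eq_bigr => j _ /=.
have hj := pihomogP mdeg j T; have hQj := dhomogM hQ hj.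
have [je|je] := eqVneq (j : nat) e; first by rewrite je in hj hQj *; rewrite (pihomog_dE hQj) (pihomog_dE hj).
by rewrite (pihomog_ne0 _ hQj) ?eqn_add2l // (pihomog_ne0 je hj) mulr0.
Qed.

Lemma pihomog_mul_small (R : realType) d k (Q T : mpoly 3 R) :
  Q \is @ishomog1 3 R d mdeg -> (k < d)%N -> pihomog mdeg k (Q * T) = 0.
Proof.
move=> hQ kd; rewrite (pihomog_partitionE (mf := mdeg) (leqnn (msize T))).
rewrite !mulr_sumr raddf_sum big1 // => j _ /=.
rewrite (pihomog_ne0 _ (dhomogM hQ (pihomogP mdeg j T))) //.
by rewrite gtn_eqF // (leq_trans kd) ?leq_addr.
Qed.

(** A multiple Q T of Q that is homogeneous of degree k is Q times the
    component of T of degree k - 2. *)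
Lemma VQP (R : realType) (Q : form R 2) k (P : form R k) :
  reflect (divides (Q : mpoly 3 R) P) (P \in VQ Q k).
Proof.
have hP : (P : mpoly 3 R) \is @ishomog1 3 R k mdeg by apply: dhomog_is_dhomog.
have hQ : (Q : mpoly 3 R) \is @ishomog1 3 R 2 mdeg by apply: dhomog_is_dhomog.
have small j (P' : form R j) : (j < 2)%N -> divides (Q : mpoly 3 R) P' -> P' = 0.
  move=> j2 [T PT]; apply: val_inj => /=; have hP' := dhomog_is_dhomog P'.
  by rewrite -(pihomog_dE hP') [X in pihomog _ _ X]PT (pihomog_mul_small _ hQ).
case: k P hP => [|[|j]] P hP /=.
- apply: (iffP idP) => [|/small -> //]; last by rewrite mem0v.
  by rewrite memv0 => /eqP ->; exact: divides0.
- apply: (iffP idP) => [|/small -> //]; last by rewrite mem0v.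
  by rewrite memv0 => /eqP ->; exact: divides0.
apply: (iffP idP) => [/memv_imgP[T _ ->]|[T PT]].
  by rewrite lfunE /=; exists (T : mpoly 3 R).
apply/memv_imgP; exists (DHomog (pihomogP mdeg j T)); first by rewrite memvf.
rewrite lfunE; apply: val_inj => /=; rewrite -[LHS](pihomog_dE hP) [X in pihomog _ _ X]PT.
by rewrite -[j.+2]add2n pihomog_mul.
Qed.

Lemma dim_form (R : realType) k : \dim {: form R k} = 'C(k + 2, 2).
Proof.
rewrite dimvf -bin_sub ?leq_addl // addnK.
by rewrite /dim.
Qed.

(** Multiplication by Q is injective, and C(k + 2, 2) - C(k, 2) = 2 k + 1. *)
Lemma dim_VQ (R : realType) (Q : form R 2) k : Q != 0 ->
  (\dim (VQ Q k) + (2 * k).+1)%N = \dim {: form R k}.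
Proof.
move=> Q0; case: k => [|[|j]] /=; rewrite ?dimv0 dim_form //.
rewrite limg_dim_eq.
  rewrite !dim_form !addn2; have := binS j.+2 1; have := binS j.+3 1.
  by rewrite !bin1; lia.
apply/eqP; rewrite -subv0; apply/subvP => T.
rewrite memv_cap memvf memv_ker lfunE /= => /eqP/(congr1 val)/eqP.
rewrite /= mulf_eq0 => /orP[/eqP h|/eqP h]; last by rewrite memv0; apply/eqP/val_inj.
by case/eqP: Q0; apply: val_inj.
Qed.

Section Orthogonal.
Variables (R : realType) (V : vectType R) (B : {dot V for idfun}) (U : {vspace V}).

Lemma cap_orthov : (orthov B U :&: U = 0)%VS.
Proof.
apply/eqP; rewrite -subv0; apply/subvP => x; rewrite memv_cap => /andP[].
move=> /mem_orthovP h /h /eqP.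
by apply: contraTT; rewrite memv0 => /(@neq0_dnorm_gt0 _ _ _ B) /lt0r_neq0.
Qed.

(** Each of the dim U orthogonality conditions lowers the dimension by at
    most 1, and the positivity of the inner product makes the sum with U
    direct. *)
Lemma dim_orthov : (\dim (orthov B U) + \dim U)%N = \dim {:V}.
Proof.
apply/eqP; rewrite eqn_leq -dimv_disjoint_sum ?cap_orthov // dimvS ?subvf //=.
rewrite dimv_disjoint_sum ?cap_orthov //.
have H (n : nat) (f : 'I_n -> 'Hom(V, R^o)) :
    (\dim {:V} <= \dim (\bigcap_(i < n) lker (f i)) + n)%N.
  elim: n f => [|n IH] f; first by rewrite big_ord0 addn0.
  rewrite big_ord_recr /=; apply: leq_trans (IH (fun i => f (widen_ord (leqnSn n) i))) _.
  set W := (\bigcap_(i < n) _)%VS; rewrite -(limg_ker_dim (f ord_max) W).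
  have : (\dim (f ord_max @: W)%VS <= 1)%N.
    by rewrite (leq_trans (dimvS (subvf _))) // dimvf.
  lia.
exact: H.
Qed.

Lemma addv_orthov : (orthov B U + U = fullv)%VS.
Proof.
apply/eqP; rewrite eqEdim subvf /=.
by rewrite dimv_disjoint_sum ?cap_orthov // dim_orthov.
Qed.

End Orthogonal.

(** * Irreducible quadratic forms *)

Section IrreducibleQuadric.
Variables (R : realType) (Q : form R 2).
Hypothesis Qirr : irreducible_over_C Q.
Implicit Types (v w x : 'rV[R]_3) (P S T : mpoly 3 R).

Lemma irr_neq0 : (Q : mpoly 3 R) != 0.
Proof. by case: Qirr => + _; apply: contraNneq => ->; rewrite rmorph0. Qed.

Lemma map_linear_form_nonunit v :
  map_mpoly (fun t : R => t%:C%C) (linear_form v) \isn't a GRing.unit.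
Proof.
apply/negP => /andP[_]; rewrite mcoeff_map_mpoly.
suff -> : mcoeff mnm0 (linear_form v) = 0 by rewrite raddf0 unitr0.
rewrite raddf_sum big1 // => i _ /=; rewrite mcoeffZ mcoeffX.
by rewrite mnm1_eq0 mulr0.
Qed.

(** A linear factor of Q would be proper, as Q has degree 2. *)
Lemma linear_form_ndvd_irr v : ~ divides (linear_form v) Q.
Proof.
move=> [T QT]; pose f := map_mpoly (real_complex R) : mpoly 3 R -> _.
have fQ : f Q = f (linear_form v) * f T by rewrite QT /f rmorphM.
case: Qirr => _ [_ /(_ _ _ fQ)[|]].
  by apply/negP; apply: map_linear_form_nonunit.
move=> /andP[/eqP]; rewrite mcoeff_map_mpoly => TC _.
(* The cofactor is a constant, so Q would have degree 1. *)
have TE : T = mpolyC 3 (mcoeff mnm0 T).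
  apply/mpolyP => m; have := congr1 (mcoeff m) TC.
  rewrite mcoeff_map_mpoly !mcoeffC => h; apply: (@complexI R).
  by rewrite h rmorphM /= rmorph_nat.
have hQ : (Q : mpoly 3 R) \is @ishomog1 3 R 2 mdeg by apply: dhomog_is_dhomog.
have := dhomog_uniq irr_neq0 hQ.
have h1 : (Q : mpoly 3 R) \is @ishomog1 3 R 1 mdeg.
  by rewrite QT TE mulrC mul_mpolyC; apply: dhomogZ; apply: linear_form_homog.
by move=> /(_ _ h1).
Qed.

(** Q is coprime to the prime v, which then has to divide the cofactor
    of Q. *)
Lemma irr_dvd_cancel v S : v != 0 ->
  divides (Q : mpoly 3 R) (linear_form v * S) -> divides (Q : mpoly 3 R) S.
Proof.
move=> v0 [T e]; have : divides (linear_form v) ((Q : mpoly 3 R) * T).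
  by exists S.
case/(linear_form_prime v0) => [/linear_form_ndvd_irr //|[T' TE]].
exists T'; apply: (@mulfI _ (linear_form v)); first by rewrite linear_form_eq0.
by rewrite e TE mulrCA.
Qed.

Lemma irr_evalp0 : evalp Q 0 = 0.
Proof.
have := @evalp_homog R 2 Q 0 0 (dhomog_is_dhomog Q).
by rewrite scale0r expr0n mul0r.
Qed.

Lemma irr_ndvd_const c : divides (Q : mpoly 3 R) (c *: 1) -> c = 0.
Proof.
move=> [T /(congr1 (fun P => evalp P 0))].
by rewrite evalpM irr_evalp0 mul0r evalpZ evalp1 mulr1.
Qed.

Lemma irr_ndvd_prod vs c : all (fun v => v != 0) vs ->
  divides (Q : mpoly 3 R) (c *: \prod_(v <- vs) linear_form v) -> c = 0.
Proof.
elim: vs => [|v vs IH] /=; first by rewrite big_nil => _; apply: irr_ndvd_const.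
move=> /andP[v0 vs0]; rewrite big_cons scalerAr => /(irr_dvd_cancel v0).
exact: IH.
Qed.

Lemma irr_ndvd_linear v : divides (Q : mpoly 3 R) (linear_form v) -> v = 0.
Proof.
move=> h; apply/eqP; apply: contraT => v0; have := oner_eq0 R.
rewrite -(@irr_ndvd_prod [:: v] 1) ?eqxx //= ?v0 //.
by rewrite big_seq1 scale1r.
Qed.

(** The line of the plane v^\bot is elliptic when it misses the real conic,
    hence meets the complex one in two conjugate points. *)
Definition elliptic v := forall x, x != 0 -> dotv v x = 0 -> evalp Q x != 0.

Lemma orth2_neq0 v w : exists2 x, x != 0 & dotv v x = 0 /\ dotv w x = 0.
Proof.
pose M := row_mx v^T w^T : 'M[R]_(3, 1 + 1).
have k0 : kermx M != 0.
  by rewrite kermx_eq0 -row_leq_rank -ltnNge (leq_ltn_trans (rank_leq_col _)).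
exists (nz_row (kermx M)); first by rewrite nz_row_eq0.
have := nz_row_sub (kermx M); set x := nz_row _ => /sub_kermxP.
rewrite mul_mx_row => e.
have dE u : x *m u^T = 0 -> dotv u x = 0.
  move=> /matrixP/(_ 0 0); rewrite !mxE => <-; apply: eq_bigr => i _.
  by rewrite mxE mulrC.
split; apply: dE.
  by have := congr1 lsubmx e; rewrite row_mxKl => ->; apply/matrixP => i j; rewrite !mxE.
by have := congr1 rsubmx e; rewrite row_mxKr => ->; apply/matrixP => i j; rewrite !mxE.
Qed.

(** Nullstellensatz for the line where two planes meet. *)
Lemma two_linear_formsP v w T : v != 0 -> ~ (exists c, w = c *: v) ->
  (forall x, x != 0 -> dotv v x = 0 /\ dotv w x = 0 -> evalp T x = 0) ->
  exists A B, T = linear_form v * A + linear_form w * B.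
Proof.
move=> v0 wv hT0; have hT x : dotv v x = 0 -> dotv w x = 0 -> evalp T x = 0.
  move=> vx wx; have [->|x0] := eqVneq x 0; last exact: hT0.
  have [y y0 [vy wy]] := orth2_neq0 v w; have [p pE] := evalp_line T 0 y.
  have := pE 0; rewrite scale0r addr0 => <-.
  rewrite (@poly_eq0_off0 _ p) ?horner0 // => t t0; rewrite pE add0r.
  by apply: hT0; rewrite ?scaler_eq0 ?negb_or ?t0 // !dotvZr vy wy mulr0.
have [s [u [vu sE sd _]]] := linear_form_retraction v0.
pose w' := w + (- dotv w u) *: v.
have w'0 : w' != 0.
  by apply/eqP => /eqP; rewrite /w' scaleNr subr_eq0 => /eqP h; case: wv; exists (dotv w u).
have [|B sT] := (linear_form_dvdP (s T) w'0).2 _.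
  move=> x w'x; rewrite sE -scaleNr; apply: hT.
    by rewrite dotvDr dotvZr vu mulr1 subrr.
  by rewrite -[RHS]w'x dotvDr dotvDl dotvZr dotvZl; ring.
have [A TA] := sd T.
exists (A - dotv w u *: B), B; rewrite -[LHS](subrK (s T)) TA sT /w'.
by rewrite addrC [w + _]addrC linear_formE scaleNr mulrBr -scalerAr mulrDl mulNr -scalerAl addrC addrA.
Qed.

(** Write c w1 ... wn = Q S + v A and suppose that w1 is not proportional to
    v. The lines v = 0 and w1 = 0 meet at a point where Q does not vanish, since
    v is elliptic; so S vanishes there and lies in the ideal (v, w1). The prime v
    then divides w1 times (c w2 ... wn - Q B) for some B, and w1 can be
    cancelled. *)
Lemma elliptic_factor v c ws T : elliptic v -> v != 0 -> c != 0 ->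
  all (fun w => w != 0) ws ->
  divides (Q : mpoly 3 R) (c *: \prod_(w <- ws) linear_form w - linear_form v * T) ->
  exists2 w, w \in ws & cano w = cano v.
Proof.
move=> ev v0 c0 ws0 [S e].
have {e} : exists S' A, c *: \prod_(w <- ws) linear_form w = (Q : mpoly 3 R) * S' + linear_form v * A.
  by exists S, T; rewrite -e subrK.
elim: ws ws0 => [_ [S' [A /(congr1 (fun P => evalp P 0))]]|w ws IH /= /andP[w0 ws0]].
  rewrite big_nil evalpZ evalp1 evalpD !evalpM irr_evalp0 evalp_linear_form.
  by rewrite dotv0r !mul0r addr0 mulr1 => c0'; rewrite c0' eqxx in c0.
move=> [S' [A e]].
have [h|vw] := eqVneq (cano w) (cano v); first by exists w; rewrite ?mem_head //.
have wv : ~ exists a, w = a *: v.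
  move=> [a wa]; case/eqP: vw; rewrite wa canoZ //.
  by apply: contraNneq w0 => a0; rewrite wa a0 scale0r.
have [x x0 [vx wx]|A' [B' SE]] := @two_linear_formsP v w S' v0 wv.
  have := congr1 (fun P => evalp P x) e.
  rewrite big_cons scalerAr !(evalpD, evalpM, evalp_linear_form) vx wx !mul0r addr0.
  by move/esym/eqP; rewrite mulf_eq0 (negbTE (ev x x0 vx)) => /eqP.
have [|u uws ue] := IH ws0 _; last by exists u => //; rewrite inE uws orbT.
have : divides (linear_form v) (linear_form w *
    (c *: \prod_(j <- ws) linear_form j - (Q : mpoly 3 R) * B')).
  exists ((Q : mpoly 3 R) * A' + A); rewrite big_cons scalerAr in e.
  by rewrite mulrBr e SE; ring.
case/(linear_form_prime v0) => [/(linear_form_dvd_linear v0) //|[A'' e'']].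
by exists B', A''; rewrite -e'' addrC subrK.
Qed.

(** Linear factors can be cancelled modulo Q, and the elliptic ones have to
    occur in both products. *)
Lemma linear_factors_uniq_modQ vs ws c :
  all (fun v => v != 0) vs -> all (fun w => w != 0) ws -> size vs = size ws ->
  c != 0 -> (count (fun v => ~~ `[< elliptic v >]) vs <= 1)%N ->
  divides (Q : mpoly 3 R)
    (c *: \prod_(w <- ws) linear_form w - \prod_(v <- vs) linear_form v) ->
  perm_eq (map cano vs) (map cano ws).
Proof.
apply: linear_factors_uniq => [v S|v|v a us T /asboolP].
- exact: irr_dvd_cancel.
- exact: irr_ndvd_linear.
- exact: elliptic_factor.
Qed.

End IrreducibleQuadric.

(** The case d = 0, where every nonzero linear form has to occur because it
    is prime. *)
Lemma linear_factorization_uniq (R : realType) (vs ws : seq 'rV[R]_3) c :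
  all (fun v => v != 0) vs -> all (fun w => w != 0) ws -> size vs = size ws ->
  c != 0 -> c *: \prod_(w <- ws) linear_form w = \prod_(v <- vs) linear_form v ->
  perm_eq (map cano vs) (map cano ws).
Proof.
move=> vs0 ws0 sz c0 e.
apply: (@linear_factors_uniq R 0 predT _ _ _ vs ws c) => //.
- move=> v S v0 /divides0P/eqP; rewrite mulf_eq0 linear_form_eq0 (negbTE v0) /=.
  by move=> /eqP ->; apply: divides0.
- by move=> v /divides0P/eqP; rewrite linear_form_eq0 => /eqP.
- move=> {vs ws c vs0 ws0 sz c0 e} v c ws T _ v0 c0 ws0 /divides0P/subr0_eq e.
  have : divides (linear_form v) (c *: \prod_(w <- ws) linear_form w) by rewrite e; exists T.
  move/(dividesZ c^-1); rewrite scalerA mulVf // scale1r {e}.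
  elim: ws ws0 => [_|w ws IH /= /andP[w0 ws0]].
    rewrite big_nil => -[S /(congr1 (fun P => evalp P 0))].
    by rewrite evalp1 evalpM evalp_linear_form dotv0r mul0r => /eqP; rewrite oner_eq0.
  rewrite big_cons => /(linear_form_prime v0)[/(linear_form_dvd_linear v0)[a wa]|/(IH ws0)[u uws ue]].
    exists w; rewrite ?mem_head // wa canoZ //.
    by apply: contraNneq w0 => a0; rewrite wa a0 scale0r.
  by exists u => //; rewrite inE uws orbT.
- by rewrite (eq_count (a2 := pred0)) ?count_pred0.
- by rewrite e subrr; apply: divides0.
Qed.

(** * Conics *)

Section BilinearForm.
Variable A : comNzRingType.
Implicit Types (s : 'I_3 -> 'I_3 -> A) (p q : 'I_3 -> A).

(** The value is computed in an arbitrary commutative ring, so as to apply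
    over the complex numbers and to polynomials as well. *)
Definition bil s p q : A := \sum_i \sum_j s i j * p i * q j.

Lemma bilDl s p p' q : bil s (fun i => p i + p' i) q = bil s p q + bil s p' q.
Proof.
rewrite -big_split; apply: eq_bigr => i _; rewrite -big_split.
by apply: eq_bigr => j _ /=; rewrite mulrDr mulrDl.
Qed.

Lemma bilZl s a p q : bil s (fun i => a * p i) q = a * bil s p q.
Proof.
rewrite mulr_sumr; apply: eq_bigr => i _; rewrite mulr_sumr.
by apply: eq_bigr => j _ /=; rewrite mulrCA !mulrA.
Qed.

Lemma bilC s p q : (forall i j, s i j = s j i) -> bil s p q = bil s q p.
Proof.
move=> ss; rewrite /bil exchange_big; apply: eq_bigr => i _.
by apply: eq_bigr => j _; rewrite ss mulrAC.
Qed.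

Lemma eq_bil s p p' q q' : p =1 p' -> q =1 q' -> bil s p q = bil s p' q'.
Proof.
by move=> e e'; apply: eq_bigr => i _; apply: eq_bigr => j _; rewrite e e'.
Qed.

Lemma bil_comb3 s (ss : forall i j, s i j = s j i) a b c p q r :
  let v := fun i => a * p i + b * q i + c * r i in
  bil s v v = a ^+ 2 * bil s p p + b ^+ 2 * bil s q q + c ^+ 2 * bil s r r
    + (a * b * bil s p q + a * c * bil s p r + b * c * bil s q r) *+ 2.
Proof.
move=> v; have vl x : bil s v x = a * bil s p x + b * bil s q x + c * bil s r x.
  by rewrite /v !bilDl !bilZl.
rewrite vl !(bilC _ v ss) !vl (bilC q p ss) (bilC r p ss) (bilC r q ss).
by rewrite mulr2n; ring.
Qed.

End BilinearForm.

Lemma bil_rmorph (A A' : comNzRingType) (f : {rmorphism A -> A'}) s p q :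
  bil (fun i j => f (s i j)) (fun i => f (p i)) (fun i => f (q i)) = f (bil s p q).
Proof.
rewrite rmorph_sum; apply: eq_bigr => i _; rewrite rmorph_sum.
by apply: eq_bigr => j _; rewrite !rmorphM.
Qed.

Lemma mdegS_split n (m : multinom n) k : mdeg m = k.+1 ->
  exists i m', m = mnm_add (mnm1 i) m' /\ mdeg m' = k.
Proof.
move=> mk; have [i mi] : exists i, m i != 0%N.
  apply/existsP; apply: contraT => /existsPn h; move: mk; rewrite mdegE big1 // => i _.
  by apply/eqP; have := h i; rewrite negbK.
have e : m = mnm_add (mnm1 i) (mnm_sub m (mnm1 i)).
  rewrite addmC submK //; apply/mnm_lepP => j; rewrite mnm1E.
  by case: eqP => // <-; rewrite lt0n.
exists i, (mnm_sub m (mnm1 i)); split=> //.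
by move: mk; rewrite {1}e mdegD mdeg1 add1n => -[].
Qed.

Section Quadratic.
Variables (R : realType) (Q : form R 2).

(** Each monomial of Q is a product of two variables; the symmetric matrix
    is obtained by averaging. *)
Lemma quad_bil : exists s : 'I_3 -> 'I_3 -> R, (forall i j, s i j = s j i) /\
  forall (A : comNzRingType) (f : {rmorphism R -> A}) h,
    mmap f h (Q : mpoly 3 R) = bil (fun i j => f (s i j)) h h.
Proof.
have hQ : (Q : mpoly 3 R) \is @ishomog1 3 R 2 mdeg by apply: dhomog_is_dhomog.
have [q qE] : exists q : 'I_3 -> 'I_3 -> R,
    forall (A : comNzRingType) (f : {rmorphism R -> A}) h,
    mmap f h (Q : mpoly 3 R) = bil (fun i j => f (q i j)) h h.
  rewrite (mpolyE (Q : mpoly 3 R)) big_seq.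
  elim/big_rec: _ => [|m p mQ [q qE]].
    exists (fun _ _ => 0) => A f h; rewrite rmorph0 /bil big1 // => i _.
    by rewrite big1 // => j _; rewrite rmorph0 !mul0r.
  have := dhomog_mf hQ mQ => /mdegS_split[i [m' [-> /eqP/mdeg1P[j /eqP ->]]]].
  set c := mcoeff _ _.
  exists (fun a b => q a b + c * ((a == i) && (b == j))%:R) => A f h.
  rewrite rmorphD /= qE mmapZ mmapX commr_mmap1_M; last by move=> *; apply: mulrC.
  rewrite !mmap1U addrC /bil.
  have -> : f c * (h i * h j) =
     \sum_a \sum_b f (c * ((a == i) && (b == j))%:R) * h a * h b.
    rewrite (bigD1 i) //= [X in _ + X]big1 ?addr0; last first.
      move=> a ai; rewrite big1 // => b _.
      by rewrite (negbTE ai) mulr0 rmorph0 !mul0r.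
    rewrite (bigD1 j) //= big1 ?addr0; last first.
      by move=> b bj; rewrite eqxx (negbTE bj) mulr0 rmorph0 !mul0r.
    by rewrite !eqxx mulr1 mulrA.
  rewrite -big_split; apply: eq_bigr => a _; rewrite -big_split.
  by apply: eq_bigr => b _; rewrite rmorphD !mulrDl.
exists (fun i j => (q i j + q j i) / 2); split=> [i j|A f h]; first by rewrite addrC.
rewrite qE; pose t i j := f (q i j / 2) * h i * h j.
have -> : bil (fun i j => f ((q i j + q j i) / 2)) h h =
   \sum_i \sum_j t i j + \sum_i \sum_j t j i.
  rewrite -big_split; apply: eq_bigr => i _; rewrite -big_split.
  by apply: eq_bigr => j _; rewrite /t /= mulrDl rmorphD !mulrDl (mulrAC (f (q j i / 2))).
rewrite [X in _ + X]exchange_big /= -big_split; apply: eq_bigr => i _.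
rewrite -big_split; apply: eq_bigr => j _; rewrite /t /= -!mulrDl -rmorphD.
by congr (f _ * _ * _); field.
Qed.

End Quadratic.

(** The restriction of a form of degree k to a conic parametrised by
    a + t c + t^2 b has degree at most 2 k, and its top coefficient is the value
    of the form at the point at infinity b. *)
Section ConicRestriction.
Variables (R A : comNzRingType) (f : {rmorphism R -> A}) (a c b : 'I_3 -> A).

Definition conic_poly (i : 'I_3) : {poly A} :=
  (a i)%:P + (c i)%:P * 'X + (b i)%:P * 'X^2.

Definition conic_restr (P : mpoly 3 R) : {poly A} :=
  mmap (@polyC A \o f) conic_poly P.

Lemma horner_conic_restr P t :
  (conic_restr P).[t] = mmap f (fun i => a i + c i * t + b i * t ^+ 2) P.
Proof.
elim/mpolyind: P => [|x m p _ _ ih].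
  by rewrite /conic_restr !rmorph0 horner0.
rewrite /conic_restr !rmorphD /= hornerD [in LHS]ih; congr (_ + _).
rewrite !mmapZ !mmapX hornerM hornerC /mmap1 horner_prod; congr (_ * _).
by apply: eq_bigr => i _; rewrite horner_exp /conic_poly !hornerE.
Qed.

Let top (d : nat) (p : {poly A}) (x : A) := (size p <= d.+1)%N /\ p`_d = x.

Let topM d e p q x y : top d p x -> top e q y -> top (d + e) (p * q) (x * y).
Proof.
move=> [sp <-] [sq <-]; split.
  apply: leq_trans (size_polyMleq _ _) _.
  by rewrite -ltnS; case: (size p + size q)%N (leq_add sp sq) => //= n; lia.
have h : (d < (d + e).+1)%N by lia.
rewrite coefM (bigD1 (Ordinal h)) //= addKn big1 ?addr0 // => i ne.
have {}ne : (i : nat) <> d by move=> e'; case/eqP: ne; apply/val_inj.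
case: (ltnP i d) => id.
  by rewrite [q`__]nth_default ?mulr0 // (leq_trans sq) //; lia.
by rewrite nth_default ?mul0r // (leq_trans sp) //; lia.
Qed.

Lemma conic_restr_top k (P : mpoly 3 R) : P \is @ishomog1 3 R k mdeg ->
  (size (conic_restr P) <= (2 * k).+1)%N /\ (conic_restr P)`_(2 * k) = mmap f b P.
Proof.
move=> /dhomogP hP; rewrite -/(top (2 * k) _ _) /conic_restr {1 2}(mpolyE P).
rewrite !rmorph_sum /= big_seq [X in top _ _ X]big_seq.
elim/big_rec2: _ => [|m y p mP [sy <-]].
  by split; rewrite ?size_poly0 ?coef0.
have [sm <-] : top (2 * k) (mmap (@polyC A \o f) conic_poly (mcoeff m P *: mpolyX R m))
                   (mmap f b (mcoeff m P *: mpolyX R m)).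
  rewrite !mmapZ !mmapX -(add0n (2 * k)%N); apply: topM.
    by split; rewrite ?size_polyC_leq1 ?coefC.
  have <- : mdeg m = k := hP m mP.
  rewrite mdegE big_distrr /= /mmap1.
  elim/big_rec3: _ => [|i d x q _ h]; first by split; rewrite ?size_poly1 ?coef1.
  apply: topM => //; elim: (m i) => [|n IH]; first by split; rewrite ?size_poly1 ?coef1.
  rewrite mulnS !exprS; apply: topM => //; split.
    rewrite /conic_poly (leq_trans (size_polyD _ _)) // geq_max.
    rewrite (leq_trans (size_polyD _ _)) /= ?geq_max.
      rewrite (leq_trans (size_polyMleq _ _)) // size_polyXn.
      by have := size_polyC_leq1 (b i); lia.
    rewrite (leq_trans (size_polyC_leq1 _)) //= (leq_trans (size_polyMleq _ _)) //.
    by rewrite size_polyX; have := size_polyC_leq1 (c i); lia.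
  by rewrite /conic_poly !coefD coefC coefMX coefC coefMXn /= coefC !add0r.
split; first by rewrite (leq_trans (size_polyD _ _)) // geq_max sm.
by rewrite coefD.
Qed.

End ConicRestriction.

(** * Completely factorable representatives for a definite quadratic form *)

Section MulLinear.
Variables (R : realType) (v : 'rV[R]_3).

Definition mul_linear j (A : form R j) : form R j.+1 :=
  DHomog (dhomogM (linear_form_homog v) (dhomog_is_dhomog A)).

Lemma mul_linear_is_linear j : linear (@mul_linear j).
Proof. by move=> c S T; apply: val_inj; rewrite /= mulrDr -scalerAr. Qed.

HB.instance Definition _ j :=
  GRing.isLinear.Build R (form R j) (form R j.+1) _ (@mul_linear j)
    (@mul_linear_is_linear j).

Lemma dim_mul_linear j (U : {vspace form R j}) : v != 0 ->
  \dim (linfun (@mul_linear j) @: U)%VS = \dim U.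
Proof.
move=> v0; rewrite limg_dim_eq //; apply/eqP; rewrite -subv0; apply/subvP => T.
rewrite memv_cap memv_ker lfunE /= => /andP[_ /eqP/(congr1 val)/eqP].
rewrite /= mulf_eq0 linear_form_eq0 (negbTE v0) => /eqP h.
by rewrite memv0; apply/eqP/val_inj.
Qed.

End MulLinear.

Section Definite.
Variables (R : realType) (Q : form R 2).
Hypothesis Qdef : definite Q.
Local Notation C := R[i].
Local Notation toC := (real_complex R).

Lemma definite_anisotropic x : x != 0 -> evalp Q x != 0.
Proof. by case: Qdef => h /h; [exact: lt0r_neq0|exact: ltr0_neq0]. Qed.

Lemma definite_elliptic v : elliptic Q v.
Proof. by move=> x x0 _; apply: definite_anisotropic. Qed.

Variable s : 'I_3 -> 'I_3 -> R.
Hypothesis ss : forall i j, s i j = s j i.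
Hypothesis sQ : forall (A : comNzRingType) (f : {rmorphism R -> A}) h,
    mmap f h (Q : mpoly 3 R) = bil (fun i j => f (s i j)) h h.

Let sC i j := toC (s i j).
Let fn (x : 'rV[R]_3) i := x 0 i.

Let evalpQ x : evalp Q x = bil s (fn x) (fn x).
Proof. exact: (sQ idfun). Qed.

Let bil_dotv x y : bil s (fn x) (fn y) = dotv (\row_j \sum_i s i j * x 0 i) y.
Proof.
rewrite /bil exchange_big; apply: eq_bigr => j _; rewrite mxE mulr_suml.
by apply: eq_bigr.
Qed.

(** Gram-Schmidt: two orthogonality conditions in a space of dimension 3
    leave a nonzero vector, and a definite form does not vanish on it. The sign
    of d is that of Q. *)
Lemma definite_orthonormal : exists e1 e2 e3 : 'rV[R]_3, exists2 d : R, d != 0 &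
  [/\ evalp Q e1 = d, evalp Q e2 = d, evalp Q e3 = d &
   [/\ bil s (fn e1) (fn e2) = 0, bil s (fn e1) (fn e3) = 0 &
       bil s (fn e2) (fn e3) = 0]].
Proof.
have [d d0 hd] : exists2 d : R, d != 0 & forall x, x != 0 -> 0 < d * evalp Q x.
  case: Qdef => h; [exists 1|exists (-1)]; rewrite ?oppr_eq0 ?oner_eq0 // => x /h.
    by rewrite mul1r.
  by rewrite mulN1r oppr_gt0.
have scale x : x != 0 -> exists2 c : R, c != 0 & evalp Q (c *: x) = d.
  move=> x0; have h := hd x x0.
  have Qx0 : evalp Q x != 0 by apply: contraTneq h => ->; rewrite mulr0 ltxx.
  have h' : 0 < d / evalp Q x.
    have -> : d / evalp Q x = d * evalp Q x / evalp Q x ^+ 2 by field.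
    by rewrite divr_gt0 // exprn_even_gt0.
  exists (Num.sqrt (d / evalp Q x)); first by rewrite sqrtr_eq0 -ltNge.
  by rewrite (evalp_homog _ _ (dhomog_is_dhomog Q)) sqr_sqrtr ?ltW // divfK.
have x1 : (delta_mx 0 0 : 'rV[R]_3) != 0.
  by apply/eqP => /rowP/(_ 0)/eqP; rewrite !mxE !eqxx oner_eq0.
pose S (x : 'rV[R]_3) : 'rV[R]_3 := \row_j \sum_i s i j * x 0 i.
set y1 := delta_mx _ _ in x1.
have [y2 x2 [o12 _]] := orth2_neq0 (S y1) (S y1).
have [y3 x3 [o13 o23]] := orth2_neq0 (S y1) (S y2).
have [c1 c10 q1] := scale _ x1; have [c2 c20 q2] := scale _ x2.
have [c3 c30 q3] := scale _ x3.
exists (c1 *: y1), (c2 *: y2), (c3 *: y3); exists d => //; split=> //.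
have bz c x c' y : dotv (S x) y = 0 -> bil s (fn (c *: x)) (fn (c' *: y)) = 0.
  move=> h; rewrite (@eq_bil _ _ _ (fun i => c * fn x i) _ (fun i => c' * fn y i)); last 2 first.
  - by move=> i; rewrite /fn mxE.
  - by move=> i; rewrite /fn mxE.
  by rewrite bilZl bilC // bilZl bilC // bil_dotv h !mulr0.
by split; apply: bz.
Qed.

(** Over the complex numbers the conic is parametrised by
    (1 - t^2, 2 t, i (1 + t^2)) in an orthonormal basis, so that P restricts to
    a polynomial in t; it has a root unless it is constant, in which case P
    vanishes at the point at infinity. *)
Lemma definite_common_zero k (P : form R k.+1) : exists p : 'I_3 -> C,
  [/\ exists i, p i != 0, bil sC p p = 0 & mmap toC p (P : mpoly 3 R) = 0].
Proof.
have [e1 [e2 [e3 [d d0 [q1 q2 q3 [o12 o13 o23]]]]]] := definite_orthonormal.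
have hP : (P : mpoly 3 R) \is @ishomog1 3 R k.+1 mdeg by apply: dhomog_is_dhomog.
pose E (x : 'rV[R]_3) i := toC (x 0 i).
have sCs i j : sC i j = sC j i by rewrite /sC ss.
have bE x y : bil sC (E x) (E y) = toC (bil s (fn x) (fn y)).
  exact: (bil_rmorph toC).
have bp a b c : let p := fun i => a * E e1 i + b * E e2 i + c * E e3 i in
    bil sC p p = toC d * (a ^+ 2 + b ^+ 2 + c ^+ 2) /\
    bil sC p (E e1) = toC d * a /\ bil sC p (E e3) = toC d * c.
  move=> p; split; last split.
  - by rewrite bil_comb3 // !bE o12 o13 o23 -!evalpQ q1 q2 q3 rmorph0 mulr2n; ring.
  - by rewrite /p !bilDl !bilZl !bE (bilC (fn e2) _ ss) (bilC (fn e3) _ ss) o12 o13 -evalpQ q1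
       rmorph0; ring.
  - by rewrite /p !bilDl !bilZl !bE o13 o23 -evalpQ q3 rmorph0; ring.
have dC0 : toC d != 0 by rewrite fmorph_eq0.
have nz a b c : (a != 0) || (c != 0) -> exists i, a * E e1 i + b * E e2 i + c * E e3 i != 0.
  move=> ac; apply/existsP; apply: contraT => /existsPn h.
  have [_ [ha hc]] := bp a b c.
  have z y : bil sC (fun i => a * E e1 i + b * E e2 i + c * E e3 i) y = 0.
    rewrite /bil big1 // => i _; rewrite big1 // => j _.
    by have /negPn/eqP -> := h i; rewrite mulr0 mul0r.
  move: ac; rewrite z in ha; rewrite z in hc.
  have /eqP := ha; rewrite eq_sym mulf_eq0 (negbTE dC0) /= => ->.
  by have /eqP := hc; rewrite eq_sym mulf_eq0 (negbTE dC0) /= => ->.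
pose a i := 1 * E e1 i + 0 * E e2 i + 'i%C * E e3 i.
pose c i := 0 * E e1 i + 2 * E e2 i + 0 * E e3 i.
pose b i := (-1) * E e1 i + 0 * E e2 i + 'i%C * E e3 i.
have i2 : 'i%C ^+ 2 = -1 :> C by rewrite sqr_i.
have [/closed_rootP[t /rootP]|] := boolP (size (conic_restr toC a c b P) != 1%N).
  rewrite horner_conic_restr => Pt.
  pose p i := (1 - t ^+ 2) * E e1 i + (2 * t) * E e2 i + ('i%C * (1 + t ^+ 2)) * E e3 i.
  have pE i : a i + c i * t + b i * t ^+ 2 = p i by rewrite /a /c /b /p; ring.
  exists p; split.
  - apply: nz; have [h|//] := eqVneq (1 - t ^+ 2) 0.
    rewrite mulf_neq0 //; first by apply/eqP => h'; move: i2; rewrite h' expr0n => /esym/eqP;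
      rewrite oppr_eq0 oner_eq0.
    by move/subr0_eq : h => <-; rewrite -[1 + 1]/(2%:R) (pnatr_eq0 _ 2).
  - by rewrite (bp _ _ _).1 !exprMn i2; ring.
  - by rewrite -Pt; apply: eq_bigr => m _; congr (_ * _); apply: mmap1_eq => i; rewrite pE.
rewrite negbK => /eqP sz; exists b; split.
- by apply: nz; rewrite oppr_eq0 oner_eq0.
- by rewrite (bp _ _ _).1 sqrrN i2; ring.
- by have [_ <-] := conic_restr_top toC a c b hP; rewrite nth_default // sz; lia.
Qed.

End Definite.

Section DefiniteFactor.
Variables (R : realType) (Q : form R 2).
Hypotheses (Qirr : irreducible_over_C Q) (Qdef : definite Q).
Local Notation toC := (real_complex R).

(** If Q divides v A, it divides A. *)
Lemma cap_mul_linear_VQ (v : 'rV[R]_3) k : v != 0 ->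
  (VQ Q k.+1 :&: linfun (@mul_linear R v k) @: fullv <=
     linfun (@mul_linear R v k) @: VQ Q k)%VS.
Proof.
move=> v0; apply/subvP => T; rewrite memv_cap => /andP[/VQP TQ /memv_imgP[S _]].
rewrite lfunE => TS; apply/memv_imgP; exists S; last by rewrite lfunE.
by apply/VQP/(irr_dvd_cancel Qirr v0); move: TQ; rewrite TS.
Qed.

(** The forms vanishing at a non-real point p of the complex conic have
    codimension 2, just like those generated modulo Q by the real linear form
    that vanishes at p and at its conjugate. *)
Lemma definite_split_linear k (P : form R k.+1) :
  exists2 v, v != 0 & exists P' : form R k,
    divides (Q : mpoly 3 R) ((P : mpoly 3 R) - linear_form v * (P' : mpoly 3 R)).
Proof.
have [s [ss sQ]] := quad_bil Q.
have [p [[i0 p0] Qp Pp]] := definite_common_zero Qdef ss sQ P.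
pose u : 'rV[R]_3 := \row_i complex.Re (p i).
pose w : 'rV[R]_3 := \row_i complex.Im (p i).
have pE i : p i = toC (u 0 i) + 'i%C * toC (w 0 i) by rewrite !mxE -complexE.
have [v v0 [vu vw]] := orth2_neq0 u w.
exists v => //.
pose fn (x : 'rV[R]_3) i := x 0 i.
pose S (x : 'rV[R]_3) : 'rV[R]_3 := \row_j \sum_i s i j * x 0 i.
have bil_dotv x y : bil s (fn x) (fn y) = dotv (S x) y.
  rewrite /bil exchange_big; apply: eq_bigr => j _; rewrite mxE mulr_suml.
  by apply: eq_bigr.
have evalpQ x : evalp Q x = dotv (S x) x by rewrite -bil_dotv; exact: (sQ _ idfun).
have lin_p x : mmap toC p (linear_form x) = toC (dotv x u) + 'i%C * toC (dotv x w).
  rewrite mmap_linear_form /dotv !rmorph_sum mulr_sumr -big_split; apply: eq_bigr => i _.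
  by rewrite pE /= !rmorphM; ring.
have [Quw Suw] : evalp Q u - evalp Q w = 0 /\ dotv (S u) w = 0.
  have h : bil (fun i j => toC (s i j)) p p = toC (evalp Q u - evalp Q w)
      + 'i%C * toC (2 * dotv (S u) w).
    pose E (x : 'rV[R]_3) i := toC (x 0 i).
    have bE x y : bil (fun i j => toC (s i j)) (E x) (E y) = toC (bil s (fn x) (fn y)).
      exact: (bil_rmorph toC).
    rewrite (@eq_bil _ _ _ (fun i => 1 * E u i + 'i%C * E w i + 0 * E w i) _
       (fun i => 1 * E u i + 'i%C * E w i + 0 * E w i)); last 2 first.
    - by move=> i; rewrite pE /E; ring.
    - by move=> i; rewrite pE /E; ring.
    rewrite bil_comb3; last by move=> i j; rewrite ss.
    by rewrite !bE !evalpQ !bil_dotv sqr_i mulr2n rmorphB rmorphM rmorph_nat; ring.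
  move: Qp; rewrite h; move: (_ - _) (dotv (S u) w) => x y.
  move=> /eqP; rewrite -(complexE (Complex x (2 * y))) eq_complex /=.
  by move=> /andP[/eqP -> /eqP xy]; split=> //; lra.
have Qu0 : evalp Q u != 0.
  apply: contraNneq p0 => Qu; have an x : evalp Q x = 0 -> x = 0.
    move=> /eqP; apply: contraTeq; exact: definite_anisotropic.
  have Qw : evalp Q w = 0 by rewrite -(subr0_eq Quw).
  by rewrite pE (an _ Qu) (an _ Qw) mxE !rmorph0 mulr0 addr0.
pose ev (T : form R k.+1) : 'rV[R]_2 :=
  \row_j (if j == 0 then complex.Re (mmap toC p (T : mpoly 3 R))
          else complex.Im (mmap toC p (T : mpoly 3 R))).
have ev_lin : linear ev.
  move=> c T1 T2; apply/rowP => j; rewrite !mxE rmorphD /= mmapZ.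
  by case: (mmap _ _ T1) (mmap _ _ T2) => [x y] [x' y']; case: eqP => _ /=; rewrite mul0r ?subr0 ?addr0.
pose evL := linfun (HB.pack_for {linear form R k.+1 -> 'rV[R]_2} ev
  (GRing.isLinear.Build R _ _ _ ev ev_lin)).
have evLE T : (T \in lker evL) = (mmap toC p (T : mpoly 3 R) == 0).
  rewrite memv_ker lfunE /= eq_complex; apply/eqP/andP => [/rowP h|[/eqP h0 /eqP h1]].
    by have := h 0; have := h 1; rewrite !mxE /= => -> ->.
  by apply/rowP => j; rewrite !mxE h0 h1 if_same.
pose E := (VQ Q k.+1 + linfun (@mul_linear R v k) @: fullv)%VS.
have EK : E = lker evL.
  apply/eqP; rewrite eqEdim; apply/andP; split.
    apply/subvP => T /memv_addP[T1 /VQP[T2 T1E] [T3 /memv_imgP[T4 _ ->] ->]].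
    rewrite evLE rmorphD /= T1E lfunE /= !rmorphM /= sQ Qp mul0r add0r.
    by rewrite lin_p !(dotvC v) vu vw rmorph0 mulr0 addr0 mul0r.
  have : (2 <= \dim (limg evL))%N.
    have hom x y : linear_form x ^+ k * linear_form y \is @ishomog1 3 R k.+1 mdeg.
      have := dhomogM (dhomogMn k (linear_form_homog x)) (linear_form_homog y).
      by rewrite mul1n addn1.
    pose lu := (evalp Q u)^-1 *: S u; pose lw := (evalp Q u)^-1 *: S w.
    have pu : mmap toC p (linear_form lu) = 1.
      by rewrite lin_p !dotvZl -evalpQ Suw mulr0 rmorph0 mulr0 addr0 mulVf.
    have pw : mmap toC p (linear_form lw) = 'i%C.
      rewrite lin_p !dotvZl -evalpQ -(subr0_eq Quw) mulVf // mulr1.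
      by rewrite -bil_dotv bilC // bil_dotv Suw mulr0 rmorph0 add0r.
    have -> : limg evL = fullv.
      apply/eqP; rewrite eqEsubv subvf; apply/subvP => r _; apply/memv_imgP.
      exists (r 0 0 *: DHomog (hom lu lu) + r 0 1 *: DHomog (hom lu lw)); rewrite ?memvf //.
      apply/rowP => j; rewrite lfunE mxE rmorphD /= !mmapZ !rmorphM rmorphXn /= pu pw.
      rewrite expr1n !mul1r; case: eqP => [->|/eqP j0] /=; first by ring.
      have -> : j = 1 by case: j j0 => -[|[|?]] //= jl _; apply/val_inj.
      by ring.
    by rewrite dimvf.
  have := limg_ker_dim evL fullv; rewrite capfv.
  have := @dim_VQ R Q k; have := @dim_VQ R Q k.+1.
  have := dimv_sum_cap (VQ Q k.+1) (linfun (@mul_linear R v k) @: fullv).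
  have := dimvS (cap_mul_linear_VQ k v0).
  have Q0 : Q != 0 by apply: contraNneq (irr_neq0 Qirr) => ->.
  rewrite !dim_mul_linear // -/E => h1 h2 /(_ Q0) h3 /(_ Q0) h4 h5 h6.
  have {}h3 := etrans h3 (dim_form R k.+1); have {}h4 := etrans h4 (dim_form R k).
  have {}h5 := etrans h5 (dim_form R k.+1).
  have {}h2 := etrans h2 (congr1 (addn _) (dim_form R k)).
  move: h1 h2 h3 h4 h5 h6.
  move: (\dim E) (\dim (lker evL)) (\dim (limg evL)) (\dim (_ :&: _)%VS) => e l i c.
  move: (\dim (VQ Q k.+1)) (\dim (VQ Q k)) => q1 q0.
  by rewrite mulnS; lia.
have : P \in E by rewrite EK evLE Pp.
case/memv_addP => T1 /VQP T1Q [T2 /memv_imgP[P' _ ->] ->].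
by exists P'; rewrite lfunE /= addrK.
Qed.

End DefiniteFactor.

Lemma definite_factorization (R : realType) (Q : form R 2) k (P : form R k) :
  irreducible_over_C Q -> definite Q ->
  exists c vs, [/\ size vs = k, all (fun v => v != 0) vs &
    divides (Q : mpoly 3 R) ((P : mpoly 3 R) - c *: \prod_(v <- vs) linear_form v)].
Proof.
move=> Qirr Qdef; elim: k P => [|k IH] P.
  exists (evalp P 0), [::]; split=> //; rewrite big_nil.
  have -> : (P : mpoly 3 R) = evalp P 0 *: 1.
    apply/eqP; rewrite -subr_eq0; apply/eqP/evalp_eq0 => x.
    rewrite evalpB evalpZ evalp1 mulr1 -[in evalp P 0](scale0r x).
    by rewrite (evalp_homog _ _ (dhomog_is_dhomog P)) expr0 mul1r subrr.
  by rewrite evalpZ evalp1 mulr1 subrr; apply: divides0.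
have [v v0 [P' h]] := definite_split_linear Qirr Qdef P.
have [c [vs [svs vs0 h']]] := IH P'.
exists c, (v :: vs); split; rewrite /= ?svs ?v0 //.
rewrite -[(P : mpoly 3 R)](subrK (linear_form v * (P' : mpoly 3 R))) -addrA.
by apply: dividesD => //; rewrite big_cons scalerAr -mulrBr; apply: divides_mull.
Qed.

(** * Parametrised real conics *)

Lemma mpoly_nonunit (F : idomainType) n (p q : mpoly n F) c d :
  mcoeff mnm0 p = 0 -> mcoeff mnm0 q = 0 ->
  mpolyC n c * p + mpolyC n d * q \isn't a GRing.unit.
Proof.
move=> p0 q0; apply/negP => /andP[_].
by rewrite mcoeffD !mcoeffCM p0 q0 !mulr0 addr0 unitr0.
Qed.

Lemma map_mpoly_quad (A F : comNzRingType) n (f : {rmorphism A -> F})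
    (p q : mpoly n A) a b d :
  map_mpoly f (a *: p ^+ 2 + b *: (p * q) + d *: q ^+ 2) =
  mpolyC n (f a) * map_mpoly f p ^+ 2
  + mpolyC n (f b) * (map_mpoly f p * map_mpoly f q)
  + mpolyC n (f d) * map_mpoly f q ^+ 2.
Proof. by rewrite !rmorphD /= !map_mpolyZ -!mul_mpolyC !expr2 !rmorphM. Qed.

Lemma split_binary_quadratic (F : numClosedFieldType) n (p q : mpoly n F) a b d :
  exists c1 c2 c3 c4 : F,
  mpolyC n a * p ^+ 2 + mpolyC n b * (p * q) + mpolyC n d * q ^+ 2
  = (mpolyC n c1 * p + mpolyC n c2 * q) * (mpolyC n c3 * p + mpolyC n c4 * q).
Proof.
have [->|a0] := eqVneq a 0.
  by exists 0, 1, b, d; rewrite !mpolyC0 mpolyC1; ring.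
pose z := sqrtC (b ^+ 2 - 4 * a * d); pose r := (- b + z) / (2 * a).
have rE : d = - (a * r ^+ 2 + b * r).
  have -> : - (a * r ^+ 2 + b * r) = (b ^+ 2 - z ^+ 2) / (4 * a) by rewrite /r; field.
  by rewrite /z sqrtCK; field.
exists 1, (- r), a, (b + a * r); rewrite {1}rE.
by rewrite !expr2 mpolyC1 !mpolyCN !mpolyCD !mpolyCM; ring.
Qed.

(** If a were in the radical, Q would be a binary quadratic form in the two
    linear forms l 0 and l 1 that vanish at a; over the complex numbers it would
    split into linear factors. *)
Lemma irr_nondegenerate (R : realType) (Q : form R 2) s (a : 'rV[R]_3) :
  irreducible_over_C Q -> (forall i j, s i j = s j i) ->
  (forall x, evalp Q x = bil s (fun i => x 0 i) (fun i => x 0 i)) ->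
  a != 0 -> exists y : 'rV[R]_3, bil s (fun i => a 0 i) (fun i => y 0 i) != 0.
Proof.
move=> Qirr ss sQ a0; apply: contrapT => hN.
have h (y : 'rV[R]_3) : bil s (fun i => a 0 i) (fun i => y 0 i) = 0.
  by apply/eqP; apply: contraT => ne; case: hN; exists y.
have [i0 ai0] := row_neq0 a0.
pose l (j : 'I_2) : 'rV[R]_3 :=
  delta_mx 0 (lift i0 j) - (a 0 (lift i0 j) / a 0 i0) *: delta_mx 0 i0.
pose A := s (lift i0 0) (lift i0 0); pose D := s (lift i0 1) (lift i0 1).
pose B := s (lift i0 0) (lift i0 1).
have lE j x : dotv (l j) x = x 0 (lift i0 j) - x 0 i0 / a 0 i0 * a 0 (lift i0 j).
  rewrite /l -scaleNr dotvDl dotvZl !(dotvC _ x) !dotv_delta; field.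
  exact: ai0.
have QE : (Q : mpoly 3 R) = A *: linear_form (l 0) ^+ 2
    + (B *+ 2) *: (linear_form (l 0) * linear_form (l 1)) + D *: linear_form (l 1) ^+ 2.
  apply/eqP; rewrite -subr_eq0; apply/eqP/evalp_eq0 => x; apply/eqP.
  rewrite evalpB subr_eq0 sQ !evalpD !evalpZ !expr2 !evalpM !evalp_linear_form !lE.
  pose t := x 0 i0 / a 0 i0; rewrite -/t.
  pose y i := x 0 i - t * a 0 i.
  have -> : bil s (fun i => x 0 i) (fun i => x 0 i) = bil s y y.
    rewrite (@eq_bil _ _ _ (fun i => 1 * y i + t * a 0 i + 0 * a 0 i) _
      (fun i => 1 * y i + t * a 0 i + 0 * a 0 i)); last 2 first.
    - by move=> i; rewrite /y; ring.
    - by move=> i; rewrite /y; ring.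
    rewrite bil_comb3 // (bilC y _ ss) h.
    have -> : bil s (fun i => a 0 i) y = 0.
      rewrite -(h (x - t *: a)); apply: eq_bil => // i.
      by rewrite /y !mxE.
    by rewrite !mulr0 !addr0 expr1n mul1r mul0rn addr0.
  have yi0 : y i0 = 0 by rewrite /y /t divfK ?subrr.
  rewrite /bil (bigD1_ord i0) //= [X in X + _]big1 ?add0r; last first.
    by move=> j _; rewrite yi0 mulr0 mul0r.
  under eq_bigr do rewrite (bigD1_ord i0) //= yi0 mulr0 add0r.
  rewrite !big_ord_recl !big_ord0 !addr0.
  have -> : lift ord0 ord0 = 1 :> 'I_2 by apply/val_inj.
  rewrite /A /B /D (ss (lift i0 1) (lift i0 ord0)) mulr2n /y.
  by apply/eqP; ring.
pose f := map_mpoly (real_complex R) : mpoly 3 R -> _.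
pose toC := real_complex R; pose M j := f (linear_form (l j)).
have fZ c p : f (c *: p) = mpolyC 3 (toC c) * f p by rewrite /f map_mpolyZ mul_mpolyC.
have M0 j : mcoeff mnm0 (M j) = 0.
  rewrite mcoeff_map_mpoly raddf_sum big1 ?raddf0 // => i _ /=.
  by rewrite mcoeffZ mcoeffX mnm1_eq0 mulr0.
have red (c1 c2 c3 c4 : R[i]) :
    f Q <> (mpolyC 3 c1 * M 0 + mpolyC 3 c2 * M 1) * (mpolyC 3 c3 * M 0 + mpolyC 3 c4 * M 1).
  move=> e; case: Qirr => _ [_ /(_ _ _ e)].
  by move=> [|]; apply/negP; apply: mpoly_nonunit.
have fQ : f Q = mpolyC 3 (toC A) * M 0 ^+ 2 + mpolyC 3 (toC (B *+ 2)) * (M 0 * M 1)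
   + mpolyC 3 (toC D) * M 1 ^+ 2.
  by rewrite QE; apply: map_mpoly_quad.
have [c1 [c2 [c3 [c4 e]]]] :=
  split_binary_quadratic (M 0) (M 1) (toC A) (toC (B *+ 2)) (toC D).
by apply: (red c1 c2 c3 c4); rewrite fQ e.
Qed.

(** Coordinates (x, y, z) in which Q is proportional to y^2 - x z: the
    vectors a, c, b are the basis and the linear forms x, y, z its dual basis.
    The point a + t c + t^2 b then runs over the conic, except for its point at
    infinity b. *)
Record conic_frame (R : realType) (Q : form R 2) := ConicFrame {
  fr_a : 'rV[R]_3; fr_c : 'rV[R]_3; fr_b : 'rV[R]_3;
  fr_x : 'rV[R]_3; fr_y : 'rV[R]_3; fr_z : 'rV[R]_3; fr_q : R;
  fr_q_neq0 : fr_q != 0;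
  fr_coord : forall v,
    v = dotv fr_x v *: fr_a + dotv fr_y v *: fr_c + dotv fr_z v *: fr_b;
  fr_dualx : [/\ dotv fr_x fr_a = 1, dotv fr_x fr_c = 0 & dotv fr_x fr_b = 0];
  fr_dualy : [/\ dotv fr_y fr_a = 0, dotv fr_y fr_c = 1 & dotv fr_y fr_b = 0];
  fr_dualz : [/\ dotv fr_z fr_a = 0, dotv fr_z fr_c = 0 & dotv fr_z fr_b = 1];
  fr_quad : forall v,
    evalp Q v = fr_q * (dotv fr_y v ^+ 2 - dotv fr_x v * dotv fr_z v) }.

(** A hyperbolic plane spanned by b and a second isotropic vector a1, and a
    vector c orthogonal to it; c is anisotropic because Q is nondegenerate, and
    a1 is rescaled to balance the values of Q. *)
Lemma exists_conic_frame (R : realType) (Q : form R 2) (b : 'rV[R]_3) :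
  irreducible_over_C Q -> b != 0 -> evalp Q b = 0 ->
  exists F : conic_frame Q, fr_b F = b.
Proof.
move=> Qirr b0 Qb; have [s [ss sQ0]] := quad_bil Q.
pose fn (x : 'rV[R]_3) i := x 0 i.
have sQ x : evalp Q x = bil s (fn x) (fn x) by exact: (sQ0 _ idfun).
pose S (x : 'rV[R]_3) : 'rV[R]_3 := \row_j \sum_i s i j * x 0 i.
have bil_dotv x y : bil s (fn x) (fn y) = dotv (S x) y.
  rewrite /bil exchange_big; apply: eq_bigr => j _; rewrite mxE mulr_suml.
  by apply: eq_bigr.
have SC x y : dotv (S x) y = dotv (S y) x by rewrite -!bil_dotv bilC.
have QE x : evalp Q x = dotv (S x) x by rewrite sQ bil_dotv.
have SZ k x y : dotv (S (k *: x)) y = k * dotv (S x) y by rewrite SC dotvZr SC.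
have SD x x' y : dotv (S (x + x')) y = dotv (S x) y + dotv (S x') y.
  by rewrite SC dotvDr !(SC y).
have nondeg x : x != 0 -> exists y, dotv (S x) y != 0.
  move=> /(irr_nondegenerate Qirr ss sQ)[y]; rewrite (bil_dotv x y) => h.
  by exists y.
have [a' a'b] := nondeg _ b0.
(* Subtracting a multiple of b makes a vector not orthogonal to b isotropic. *)
have [a1 a1b a1a1] : exists2 a1, dotv (S b) a1 != 0 & evalp Q a1 = 0.
  exists (a' + (- (evalp Q a' / (2 * dotv (S b) a'))) *: b).
    by rewrite dotvDr dotvZr -QE Qb mulr0 addr0.
  by rewrite QE SD SZ !(dotvDr, dotvZr) -!QE Qb (SC a'); field.
have [c c0 [cb ca1]] := orth2_neq0 (S b) (S a1).
have [g gE g0] : exists2 g, dotv (S b) a1 = g & g != 0.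
  by exists (dotv (S b) a1).
have gE' : dotv (S a1) b = g by rewrite SC.
have bb : dotv (S b) b = 0 by rewrite -QE.
have aa : dotv (S a1) a1 = 0 by rewrite -QE.
have bc : dotv (S c) b = 0 by rewrite SC.
have ac : dotv (S c) a1 = 0 by rewrite SC.
have decomp y : exists k, y = (dotv (S a1) y / g) *: b + (dotv (S b) y / g) *: a1 + k *: c.
  pose y' := y - ((dotv (S a1) y / g) *: b + (dotv (S b) y / g) *: a1).
  have y'b : dotv (S b) y' = 0.
    by rewrite /y' -scaleN1r !(dotvDr, dotvZr) bb gE; field.
  have y'a : dotv (S a1) y' = 0.
    by rewrite /y' -scaleN1r !(dotvDr, dotvZr) aa gE'; field.
  suff [k kE] : exists k, y' = k *: c by exists k; rewrite -kE /y' addrC subrK.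
  clearbody y'; pose us := [:: b; a1; c; y']; pose M := \matrix_(i < 4) us`_i : 'M[R]_(4, 3).
  have k0 : kermx M != 0.
    by rewrite kermx_eq0 -row_leq_rank -ltnNge (leq_ltn_trans (rank_leq_col _)).
  have := nz_row_sub (kermx M); rewrite -nz_row_eq0 in k0.
  move: (nz_row _) k0 => r r0 /sub_kermxP; rewrite mulmx_sum_row.
  pose t j := r 0 (inord j).
  rewrite (eq_bigr (fun i : 'I_4 => t i *: us`_i)); last first.
    by move=> i _; rewrite rowK /t inord_val.
  rewrite !big_ord_recl big_ord0 /= addr0 => e.
  have e1 : t 1%N = 0.
    have := congr1 (dotv (S b)) e; rewrite !(dotvDr, dotvZr) bb gE cb y'b dotv0r.
    by rewrite !mulr0 !addr0 add0r => /eqP; rewrite mulf_eq0 (negbTE g0) orbF => /eqP.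
  have e2 : t 0%N = 0.
    have := congr1 (dotv (S a1)) e; rewrite !(dotvDr, dotvZr) aa gE' ca1 y'a dotv0r.
    by rewrite !mulr0 !addr0 => /eqP; rewrite mulf_eq0 (negbTE g0) orbF => /eqP.
  rewrite e1 e2 !scale0r !add0r in e.
  have [r40|r40] := eqVneq (t 3%N) 0.
    move: e; rewrite r40 scale0r addr0 => /eqP; rewrite scaler_eq0 (negbTE c0) orbF => /eqP r30.
    case/eqP: r0; apply/rowP => j; rewrite mxE -[j]inord_val -/(t j).
    by case: j => -[|[|[|[|?]]]] //= _.
  exists (- (t 3%N)^-1 * t 2%N); apply: (scalerI r40).
  move/eqP: e; rewrite addrC addr_eq0 => /eqP ->.
  by rewrite scalerA mulrA mulrN divff // mulN1r scaleNr.
have Qc0 : evalp Q c != 0.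
  apply/eqP => Qc; have [y] := nondeg _ c0; have [k ->] := decomp y.
  by rewrite !(dotvDr, dotvZr) bc ac -QE Qc !mulr0 !addr0 eqxx.
pose q := evalp Q c; have cc : dotv (S c) c = q by rewrite -QE.
have kE y : y = (dotv (S a1) y / g) *: b + (dotv (S b) y / g) *: a1 + (dotv (S c) y / q) *: c.
  have [k yE] := decomp y; rewrite {1}yE; congr (_ + _ *: _).
  by rewrite yE !(dotvDr, dotvZr) bc ac cc !mulr0 !add0r mulfK.
pose a := (- q / (2 * g)) *: a1.
pose x := (- 2 / q) *: S b; pose y := q^-1 *: S c; pose z := g^-1 *: S a1.
have coord v : v = dotv x v *: a + dotv y v *: c + dotv z v *: b.
  rewrite {1}(kE v) /x /y /z /a !dotvZl scalerA [_ *: b + _]addrC addrAC.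
  by congr (_ *: _ + _ *: _ + _ *: _); field; rewrite ?Qc0 ?g0.
have dx : [/\ dotv x a = 1, dotv x c = 0 & dotv x b = 0].
  rewrite /x /a !dotvZl dotvZr gE cb bb !mulr0; split=> //.
  by field; rewrite Qc0 g0.
have dy : [/\ dotv y a = 0, dotv y c = 1 & dotv y b = 0].
  by rewrite /y /a !dotvZl dotvZr ac cc bc !mulr0 mulVf.
have dz : [/\ dotv z a = 0, dotv z c = 0 & dotv z b = 1].
  by rewrite /z /a !dotvZl dotvZr aa ca1 gE' !mulr0 mulVf.
have quad v : evalp Q v = q * (dotv y v ^+ 2 - dotv x v * dotv z v).
  rewrite QE {2}(kE v) !(dotvDr, dotvZr) !(SC v) /x /y /z !dotvZl.
  by field; rewrite Qc0 g0.
by exists (ConicFrame Qc0 coord dx dy dz quad).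
Qed.

Lemma poly_ext (R : numDomainType) (p q : {poly R}) : (forall t, p.[t] = q.[t]) -> p = q.
Proof.
move=> h; apply/eqP; rewrite -subr_eq0; apply: contraT => /infinite_field_nonroot[x].
by rewrite /root !hornerE h subrr eqxx.
Qed.

Section FrameTheory.
Variables (R : realType) (Q : form R 2) (F : conic_frame Q).
Implicit Types (P S : mpoly 3 R) (p q f : {poly R}).

Definition fr_pt t : 'rV[R]_3 := fr_a F + t *: fr_c F + t ^+ 2 *: fr_b F.

Lemma fr_ptE t : [/\ dotv (fr_x F) (fr_pt t) = 1, dotv (fr_y F) (fr_pt t) = t &
  dotv (fr_z F) (fr_pt t) = t ^+ 2].
Proof.
have [x1 x2 x3] := fr_dualx F; have [y1 y2 y3] := fr_dualy F.
have [z1 z2 z3] := fr_dualz F.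
by rewrite /fr_pt; split; rewrite !(dotvDr, dotvZr) ?(x1, x2, x3) ?(y1, y2, y3) ?(z1, z2, z3); ring.
Qed.

Lemma fr_pt_neq0 t : fr_pt t != 0.
Proof.
by apply/eqP => h; have [] := fr_ptE t; rewrite h dotv0r => /eqP; rewrite eq_sym oner_eq0.
Qed.

Lemma fr_pt_inj s t l : fr_pt s = l *: fr_pt t -> s = t.
Proof.
move=> e; have [x y _] := fr_ptE s; have [x' y' _] := fr_ptE t.
by move: y x; rewrite e !dotvZr x' y' mulr1 => <- ->; rewrite mul1r.
Qed.

Lemma fr_b_neq0 : fr_b F != 0.
Proof.
by apply/eqP => h; have [_ _] := fr_dualz F; rewrite h dotv0r => /eqP; rewrite eq_sym oner_eq0.
Qed.

Lemma fr_pt_isotropic t : evalp Q (fr_pt t) = 0.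
Proof. by have [x y z] := fr_ptE t; rewrite (fr_quad F) x y z; ring. Qed.

Lemma fr_b_isotropic : evalp Q (fr_b F) = 0.
Proof.
have [_ _ x] := fr_dualx F; have [_ _ y] := fr_dualy F.
by rewrite (fr_quad F) x y; ring.
Qed.

(** In the coordinates of the frame: where y^2 = x z, either x = y = 0, or
    (x, y, z) is proportional to (1, t, t^2) with t = y / x. *)
Lemma fr_isotropicP x : x != 0 -> evalp Q x = 0 ->
  (exists t l, l != 0 /\ x = l *: fr_pt t) \/ (exists2 l, l != 0 & x = l *: fr_b F).
Proof.
move=> x0; rewrite (fr_quad F) => /eqP; rewrite mulf_eq0 (negbTE (fr_q_neq0 F)) /= subr_eq0.
move=> /eqP e; have [X0|X0] := eqVneq (dotv (fr_x F) x) 0.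
  right; exists (dotv (fr_z F) x); last first.
    rewrite {1}(fr_coord F x) X0 scale0r add0r.
    by move: e; rewrite X0 mul0r => /eqP; rewrite sqrf_eq0 => /eqP ->; rewrite scale0r add0r.
  apply: contraNneq x0 => Z0; rewrite (fr_coord F x) X0 Z0.
  by move: e; rewrite X0 mul0r => /eqP; rewrite sqrf_eq0 => /eqP ->; rewrite !scale0r !addr0.
left; exists (dotv (fr_y F) x / dotv (fr_x F) x), (dotv (fr_x F) x); split=> //.
rewrite {1}(fr_coord F x) /fr_pt !scalerDr !scalerA; congr (_ + _ *: _ + _ *: _).
  by field.
by apply: (mulfI X0); rewrite -e; field.
Qed.

(** The restriction to the conic, in the affine coordinate of the frame. *)
Definition restr P : {poly R} :=
  conic_restr idfun (fun i => fr_a F 0 i) (fun i => fr_c F 0 i) (fun i => fr_b F 0 i) P.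

Lemma restrE P t : (restr P).[t] = evalp P (fr_pt t).
Proof.
rewrite horner_conic_restr; apply: eq_bigr => m _; congr (_ * _).
by apply: mmap1_eq => i; rewrite !mxE; ring.
Qed.

Lemma restrM P S : restr (P * S) = restr P * restr S.
Proof. by apply: poly_ext => t; rewrite hornerM !restrE evalpM. Qed.
Lemma restrD P S : restr (P + S) = restr P + restr S.
Proof. by apply: poly_ext => t; rewrite hornerD !restrE evalpD. Qed.
Lemma restrB P S : restr (P - S) = restr P - restr S.
Proof. by apply: poly_ext => t; rewrite !hornerE !restrE evalpB. Qed.
Lemma restrZ c P : restr (c *: P) = c *: restr P.
Proof. by apply: poly_ext => t; rewrite hornerZ !restrE evalpZ. Qed.
Lemma restr1 : restr 1 = 1.
Proof. by apply: poly_ext => t; rewrite hornerE restrE evalp1. Qed.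
Lemma restr0 : restr 0 = 0.
Proof. by apply: poly_ext => t; rewrite horner0 restrE evalp0. Qed.
Lemma restr_prod I (r : seq I) (G : I -> mpoly 3 R) :
  restr (\prod_(i <- r) G i) = \prod_(i <- r) restr (G i).
Proof. by apply: poly_ext => t; rewrite horner_prod restrE evalp_prod; under eq_bigr do rewrite -restrE. Qed.
Lemma restr_sum I (r : seq I) (G : I -> mpoly 3 R) :
  restr (\sum_(i <- r) G i) = \sum_(i <- r) restr (G i).
Proof.
elim: r => [|i r IH]; first by rewrite !big_nil restr0.
by rewrite !big_cons restrD IH.
Qed.

Lemma restr_Q : restr Q = 0.
Proof. by apply: poly_ext => t; rewrite restrE fr_pt_isotropic horner0. Qed.

Lemma restr_divides P S : divides (Q : mpoly 3 R) (P - S) -> restr P = restr S.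
Proof.
by move=> [T e]; apply/eqP; rewrite -subr_eq0 -restrB e restrM restr_Q mul0r.
Qed.

Lemma restr_top k P : P \is @ishomog1 3 R k mdeg ->
  (size (restr P) <= (2 * k).+1)%N /\ (restr P)`_(2 * k) = evalp P (fr_b F).
Proof. by move=> hP; have := conic_restr_top idfun (fun i => fr_a F 0 i)
  (fun i => fr_c F 0 i) (fun i => fr_b F 0 i) hP. Qed.

(** The linear form p0 x + p1 y + p2 z takes the value p(t) at the point
    (1, t, t^2). *)
Definition vec_of_poly p : 'rV[R]_3 := p`_0 *: fr_x F + p`_1 *: fr_y F + p`_2 *: fr_z F.

Lemma restr_vec_of_poly p : (size p <= 3)%N -> restr (linear_form (vec_of_poly p)) = p.
Proof.
move=> sp; apply: poly_ext => t; rewrite restrE evalp_linear_form.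
rewrite !(dotvDl, dotvZl); have [-> -> ->] := fr_ptE t.
by rewrite (horner_coef_wide _ sp) !big_ord_recl big_ord0 /=; ring.
Qed.

Lemma size_restr_linear v : (size (restr (linear_form v)) <= 3)%N.
Proof. by have [] := restr_top (linear_form_homog v). Qed.

(** The monomial t^j is the restriction of x^(k - j) y^j if j is at most k,
    and of y^(2 k - j) z^(j - k) otherwise. *)
Lemma restr_lift k p : (size p <= (2 * k).+1)%N -> exists P : form R k, restr P = p.
Proof.
have mono j : (j < (2 * k).+1)%N -> exists P : form R k, restr P = 'X^j.
  have X u (e : nat) (q : {poly R}) : (size q <= 3)%N -> u = vec_of_poly q ->
      restr (linear_form u ^+ e) = q ^+ e.
    move=> sq ->; elim: e => [|e IH]; first by rewrite !expr0 restr1.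
    by rewrite !exprS restrM restr_vec_of_poly // IH.
  rewrite ltnS => jk; have [jk'|kj] := leqP j k.
    have h : linear_form (vec_of_poly 1) ^+ (k - j) * linear_form (vec_of_poly 'X) ^+ j
        \is @ishomog1 3 R k mdeg.
      have := dhomogM (dhomogMn (k - j) (linear_form_homog (vec_of_poly 1)))
        (dhomogMn j (linear_form_homog (vec_of_poly 'X))).
      by rewrite !mul1n subnK.
    exists (DHomog h); rewrite restrM (X _ _ 1) ?size_poly1 // (X _ _ 'X) ?size_polyX //.
    by rewrite expr1n mul1r.
  have h : linear_form (vec_of_poly 'X) ^+ (2 * k - j) * linear_form (vec_of_poly 'X^2) ^+ (j - k)
      \is @ishomog1 3 R k mdeg.
    have := dhomogM (dhomogMn (2 * k - j) (linear_form_homog (vec_of_poly 'X)))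
      (dhomogMn (j - k) (linear_form_homog (vec_of_poly 'X^2))).
    by rewrite !mul1n; have -> : (2 * k - j + (j - k))%N = k by lia.
  exists (DHomog h); rewrite restrM (X _ _ 'X) ?size_polyX // (X _ _ 'X^2) ?size_polyXn //.
  by rewrite -exprM -exprD; congr ('X^_); lia.
move=> sp; have [M hM] := @boolp.choice 'I_(2 * k).+1 (form R k) (fun j (P : form R k) => restr P = 'X^j)
  (fun j => mono j (ltn_ord j)).
exists (\sum_(j < (2 * k).+1) p`_j *: M j).
have -> : ((\sum_(j < (2 * k).+1) p`_j *: M j : form R k) : mpoly 3 R) =
          \sum_(j < (2 * k).+1) p`_j *: (M j : mpoly 3 R).
  by rewrite raddf_sum.
rewrite restr_sum; apply: poly_ext => t; rewrite horner_sum (horner_coef_wide _ sp).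
by apply: eq_bigr => j _; rewrite restrZ hM hornerZ hornerXn.
Qed.

(** The restriction map has rank 2 k + 1, the codimension of the multiples
    of Q, which it kills. *)
Lemma restr_eq0 k P : P \is @ishomog1 3 R k mdeg -> restr P = 0 -> divides (Q : mpoly 3 R) P.
Proof.
move=> hP P0; pose ev (T : form R k) : 'rV[R]_(2 * k).+1 := \row_j (restr T)`_j.
have ev_lin : linear ev.
  by move=> c T1 T2; apply/rowP => j; rewrite !mxE /= restrD restrZ coefD coefZ.
pose evL := linfun (HB.pack_for {linear form R k -> 'rV[R]_(2 * k).+1} ev
  (GRing.isLinear.Build R _ _ _ ev ev_lin)).
have evLE (T : form R k) : (T \in lker evL) = (restr T == 0).
  rewrite memv_ker lfunE /=; apply/eqP/eqP => [/rowP h|h]; last first.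
    by apply/rowP => j; rewrite !mxE h coef0.
  apply/polyP => i; rewrite coef0; have [ik|ik] := ltnP i (2 * k).+1.
    by have := h (Ordinal ik); rewrite !mxE.
  by rewrite nth_default // (leq_trans _ ik) //; have [] := restr_top (dhomog_is_dhomog T).
have Q0 : Q != 0.
  apply: contraTneq (fr_q_neq0 F) => Q0; rewrite negbK; apply/eqP; have := fr_quad F (fr_c F).
  have -> : (Q : mpoly 3 R) = 0 by rewrite Q0.
  rewrite evalp0; have [_ -> _] := fr_dualx F; have [_ -> _] := fr_dualy F.
  by rewrite mul0r subr0 expr1n mulr1 => /esym ->.
have /eqP E : VQ Q k == lker evL.
  rewrite eqEdim; apply/andP; split.
    apply/subvP => T /VQP QT; rewrite evLE; apply/eqP.
    by rewrite -restr0; apply: restr_divides; rewrite subr0.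
  have Efull : limg evL = fullv.
    apply/eqP; rewrite eqEsubv subvf; apply/subvP => r _; apply/memv_imgP.
    have [|T hT] := @restr_lift k (\poly_(j < (2 * k).+1) r 0 (inord j)).
      exact: size_poly.
    exists T; rewrite ?memvf // lfunE; apply/rowP => j.
    by rewrite mxE hT coef_poly ltn_ord inord_val.
  have h1 := limg_ker_dim evL fullv; rewrite capfv Efull dimvf in h1.
  have {}h1 := etrans h1 (dim_form R k).
  have h2 := etrans (dim_VQ k Q0) (dim_form R k).
  rewrite [X in (_ + X)%N](_ : _ = (2 * k).+1) in h1; last by rewrite /dim /= mul1n.
  move: h1 h2; move: (\dim (lker evL)) (\dim (VQ Q k)) ('C(_, _)) => x y z.
  by lia.
have : DHomog hP \in lker evL by rewrite evLE P0.
by rewrite -E => /VQP.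
Qed.

Lemma restr_inj k P S : P \is @ishomog1 3 R k mdeg -> S \is @ishomog1 3 R k mdeg ->
  restr P = restr S -> divides (Q : mpoly 3 R) (P - S).
Proof.
move=> hP hS e; apply: (@restr_eq0 k); first by rewrite rpredB.
by rewrite restrB e subrr.
Qed.

End FrameTheory.

(** * Completely factorable representatives for an indefinite quadratic form *)

Lemma real_poly_nonreal_root (R : rcfType) (g : {poly R}) :
  (1 < size g)%N -> (forall x, ~~ root g x) ->
  exists q h : {poly R}, [/\ size q = 3%N, (forall x, ~~ root q x) & g = q * h].
Proof.
move=> sg gr; pose toC := real_complex R.
have [z /rootP gz] : exists z, root (map_poly toC g) z.
  by apply/closed_rootP; rewrite size_map_poly; case: size sg => [|[]].
have Iz0 : complex.Im z != 0.
  apply: contra (gr (complex.Re z)) => /eqP Iz; apply/rootP/(fmorph_inj toC).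
  rewrite rmorph0 -gz -horner_map /=; congr (_.[_]).
  by case: z Iz {gz} => a b /= ->.
pose a := complex.Re z; pose b := complex.Im z.
pose q : {poly R} := Poly [:: a ^+ 2 + b ^+ 2; - (a *+ 2); 1].
have qE : polyseq q = [:: a ^+ 2 + b ^+ 2; - (a *+ 2); 1].
  by rewrite (@PolyK _ 0) //= oner_neq0.
have sq : size q = 3%N by rewrite qE.
have qr x : q.[x] = (x - a) ^+ 2 + b ^+ 2.
  by rewrite horner_coef sq !big_ord_recl big_ord0 qE /=; ring.
have b2 : 0 < b ^+ 2 by rewrite exprn_even_gt0.
exists q, (g %/ q); split=> // [x|].
  by rewrite /root qr lt0r_neq0 // ltr_wpDl // sqr_ge0.
have q0 : q != 0 by rewrite -size_poly_eq0 sq.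
rewrite mulrC; apply/eqP; rewrite -dvdp_eq; apply/modp_eq0P.
have qz : (map_poly toC q).[z] = 0.
  rewrite (horner_coef_wide _ (n := 3)) ?size_map_poly ?sq //.
  rewrite !big_ord_recl big_ord0 !coef_map qE /= /a /b.
  case: (z) => x y; apply/eqP; rewrite eq_complex /=; apply/andP; split; apply/eqP; simpc => /=; ring.
have := divp_eq g q => /(congr1 (fun p => (map_poly toC p).[z])).
rewrite gz rmorphD rmorphM /= hornerD hornerM qz mulr0 add0r.
have : (size (g %% q)%R < 3)%N by rewrite -sq ltn_modp.
set r := g %% q => sr; rewrite (horner_coef_wide _ (n := 2)) ?size_map_poly //.
rewrite !big_ord_recl big_ord0 !coef_map /= expr0 mulr1 expr1 addr0 => /esym/eqP.
have -> : (r`_0)%:C%C + (r`_1)%:C%C * z = Complex (r`_0 + r`_1 * a) (r`_1 * b).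
  by rewrite /a /b; case: (z) => x y; apply/eqP; rewrite eq_complex /=; apply/andP; split; apply/eqP; simpc => /=; ring.
rewrite eq_complex /= mulf_eq0 (negbTE Iz0) orbF => /andP[e /eqP r1].
move: e; rewrite r1 mul0r addr0 => /eqP r0.
apply/polyP => i; rewrite coef0; case: i => [|[|i]] //.
by rewrite nth_default // (leq_trans _ (isT : 2 <= i.+2)%N).
Qed.

Lemma real_quadratic_factor (R : rcfType) (f : {poly R}) : (2 < size f)%N ->
  exists q h : {poly R}, size q = 3%N /\ f = q * h.
Proof.
move=> sf; have f0 : f != 0 by rewrite -size_poly_gt0 (ltn_trans _ sf).
have [[r rf]|nr] := pselect (exists r, root f r); last first.
  have [|x|q [h [sq _ ->]]] := @real_poly_nonreal_root R f; first by rewrite (ltn_trans _ sf).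
    by apply/negP => fx; apply: nr; exists x.
  by exists q, h.
have /factor_theorem[g fE] := rf; have g0 : g != 0 by apply: contraNneq f0 => g0; rewrite fE g0 mul0r.
have sg : (1 < size g)%N by move: sf; rewrite fE size_Mmonic ?monicXsubC // size_XsubC addn2.
have [[s /factor_theorem[h gE]]|ng] := pselect (exists s, root g s).
  exists (('X - s%:P) * ('X - r%:P)), h; split; last by rewrite fE gE; ring.
  by rewrite size_Mmonic ?monicXsubC ?polyXsubC_eq0 // !size_XsubC.
have [//|x|q [h [sq _ gE]]] := @real_poly_nonreal_root R g.
  by apply/negP => gx; apply: ng; exists x.
by exists q, (h * ('X - r%:P)); split=> //; rewrite fE gE mulrA.
Qed.

(** A real polynomial of degree at least 2 has a real quadratic factor:
    either two conjugate roots or two real ones. Factors 1 complete the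
    product when the degree is less than 2 k: they correspond to the line that
    is tangent to the conic at infinity. *)
Lemma real_quadratics_prod (R : rcfType) k (f : {poly R}) :
  f != 0 -> (size f <= (2 * k).+1)%N ->
  exists c (qs : seq {poly R}), [/\ size qs = k, all (fun q : {poly R} => (size q <= 3)%N) qs &
    f = c *: \prod_(q <- qs) q].
Proof.
elim: k f => [|k IH] f f0 sf.
  exists f`_0, [::]; split=> //; rewrite big_nil alg_polyC.
  by apply: size1_polyC.
have [sf3|sf3] := leqP (size f) 3.
  exists 1, (f :: nseq k 1); split; rewrite /= ?size_nseq ?sf3 //.
    by apply/allP => q /nseqP[-> _]; rewrite size_poly1.
  rewrite scale1r big_cons big1_seq ?mulr1 // => q.
  by move=> /andP[_ /nseqP[]].
have [q [h [sq fE]]] := real_quadratic_factor (ltnW sf3).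
have q0 : q != 0 by apply: contraNneq f0 => q0; rewrite fE q0 mul0r.
have h0 : h != 0 by apply: contraNneq f0 => h0; rewrite fE h0 mulr0.
have [|c [qs [sqs aqs hE]]] := IH h h0.
  by move: sf; rewrite fE size_mul // sq; move: (size h) => n; lia.
exists c, (q :: qs); split; rewrite /= ?sqs ?sq //.
by rewrite big_cons fE hE scalerAr.
Qed.

(** Factors of degree at most 2 are the restrictions of linear forms. *)
Lemma indefinite_factorization (R : realType) (Q : form R 2) (F : conic_frame Q) k (f : {poly R}) :
  f != 0 -> (size f <= (2 * k).+1)%N ->
  exists c vs, [/\ c != 0, size vs = k, all (fun v => v != 0) vs &
    restr F (c *: \prod_(v <- vs) linear_form v) = f].
Proof.
move=> f0 sf; have [c [qs [sqs aqs fE]]] := real_quadratics_prod f0 sf.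
have e : restr F (c *: \prod_(v <- map (vec_of_poly F) qs) linear_form v) = f.
  rewrite restrZ restr_prod big_map fE; congr (_ *: _).
  apply: eq_big_seq => q /(allP aqs); exact: restr_vec_of_poly.
exists c, (map (vec_of_poly F) qs); split=> //.
- by apply: contraNneq f0 => c0; rewrite fE c0 scale0r.
- by rewrite size_map.
- apply/allP => v vq; apply: contraNneq f0 => v0; rewrite -e (big_rem v) //= v0.
  by rewrite linear_form0 mul0r scaler0 restr0.
Qed.

(** A quadratic form that is not definite takes a value of each sign, hence
    vanishes on the segment between two such points. *)
Lemma indefinite_isotropic (R : realType) (Q : form R 2) :
  ~ definite Q -> exists2 x, x != 0 & evalp Q x = 0.
Proof.
move=> nd; apply: contrapT => ni.
have ni' x : x != 0 -> evalp Q x != 0.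
  by move=> x0; apply/eqP => Qx; apply: ni; exists x.
have [x x0 Qx] : exists2 x, x != 0 & evalp Q x < 0.
  apply: contrapT => h; apply: nd; left => x x0; rewrite lt_neqAle eq_sym ni' //=.
  by rewrite leNgt; apply/negP => Qx; apply: h; exists x.
have [y y0 Qy] : exists2 x, x != 0 & 0 < evalp Q x.
  apply: contrapT => h; apply: nd; right => y y0; rewrite lt_neqAle ni' //=.
  by rewrite leNgt; apply/negP => Qy; apply: h; exists y.
have [p pE] := evalp_line Q x (y - x).
have [|t _ /rootP pt] := @poly_ivt _ p 0 1 ler01.
  by rewrite !pE scale0r addr0 scale1r addrC subrK !ltW.
have : x + t *: (y - x) = 0.
  by apply/eqP; apply: contraT => /ni'; rewrite -pE pt eqxx.
rewrite scalerBr addrCA -[X in _ + (X - _)]scale1r -scalerBl => e.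
have [t0|t0] := eqVneq t 0.
  by move: e; rewrite t0 scale0r add0r subr0 scale1r => /eqP; rewrite (negbTE x0).
have yE : y = (- (1 - t) / t) *: x.
  apply: (scalerI t0); rewrite scalerA mulrCA divff // mulr1.
  by rewrite scaleNr; apply/eqP; rewrite -addr_eq0 e.
move: Qy; rewrite yE (evalp_homog _ _ (dhomog_is_dhomog Q)) => Qy.
have := lt_trans Qy; move: Qy; rewrite ltNge nmulr_lle0 ?sqr_ge0 //.
Qed.

(** * Counting factorizations *)

Definition has_card (T : eqType) (n : nat) (S : set T) : Prop :=
  exists s, [/\ uniq s, size s = n & forall x, S x <-> x \in s].

Section HasCard.
Variable T : eqType.

Lemma has_card0 (S : set T) : (forall x, ~ S x) -> has_card 0 S.
Proof. by move=> h; exists [::]; split=> // x; split=> // /h. Qed.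

Lemma has_card1 (S : set T) x : S x -> (forall y, S y -> y = x) -> has_card 1 S.
Proof.
move=> Sx h; exists [:: x]; split=> // y; rewrite inE.
by split=> [/h -> //|/eqP ->].
Qed.

Lemma has_card_uniq (S : set T) n m : has_card n S -> has_card m S -> n = m.
Proof.
move=> [s [us <- hs]] [t [ut <- ht]]; apply: perm_size; apply: uniq_perm => // x.
by apply/idP/idP => [/hs/ht|/ht/hs].
Qed.

Lemma has_cardU (S1 S2 : set T) n m : has_card n S1 -> has_card m S2 ->
  (forall x, S1 x -> ~ S2 x) -> has_card (n + m) (S1 `|` S2).
Proof.
move=> [s [us <- hs]] [t [ut <- ht]] d; exists (s ++ t); split.
- rewrite cat_uniq us ut andbT /=; apply/hasPn => x /ht xt.
  by apply/negP => /hs xs; apply: (d x).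
- by rewrite size_cat.
- move=> x; rewrite mem_cat; split=> [[/hs ->|/ht ->]|/orP[/hs|/ht]]; rewrite ?orbT //.
    by left.
  by right.
Qed.

Lemma has_card_bigcup (I : eqType) (r : seq I) (S : I -> set T) n : uniq r ->
  (forall i, i \in r -> has_card n (S i)) ->
  (forall i j x, i \in r -> j \in r -> S i x -> S j x -> i = j) ->
  has_card (size r * n) [set x | exists2 i, i \in r & S i x].
Proof.
elim: r => [|i r IH] /=; first by move=> _ _ _; apply: has_card0 => x [].
move=> /andP[ir ur] hc hd; rewrite mulSn.
have -> : [set x | exists2 j, j \in i :: r & S j x] =
    S i `|` [set x | exists2 j, j \in r & S j x].
  apply/seteqP; split=> x /=.
    move=> [j]; rewrite inE => /orP[/eqP ->|jr] Sj; first by left.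
    by right; exists j.
  move=> [Si|[j jr Sj]]; first by exists i; rewrite ?mem_head.
  by exists j; rewrite // inE jr orbT.
apply: has_cardU.
- by apply: hc; rewrite mem_head.
- apply: IH => // [j jr|j j' x jr jr'].
    by apply: hc; rewrite inE jr orbT.
  by apply: hd; rewrite inE ?jr ?jr' orbT.
- move=> x Si [j jr Sj]; move: ir; rewrite (hd i j x) ?mem_head ?inE ?jr ?orbT //.
Qed.

Lemma has_card_image (T' : eqType) (f : T -> T') (S : set T) n :
  injective f -> has_card n S -> has_card n [set y | exists2 x, S x & y = f x].
Proof.
move=> fi [s [us <- hs]]; exists (map f s); split.
- by rewrite map_inj_uniq.
- by rewrite size_map.
- move=> y; split=> [[x /hs xs ->]|/mapP[x /hs xs ->]]; first by rewrite map_f.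
  by exists x.
Qed.

Lemma eq_has_card (S S' : set T) n : (forall x, S x <-> S' x) -> has_card n S -> has_card n S'.
Proof.
move=> e [s [us sn hs]]; exists s; split=> // x.
by split=> [/e/hs|/hs/e].
Qed.

End HasCard.

(** The number (2 m - 1)!! of perfect matchings of 2 m points. *)
Definition double_fact (m : nat) : nat := (\prod_(i < m) (2 * i).+1)%N.

Lemma double_factS m : double_fact m.+1 = ((2 * m).+1 * double_fact m)%N.
Proof. by rewrite /double_fact big_ord_recr /= mulnC. Qed.

Lemma odd_double_fact m : odd (double_fact m).
Proof.
elim: m => [|m IH]; first by rewrite /double_fact big_ord0.
by rewrite double_factS oddM IH /= oddM.
Qed.

Lemma double_fact_gt0 m : (0 < double_fact m)%N.
Proof. by have := odd_double_fact m; case: double_fact. Qed.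

Lemma root_bigprod (R : idomainType) I (s : seq I) (G : I -> {poly R}) x :
  root (\prod_(i <- s) G i) x = has (fun i => root (G i) x) s.
Proof.
elim: s => [|i s IH]; first by rewrite big_nil /root hornerE (negbTE (oner_neq0 _)).
by rewrite big_cons rootM IH.
Qed.

Section RealRoots.
Variable R : realFieldType.
Implicit Types (f h : {poly R}) (rs : seq R).

(** The list rs is that of the real roots, repeated according to their
    multiplicities. *)
Definition real_split f rs h : Prop :=
  f = (\prod_(r <- rs) ('X - r%:P)) * h /\ forall x, ~~ root h x.

Lemma exists_real_split f : f != 0 -> exists rs h, real_split f rs h.
Proof.
have [n] := ubnP (size f); elim: n f => // n IH f sf f0.
have [[r /factor_theorem[g fE]]|nr] := pselect (exists r, root f r); last first.
  exists [::], f; split; first by rewrite big_nil mul1r.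
  by move=> x; apply/negP => fx; apply: nr; exists x.
have g0 : g != 0 by apply: contraNneq f0 => g0; rewrite fE g0 mul0r.
have [|rs [h [gE hr]]] := IH g _ g0.
  by move: sf; rewrite fE size_Mmonic ?monicXsubC // size_XsubC addn2.
by exists (r :: rs), h; split=> //; rewrite big_cons fE gE mulrC mulrA.
Qed.

Lemma root_real_split f rs h x : real_split f rs h -> root f x = (x \in rs).
Proof.
move=> [-> hr]; rewrite rootM (negbTE (hr x)) orbF.
exact: root_prod_XsubC.
Qed.

Lemma real_split_rem f rs h r : real_split f rs h -> r \in rs ->
  exists2 g, f = ('X - r%:P) * g & real_split g (rem r rs) h.
Proof.
move=> [fE hr] rrs; exists ((\prod_(s <- rem r rs) ('X - s%:P)) * h) => //.
by rewrite fE (big_rem r) //= mulrA.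
Qed.

Lemma real_split_uniq f rs h rs' h' :
  real_split f rs h -> real_split f rs' h' -> perm_eq rs rs'.
Proof.
elim: rs f rs' => [|r rs IH] f rs' H H'.
  case: rs' H' => // r' rs' H'; have := root_real_split r' H.
  by rewrite (root_real_split r' H') mem_head.
have rrs' : r \in rs' by rewrite -(root_real_split r H') (root_real_split r H) mem_head.
have [g fE Hg] := real_split_rem H (mem_head r rs); rewrite /= eqxx in Hg.
have [g' fE' Hg'] := real_split_rem H' rrs'.
have gg' : g = g'.
  by apply: (@mulfI _ ('X - r%:P)); rewrite ?polyXsubC_eq0 // -fE.
rewrite -gg' in Hg'; rewrite (permPr (perm_to_rem rrs')) perm_cons.
exact: IH Hg Hg'.
Qed.

Lemma real_split_size f rs h : real_split f rs h ->
  (size rs <= (size f).-1)%N.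
Proof.
move=> [-> hr]; have h0 : h != 0 by apply/eqP => h0; have := hr 0; rewrite h0 root0.
have p0 : \prod_(r <- rs) ('X - r%:P) != 0 by rewrite monic_neq0 // monic_prod_XsubC.
rewrite size_mul // size_prod_XsubC /=; move: h0; rewrite -size_poly_gt0.
by case: (size h) => // n _; rewrite addnS leq_addr.
Qed.

End RealRoots.

Lemma perm_cano_prod (R : realType) (vs ws : seq 'rV[R]_3) :
  all (fun v => v != 0) vs -> all (fun w => w != 0) ws ->
  perm_eq (map cano vs) (map cano ws) ->
  exists2 a, a != 0 & \prod_(v <- vs) linear_form v = a *: \prod_(w <- ws) linear_form w.
Proof.
move=> vs0 ws0 p.
have H us : all (fun v => v != 0) us -> exists2 a, a != 0 &
    \prod_(v <- map cano us) linear_form v = a *: \prod_(u <- us) linear_form u :> mpoly 3 R.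
  elim: us => [_|u us IH /= /andP[u0 us0]].
    by exists 1; rewrite ?oner_eq0 // !big_nil scale1r.
  have [a a0 aE] := IH us0; have [b b0 bE] := cano_scale u0.
  exists (b * a); rewrite ?mulf_neq0 // !big_cons aE bE linear_formZ.
  by rewrite -scalerAl -scalerAr scalerA.
have [a a0 aE] := H _ vs0; have [b b0 bE] := H _ ws0.
exists (a^-1 * b); first by rewrite mulf_neq0 ?invr_eq0.
by rewrite -scalerA -bE -(perm_big _ p) aE scalerA mulVf ?scale1r.
Qed.

Section FactorSet.
Variables (R : realType) (Q : form R 2) (F : conic_frame Q).
Hypothesis Qirr : irreducible_over_C Q.
Local Notation lin := (@linear_form R).
Implicit Types (f h : {poly R}).

(** When f is the restriction of a form P, these are the products of linear
    forms congruent to P modulo Q, i.e. the fiber of Phi over P. *)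
Definition factor_set k f : set (mpoly 3 R) :=
  [set G | exists c vs, [/\ c != 0, size vs = k, all (fun v => v != 0) vs,
     G = c *: \prod_(v <- vs) linear_form v & restr F G = f]].

Lemma prod_linear_homog_seq (vs : seq 'rV[R]_3) :
  \prod_(v <- vs) linear_form v \is @ishomog1 3 R (size vs) mdeg.
Proof.
elim: vs => [|v vs IH]; first by rewrite big_nil dhomog1.
by rewrite big_cons -[size _]add1n; apply: dhomogM => //; apply: linear_form_homog.
Qed.

(** A conic is not contained in any line. *)
Lemma restr_linear_inj v w : restr F (lin v) = restr F (lin w) -> v = w.
Proof.
move=> e; have : divides (Q : mpoly 3 R) (lin v - lin w).
  by apply: (restr_inj (F := F) (k := 1)); rewrite ?linear_form_homog.
have -> : lin v - lin w = lin (v - w).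
  have -> : v - w = (-1) *: w + v by rewrite scaleN1r addrC.
  by rewrite linear_formE scaleN1r addrC.
by move/(irr_ndvd_linear Qirr)/subr0_eq.
Qed.

Lemma restr_linear_neq0 v : v != 0 -> restr F (lin v) != 0.
Proof.
by apply: contraNneq => e; apply/eqP/restr_linear_inj; rewrite e linear_form0 restr0.
Qed.

Lemma restr_prod_neq0 vs : all (fun v => v != 0) vs ->
  restr F (\prod_(v <- vs) lin v) != 0.
Proof.
move=> vs0; rewrite restr_prod prodf_seq_neq0; apply: sub_all vs0 => v.
exact: restr_linear_neq0.
Qed.

(** Each factor contributes at most 2 to the degree, so all of them
    contribute exactly 2 if the product has the largest possible degree. *)
Lemma size_restr_full c vs : c != 0 -> all (fun v => v != 0) vs ->
  size (restr F (c *: \prod_(v <- vs) lin v)) = ((2 * size vs).+1)%N ->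
  forall v, v \in vs -> size (restr F (lin v)) = 3%N.
Proof.
move=> c0; rewrite restrZ size_scale // restr_prod.
have le us : all (fun v => v != 0) us ->
    (size (\prod_(v <- us) restr F (lin v))%R <= (2 * size us).+1)%N.
  move=> us0; rewrite -restr_prod.
  by have [] := restr_top F (prod_linear_homog_seq us).
move=> vs0 e v vvs; move: e; rewrite (big_rem v) //= size_mul; first last.
- rewrite -restr_prod restr_prod_neq0 //.
  by apply/allP => u /mem_rem /(allP vs0).
- by apply: restr_linear_neq0; apply: (allP vs0).
have vs'0 : all (fun v => v != 0) (rem v vs).
  by apply/allP => u /mem_rem /(allP vs0).
pose q := \prod_(u <- rem v vs) restr F (lin u).
have le' : (size q <= (2 * (size vs).-1).+1)%N by rewrite -(size_rem vvs); exact: le.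
move=> e; have {}e : (size (restr F (lin v)) + size q).-1 = ((2 * size vs).+1)%N := e.
have := size_restr_linear F v.
have : (0 < size vs)%N by rewrite -has_predT; apply/hasP; exists v.
move: le' e; move: (size (restr _ _)) (size q) (size vs) => x y n.
by lia.
Qed.

Lemma elliptic_restr v : size (restr F (lin v)) = 3%N ->
  (forall t, ~~ root (restr F (lin v)) t) -> elliptic Q v.
Proof.
move=> s3 nr x x0 vx; apply/eqP => Qx.
have [[t [l [l0 xE]]]|[l l0 xE]] := fr_isotropicP F x0 Qx.
  have := nr t; rewrite /root restrE evalp_linear_form.
  by move: vx; rewrite xE dotvZr => /eqP; rewrite mulf_eq0 (negbTE l0) /= => ->.
have [_] := restr_top F (linear_form_homog v); rewrite evalp_linear_form => e.
have : restr F (lin v) != 0 by rewrite -size_poly_eq0 s3.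
rewrite -lead_coef_eq0 lead_coefE s3 /= -[2%N]muln1 e.
by move: vx; rewrite xE dotvZr => /eqP; rewrite mulf_eq0 (negbTE l0) /= => ->.
Qed.

(** No choice is left by at most one non-elliptic factor. *)
Lemma factor_set_uniq k f c vs G : c != 0 -> size vs = k -> all (fun v => v != 0) vs ->
  (count (fun v => ~~ `[< elliptic Q v >]) vs <= 1)%N ->
  restr F (c *: \prod_(v <- vs) lin v) = f ->
  factor_set k f G -> G = c *: \prod_(v <- vs) lin v.
Proof.
move=> c0 svs vs0 nE fE [d [ws [d0 sws ws0 GE GrE]]].
have : divides (Q : mpoly 3 R) ((d / c) *: \prod_(w <- ws) lin w - \prod_(v <- vs) lin v).
  apply: (restr_inj (F := F) (k := k)).
  - by apply: dhomogZ; rewrite -sws; apply: prod_linear_homog_seq.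
  - by rewrite -svs; apply: prod_linear_homog_seq.
  apply: (scalerI c0); rewrite -!restrZ scalerA mulrC divfK // -GE fE.
  exact: GrE.
have dc0 : d / c != 0 by rewrite mulf_neq0 ?invr_eq0.
move/(linear_factors_uniq_modQ Qirr vs0 ws0 (etrans svs (esym sws)) dc0 nE).
move=> /(perm_cano_prod vs0 ws0)[a a0 aE].
rewrite aE GE scalerA; congr (_ *: _); apply/eqP.
have := GrE; rewrite -fE GE aE scalerA !restrZ => /eqP.
rewrite -subr_eq0 -scalerBl scaler_eq0 subr_eq0 => /orP[//|].
by rewrite (negbTE (restr_prod_neq0 ws0)).
Qed.

(** A root r0 occurs in exactly one factor, which pairs it with another root:
    this splits the factorizations of f according to the partner r of r0. *)
Lemma factor_set_split k f rs h r0 G : size f = ((2 * k.+1).+1)%N ->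
  real_split f (r0 :: rs) h ->
  factor_set k.+1 f G <->
  exists2 r, r \in rs & exists2 G', factor_set k ((\prod_(s <- rem r rs) ('X - s%:P)) * h) G' &
    G = lin (vec_of_poly F (('X - r0%:P) * ('X - r%:P))) * G'.
Proof.
move=> sf sp; have [g fE spg] := real_split_rem sp (mem_head r0 rs).
rewrite /= eqxx in spg.
have f0 : f != 0 by rewrite -size_poly_gt0 sf.
have sq r : size (('X - r0%:P) * ('X - r%:P)) = 3%N.
  by rewrite size_Mmonic ?monicXsubC ?polyXsubC_eq0 // !size_XsubC.
have rq r : restr F (lin (vec_of_poly F (('X - r0%:P) * ('X - r%:P)))) = ('X - r0%:P) * ('X - r%:P).
  by rewrite restr_vec_of_poly // sq.
split=> [[c [vs [c0 svs vs0 GE GrE]]]|[r rrs [G' [c [vs [c0 svs vs0 G'E G'rE]]] ->]]]; last first.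
  set v := vec_of_poly _ _; exists c, (v :: vs); split=> //=.
  - by rewrite svs.
  - rewrite vs0 andbT -linear_form_eq0; apply/eqP => v00.
    by have := sq r; rewrite -rq -/v v00 restr0 size_poly0.
  - by rewrite big_cons G'E scalerAr.
  rewrite restrM G'rE rq; case: sp => fE' _; rewrite fE'.
  by rewrite big_cons (big_rem r rrs) /= !mulrA.
have full : size (restr F (c *: \prod_(v <- vs) lin v)) = ((2 * size vs).+1)%N.
  by rewrite -GE GrE sf svs.
have : root f r0 by rewrite (root_real_split r0 sp) mem_head.
rewrite -GrE GE restrZ rootZ // restr_prod root_bigprod.
move=> /hasP[v vvs rv]; have s3 := size_restr_full c0 vs0 full vvs.
have v0 := allP vs0 v vvs.
have /factor_theorem[l lE] := rv.
have sl : size l = 2%N.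
  have l0 : l != 0 by apply: contra_eq_neq s3 => l0; rewrite lE l0 mul0r size_poly0.
  by move: s3; rewrite lE size_Mmonic ?monicXsubC // size_XsubC addn2 => -[].
have [r rl] : exists r, root l r.
  have l1 : l`_1 != 0 by rewrite -[1%N]/(2.-1)%N -sl -lead_coefE lead_coef_eq0 -size_poly_eq0 sl.
  exists (- l`_0 / l`_1); apply/rootP; rewrite (horner_coef_wide _ (n := 2)) ?sl //.
  by rewrite !big_ord_recl big_ord0 /=; field.
have /factor_theorem[m mE] := rl.
have [a mC] : exists a, m = a%:P.
  exists m`_0; apply: size1_polyC; move: sl; have [->|m0] := eqVneq m 0; first by rewrite size_poly0.
  by rewrite mE size_Mmonic ?monicXsubC // size_XsubC addn2 => -[->].
pose q := ('X - r0%:P) * ('X - r%:P).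
have vE : v = a *: vec_of_poly F q.
  apply: restr_linear_inj; rewrite linear_formZ restrZ rq lE mE mC -mul_polyC; ring.
have a0 : a != 0 by apply: contraNneq v0 => a0; rewrite vE a0 scale0r.
have GE' : G = lin (vec_of_poly F q) * ((c * a) *: \prod_(u <- rem v vs) lin u).
  by rewrite GE (big_rem v) //= {1}vE linear_formZ -scalerAr -scalerAl scalerA.
have rest : g = ('X - r%:P) * restr F ((c * a) *: \prod_(u <- rem v vs) lin u).
  apply: (@mulfI _ ('X - r0%:P)); first by rewrite polyXsubC_eq0.
  by rewrite -fE -GrE GE' restrM rq mulrA.
have rrs : r \in rs.
  by rewrite -(root_real_split r spg) rest rootM root_XsubC eqxx.
exists r => //; exists ((c * a) *: \prod_(u <- rem v vs) lin u); last by rewrite -GE; exact: GE'.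
exists (c * a), (rem v vs); split=> //.
- by rewrite mulf_neq0.
- by rewrite size_rem // svs.
- by apply/allP => u /mem_rem /(allP vs0).
apply: (@mulfI _ ('X - r%:P)); first by rewrite polyXsubC_eq0.
by rewrite -rest; case: spg => -> _; rewrite (big_rem r) //= mulrA.
Qed.

(** Pair the root r0 with one of the 2 m - 1 others: what remains has 2 m - 2
    real roots. Without real roots all factors are elliptic, and the
    factorization is unique. *)
Theorem card_factor_set k f rs h m : size f = ((2 * k).+1)%N -> real_split f rs h ->
  uniq rs -> size rs = (2 * m)%N -> has_card (double_fact m) (factor_set k f).
Proof.
elim: m k f rs => [|m IH] k f rs sf sp urs srs.
  have f0 : f != 0 by rewrite -size_poly_gt0 sf.
  rewrite muln0 in srs; rewrite (size0nil srs) in sp.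
  have nr t : ~~ root f t by rewrite (root_real_split t sp).
  have [c [vs [c0 svs vs0 e]]] := indefinite_factorization F f0 (eq_leq sf).
  rewrite /double_fact big_ord0; apply: (@has_card1 _ _ (c *: \prod_(v <- vs) lin v)).
    by exists c, vs.
  move=> G; apply: factor_set_uniq => //.
  rewrite (@eq_in_count _ _ pred0) ?count_pred0 // => v vvs /=.
  apply/negbTE; rewrite negbK; apply/asboolP/elliptic_restr.
    by apply: (size_restr_full c0 vs0) vvs; rewrite e svs.
  move=> t; apply: contra (nr t); rewrite -e restrZ rootZ // restr_prod root_bigprod => rv.
  by apply/hasP; exists v.
case: rs sp urs srs => [|r0 rs] sp /=; first by lia.
move=> /andP[r0rs urs] srs.
case: k sf => [|k] sf.
  by have := real_split_size sp; rewrite sf /=.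
have {}srs : size rs = ((2 * m).+1)%N by move: srs; rewrite mulnS => -[].
pose q r := vec_of_poly F (('X - r0%:P) * ('X - r%:P)).
pose f' r := (\prod_(s <- rem r rs) ('X - s%:P)) * h.
pose S r : set (mpoly 3 R) := [set G | exists2 G', factor_set k (f' r) G' & G = lin (q r) * G'].
have sq r : size (('X - r0%:P) * ('X - r%:P)) = 3%N.
  by rewrite size_Mmonic ?monicXsubC ?polyXsubC_eq0 // !size_XsubC.
have rq r : restr F (lin (q r)) = ('X - r0%:P) * ('X - r%:P).
  by rewrite restr_vec_of_poly // sq.
have q0 r : q r != 0.
  by rewrite -linear_form_eq0; apply/eqP => h0; have := sq r; rewrite -rq h0 restr0 size_poly0.
have fE r : r \in rs -> f = ('X - r0%:P) * ('X - r%:P) * f' r.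
  by move=> rrs; case: sp => -> _; rewrite big_cons (big_rem r) //= /f' !mulrA.
have spr r : real_split (f' r) (rem r rs) h by split=> //; case: sp.
rewrite double_factS -srs.
apply: (@eq_has_card _ [set G | exists2 r, r \in rs & S r G]).
  by move=> G; rewrite (factor_set_split _ sf sp).
apply: has_card_bigcup => // [r rrs|r r' G rrs r'rs [G1 G1f GE] [G2 G2f GE']].
  apply: has_card_image.
    by move=> G1 G2; apply: mulfI; rewrite linear_form_eq0.
  apply: (IH _ _ (rem r rs)) => //; last 2 first.
  - exact: rem_uniq.
  - by rewrite size_rem // srs.
  have f'0 : f' r != 0.
    by apply/eqP => h0; move: sf; rewrite (fE r rrs) h0 mulr0 size_poly0.
  have /eqP := sf; rewrite (fE r rrs) size_mul ?sq //; last by rewrite -size_poly_gt0 sq.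
  by move: (size (f' r)) => n /eqP; lia.
have [//|rr'] := eqVneq r r'.
have : divides (lin (q r')) (lin (q r) * G1) by exists G2; rewrite -GE GE'.
case/(linear_form_prime (q0 r')) => [/(linear_form_dvd_linear (q0 r'))[a qE]|[G3 G3E]].
  have := congr1 (fun v => restr F (lin v)) qE; rewrite /= linear_formZ restrZ !rq => e.
  have e' : ('X - r%:P) = a *: ('X - r'%:P).
    by apply: (@mulfI _ ('X - r0%:P)); rewrite ?polyXsubC_eq0 // -scalerAr.
  have := congr1 (fun p => p.[r']) e'; rewrite !hornerE subrr mulr0 => /eqP.
  by rewrite subr_eq0 eq_sym => /eqP.
have G1r : restr F G1 = f' r by case: G1f => c [vs [_ _ _ _]].
have : root (f' r) r0 by rewrite -G1r G3E restrM rq !rootM root_XsubC eqxx.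
rewrite (root_real_split _ (spr r)) => /mem_rem r0rs'.
by rewrite r0rs' in r0rs.
Qed.

End FactorSet.

(** * Multiplicity of a common line *)

Lemma evalp_sum (R : realType) I (r : seq I) (p : pred I) (G : I -> mpoly 3 R) x :
  evalp (\sum_(i <- r | p i) G i) x = \sum_(i <- r | p i) evalp (G i) x.
Proof. exact: (raddf_sum (meval (fun i => x 0 i))). Qed.

Section Multiplicity.
Variables (R : realType) (Q : form R 2) (F : conic_frame Q).
Hypothesis Qirr : irreducible_over_C Q.
Local Notation pt := (fr_pt F).
Implicit Types (g h : mpoly 3 R) (t : R).

(** On the line of a point the components of a given degree are the
    coefficients in r. *)
Lemma evalp_cone g r t :
  evalp g (r *: pt t) =
  \sum_(d < msize g) r ^+ d * (restr F (pihomog mdeg d g)).[t].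
Proof.
rewrite {1}(pihomog_partitionE (mf := mdeg) (leqnn (msize g))).
rewrite /evalp raddf_sum; apply: eq_bigr => d _.
by rewrite restrE -evalp_homog ?pihomogP.
Qed.

Lemma evalp_cone_poly g t : exists p : {poly R}, forall r, p.[r] = evalp g (r *: pt t).
Proof. by have [p pE] := evalp_line g 0 (pt t); exists p => r; rewrite pE add0r. Qed.

Lemma evalp_cone_comp g t : (forall r, evalp g (r *: pt t) = 0) ->
  forall d, (restr F (pihomog mdeg d g)).[t] = 0.
Proof.
move=> g0 d; have [dg|dg] := ltnP d (msize g); last first.
  have -> : pihomog mdeg d g = 0.
    rewrite pihomogE big_seq_cond big1 // => m /andP[/msize_mdeg_lt mg /eqP md].
    by have := leq_trans mg dg; rewrite -md ltnn.
  by rewrite restr0 horner0.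
pose p := \poly_(d < msize g) (restr F (pihomog mdeg d g)).[t].
suff p0 : p = 0 by have := coef_poly (msize g) (fun d => (restr F (pihomog mdeg d g)).[t]) d;
  rewrite -/p p0 coef0 dg.
apply: poly_ext => r; rewrite horner0 -(g0 r) evalp_cone horner_poly.
by apply: eq_bigr => i _; rewrite mulrC.
Qed.

(** The homogeneous components of g vanish on the conic. *)
Lemma cone_divides g : (forall r t, evalp g (r *: pt t) = 0) -> divides (Q : mpoly 3 R) g.
Proof.
move=> g0; rewrite (pihomog_partitionE (mf := mdeg) (leqnn (msize g))).
elim/big_rec: _ => [|d p _ hp]; first exact: divides0.
apply: dividesD => //; apply: (restr_eq0 (F := F) (pihomogP mdeg d g)).
by apply: poly_ext => t; rewrite horner0 evalp_cone_comp.
Qed.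

(** The quotient by Q of the local ring of a line is a discrete valuation ring:
    on the cone, every function vanishing on the line of pt s is a multiple of
    the local parameter t - s. *)
Lemma cone_div_param g s : (forall r, evalp g (r *: pt s) = 0) ->
  exists g1, forall r t, evalp g (r *: pt t) = (t - s) * evalp g1 (r *: pt t).
Proof.
move=> g0; have comp d : exists P : form R d,
    restr F (pihomog mdeg d g) = ('X - s%:P) * restr F P.
  have /factor_theorem[p pE] : root (restr F (pihomog mdeg d g)) s.
    by apply/rootP/evalp_cone_comp.
  have [|P PE] := @restr_lift _ _ F d p.
    have [+ _] := restr_top F (pihomogP mdeg d g); rewrite pE.
    have [->|p0] := eqVneq p 0; first by rewrite size_poly0.
    by rewrite size_Mmonic ?monicXsubC // size_XsubC addn2 => /ltnW.
  by exists P; rewrite PE mulrC.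
have [G hG] : exists G : nat -> mpoly 3 R, forall d, G d \is @ishomog1 3 R d mdeg /\
    restr F (pihomog mdeg d g) = ('X - s%:P) * restr F (G d).
  have [G hG] := @boolp.choice nat (mpoly 3 R) (fun d G => G \is @ishomog1 3 R d mdeg /\
    restr F (pihomog mdeg d g) = ('X - s%:P) * restr F G)
    (fun d => let: ex_intro P e := comp d in ex_intro _ (P : mpoly 3 R) (conj (dhomog_is_dhomog P) e)).
  by exists G.
exists (\sum_(d < msize g) G d) => r t; rewrite evalp_cone.
rewrite [in RHS]/evalp raddf_sum mulr_sumr; apply: eq_bigr => d _ /=.
have [hd ->] := hG d; rewrite -/(evalp _ _) (evalp_homog _ _ hd) -restrE.
by rewrite hornerM hornerXsubC; ring.
Qed.

Definition cone_vanish s n g :=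
  exists g1, forall r t, evalp g (r *: pt t) = (t - s) ^+ n * evalp g1 (r *: pt t).

Definition cone_unit s g := exists r, evalp g (r *: pt s) != 0.

(** The order of vanishing along the line of pt s, as a normalized
    valuation: (t - s)^n times a unit of the local ring. *)
Definition cone_order s n g :=
  exists2 g1, cone_unit s g1 &
    forall r t, evalp g (r *: pt t) = (t - s) ^+ n * evalp g1 (r *: pt t).

Lemma cone_order_cases s n g : cone_vanish s n g \/ exists2 m, (m < n)%N & cone_order s m g.
Proof.
elim: n => [|n [[g1 hg1]|[m mn hm]]]; first by left; exists g => r t; rewrite mul1r.
  have [u|nu] := pselect (cone_unit s g1); first by right; exists n => //; exists g1.
  left; have [r|g2 hg2] := @cone_div_param g1 s.
    by apply/eqP; apply: contraT => ne; case: nu; exists r.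
  by exists g2 => r t; rewrite hg1 hg2 exprSr mulrA.
by right; exists m => //; exact: ltnW.
Qed.

(** In a discrete valuation ring an element divides those of larger
    valuation. *)
Lemma cone_order_dvd s n f g : cone_order s n f -> cone_vanish s n g ->
  exists h u v, cone_unit s h /\ h * g = u * f + v * (Q : mpoly 3 R).
Proof.
move=> [f1 uf fE] [g1 gE].
have [v vE] : divides (Q : mpoly 3 R) (f1 * g - g1 * f).
  by apply: cone_divides => r t; rewrite evalpB !evalpM fE gE; ring.
by exists f1, g1, v; split=> //; rewrite [v * _]mulrC -vE addrC subrK.
Qed.

Variables (k : nat) (P : form R k).
Hypothesis Pb : evalp P (fr_b F) != 0.

(** At a point where P or Q does not vanish, P or Q is a unit and no strict
    chain starts. The point at infinity is excluded by the hypothesis on P. *)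
Lemma line_mult_ge_point (a : nzvec R) m : (0 < m)%N -> line_mult_ge P Q a m ->
  exists t l, l != 0 /\ \val a = l *: pt t.
Proof.
move=> m0 [g hg]; have a0 : \val a != 0 by exact: set_mem (valP a).
have bad h : (h = P :> mpoly 3 R \/ h = Q :> mpoly 3 R) -> evalp h (\val a) = 0.
  move=> hE; apply/eqP; apply: contraT => ha; case: (hg (Ordinal m0) h).
    by exists 1; rewrite scale1r.
  case: hE => ->; [exists (g (Ordinal m0)), 0|exists 0, (g (Ordinal m0))]; exists (fun=> 0);
    by rewrite big1 ?mul0r ?addr0 ?add0r 1?mulrC // => j _; rewrite mul0r.
have [//|[l l0 aE]] := fr_isotropicP F a0 (bad Q (or_intror erefl)).
have := bad P (or_introl erefl); rewrite aE (evalp_homog _ _ (dhomog_is_dhomog P)).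
by move/eqP; rewrite mulf_eq0 expf_eq0 (negbTE l0) andbF (negbTE Pb).
Qed.

(** In the discrete valuation ring of the line modulo Q, where the element P
    has valuation n, each strict inclusion in a chain of ideals that starts with
    (P) decreases the valuation, so n is at least m. Conversely the powers
    (t - s)^(m - 1), ..., t - s, 1 give such a chain. *)
Lemma line_mult_geP (a : nzvec R) m s l : l != 0 -> \val a = l *: pt s ->
  line_mult_ge P Q a m <-> divides (('X - s%:P) ^+ m) (restr F P).
Proof.
move=> l0 aE.
have P0 : restr F P != 0.
  by apply: contraNneq Pb => h; have [_ <-] := restr_top F (dhomog_is_dhomog P); rewrite h coef0.
split=> [[g hg]|[p PE]].
  have [n [p [ps PE]]] : exists n (p : {poly R}), ~~ root p s /\ restr F P = p * ('X - s%:P) ^+ n.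
    by have [n [p ps PE]] := multiplicity_XsubC (restr F P) s; exists n, p; rewrite P0 /= in ps.
  have ordP : cone_order s n P.
    have [|P1 P1E] := @restr_lift _ _ F k p.
      have p0 : p != 0 by apply: contraNneq ps => ->; rewrite root0.
      have [+ _] := restr_top F (dhomog_is_dhomog P); rewrite PE size_Mmonic ?monic_exp ?monicXsubC //.
      by rewrite size_exp_XsubC addnS /=; apply: leq_trans; apply: leq_addr.
    exists P1 => [|r t]; first by exists 1; rewrite scale1r -restrE P1E.
    rewrite !(evalp_homog _ _ (dhomog_is_dhomog _)) -!restrE PE P1E hornerM horner_exp hornerXsubC.
    by rewrite [p.[t] * _]mulrC mulrCA.
  suff H i : (i <= m)%N -> exists f o, [/\ cone_order s o f, (o + i <= n)%N &
      forall h : mpoly 3 R, exists u (c : 'I_m -> mpoly 3 R),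
        h * f = u * (P : mpoly 3 R) + \sum_(j < m | (j < i)%N) c j * g j].
    have [f [o [_ on _]]] := H m (leqnn m).
    exists (p * ('X - s%:P) ^+ (n - m)); rewrite PE mulrCA -exprD subnKC //.
    by rewrite (leq_trans _ on) // leq_addl.
  elim: i => [|i IH] im.
    exists (P : mpoly 3 R), n; split; rewrite ?addn0 // => h.
    by exists h, (fun=> 0); rewrite big_pred0_eq addr0.
  have [f [o [fo on hf]]] := IH (ltnW im).
  have [va|[o' o'o go]] := cone_order_cases s o (g (Ordinal im)).
    have [h [u [v [[r hr] e]]]] := cone_order_dvd fo va.
    case: (hg (Ordinal im) h).
      by exists (r / l); rewrite aE scalerA divfK.
    have [u' [c hc]] := hf u; exists u', v, c; rewrite e hc.
    by rewrite addrAC.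
  exists (g (Ordinal im)), o'; split=> //; first by rewrite addnS (leq_trans _ on) // ltn_add2r.
  move=> h; exists 0, (fun j => if j == Ordinal im then h else 0).
  rewrite mul0r add0r (bigD1 (Ordinal im)) //= eqxx big1 ?addr0 // => j /andP[_ /negbTE ->].
  by rewrite mul0r.
pose L : mpoly 3 R := linear_form (vec_of_poly F ('X - s%:P)).
have LE r t : evalp L (r *: pt t) = r * (t - s).
  rewrite /L (evalp_homog _ _ (linear_form_homog _)) -restrE.
  by rewrite restr_vec_of_poly ?size_XsubC // !hornerE.
exists (fun i => L ^+ (m.-1 - i)) => i h [t0 ht0] [u [v [c e]]].
have [r r0 hr] : exists2 r, r != 0 & evalp h (r *: pt s) != 0.
  apply: contrapT => hN; have [q qE] := evalp_cone_poly h s.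
  have q0 : q = 0.
    apply: poly_eq0_off0 => t t0'; rewrite qE; apply/eqP; apply: contraT => ne.
    by case: hN; exists t.
  by move: ht0; rewrite aE scalerA -qE q0 horner0 eqxx.
have cp g : exists q : {poly R}, forall t, q.[t] = evalp g (r *: pt t).
  exists (conic_restr idfun (fun i => r * fr_a F 0 i) (fun i => r * fr_c F 0 i)
     (fun i => r * fr_b F 0 i) g) => t.
  rewrite horner_conic_restr; apply: eq_bigr => j _; congr (_ * _).
  by apply: mmap1_eq => i'; rewrite !mxE; ring.
have [hp hpE] := cp h; have [up upE] := cp u.
have [cq cqE] : exists cq : 'I_m -> {poly R}, forall j t, (cq j).[t] = evalp (c j) (r *: pt t).
  by have [cq hcq] := boolp.choice (fun j => cp (c j)); exists cq.
pose n := (m.-1 - i)%N; have im := ltn_ord i.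
have e' : (r ^+ n)%:P * hp * ('X - s%:P) ^+ n =
    (r ^+ k)%:P * up * (('X - s%:P) ^+ m * p)
    + \sum_(j < m | (j < i)%N) (r ^+ (m.-1 - j))%:P * cq j * ('X - s%:P) ^+ (m.-1 - j).
  apply: poly_ext => t; have := congr1 (fun G => evalp G (r *: pt t)) e.
  rewrite -PE hornerD horner_sum !hornerM !hornerC !horner_exp hornerXsubC hpE upE.
  rewrite !evalpD !evalpM (evalp_homog _ _ (dhomog_is_dhomog P)) -restrE.
  rewrite [evalp Q _](evalp_homog _ _ (dhomog_is_dhomog Q)) fr_pt_isotropic !mulr0 addr0.
  have LX j : evalp (L ^+ j) (r *: pt t) = r ^+ j * (t - s) ^+ j.
    by rewrite -exprMn -LE /evalp rmorphXn.
  rewrite LX => e1; rewrite -/n in e1 *.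
  rewrite [LHS](_ : _ = evalp h (r *: pt t) * (r ^+ n * (t - s) ^+ n)); last by ring.
  rewrite e1 evalp_sum; congr (_ + _); first by rewrite mulrCA mulrA.
  apply: eq_bigr => j _; rewrite evalpM LX !hornerM hornerC horner_exp hornerXsubC cqE.
  by ring.
have : divides ('X - s%:P) ((r ^+ n)%:P * hp).
  have [q qE] : divides (('X - s%:P) ^+ n.+1) ((r ^+ n)%:P * hp * ('X - s%:P) ^+ n).
    rewrite e'; apply: dividesD.
      apply: divides_mull; apply: divides_mulr; exists (('X - s%:P) ^+ (m - n.+1)).
      by rewrite -exprD subnKC // /n; lia.
    elim/big_rec: _ => [|j q' ji hq]; first exact: divides0.
    apply: dividesD => //; apply: divides_mull; exists (('X - s%:P) ^+ (m.-1 - j - n.+1)).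
    by rewrite -exprD subnKC // /n; have := ltn_ord j; lia.
  exists q; apply: (@mulIf _ (('X - s%:P) ^+ n)); first by rewrite expf_neq0 // polyXsubC_eq0.
  by rewrite qE exprS; ring.
move=> [q /(congr1 (fun p => p.[s]))]; rewrite !hornerE subrr mul0r hpE => /eqP.
by rewrite mulf_eq0 expf_eq0 (negbTE r0) andbF (negbTE hr).
Qed.

Lemma point_mult_ge_point (a : nzvec R) m : (0 < m)%N -> point_mult_ge P Q a m ->
  exists t l, l != 0 /\ \val a = l *: pt t.
Proof.
move=> m0 [d [f hf]]; have a0 : \val a != 0 by exact: set_mem (valP a).
have c0 : exists i : 'I_m, (1 : R) != 0 by exists (Ordinal m0); rewrite oner_eq0.
have Pa : evalp P (\val a) = 0.
  apply/eqP; apply: contraT => ha; case: (hf (fun=> 1) c0 k P ha).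
  by exists (\sum_i 1 *: (f i : mpoly 3 R)), 0; rewrite mul0r addr0 mulrC.
have Qa : evalp Q (\val a) = 0.
  apply/eqP; apply: contraT => ha; case: (hf (fun=> 1) c0 2 Q ha).
  by exists 0, (\sum_i 1 *: (f i : mpoly 3 R)); rewrite mul0r add0r mulrC.
have [//|[l l0 aE]] := fr_isotropicP F a0 Qa.
have := Pa; rewrite aE (evalp_homog _ _ (dhomog_is_dhomog P)).
by move/eqP; rewrite mulf_eq0 expf_eq0 (negbTE l0) andbF (negbTE Pb).
Qed.

(** If the restriction of P does not vanish doubly at s, every function
    vanishing at s is a multiple of P in the local ring, and some combination of
    two given germs vanishes there. Otherwise 1 and t - s are independent. *)
Lemma point_mult_ge2P (a : nzvec R) s l : l != 0 -> \val a = l *: pt s ->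
  point_mult_ge P Q a 2 <-> divides (('X - s%:P) ^+ 2) (restr F P).
Proof.
move=> l0 aE.
have at_a d (G : mpoly 3 R) : G \is @ishomog1 3 R d mdeg ->
    (evalp G (\val a) == 0) = ((restr F G).[s] == 0).
  by move=> hG; rewrite aE (evalp_homog _ _ hG) mulf_eq0 expf_eq0 (negbTE l0) andbF -restrE.
split=> [[d [f hf]]|[p PE]].
  apply: contrapT => ndiv.
  have [c cn gs] : exists2 c : 'I_2 -> R, (exists i, c i != 0) &
      (restr F (\sum_i c i *: (f i : mpoly 3 R))).[s] = 0.
    pose v i := (restr F (f i)).[s].
    have [/existsP[i vi]|/existsPn vn] := boolP [exists i, v i != 0].
      exists (fun j => if j == 0 then v 1 else - v 0).
        have : (i == 0) || (i == 1) by case: i vi => -[|[|?]].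
        by move=> /orP[] /eqP iE; move: vi; rewrite iE => vi; [exists 1|exists 0]; rewrite ?oppr_eq0.
      rewrite restr_sum horner_sum !big_ord_recl big_ord0 /= !restrZ !hornerZ /v.
      have -> : lift ord0 ord0 = 1 :> 'I_2 by apply/val_inj.
      by ring.
    exists (fun=> 1); first by exists 0; rewrite oner_eq0.
    rewrite restr_sum horner_sum big1 // => i _; rewrite restrZ hornerZ.
    by have := vn i; rewrite negbK /v => /eqP ->; rewrite mulr0.
  set g := \sum_i _ in gs.
  have hg : g \is @ishomog1 3 R d mdeg.
    by rewrite rpred_sum // => i _; apply: dhomogZ; apply: dhomog_is_dhomog.
  have [p [q [ps sp sq e]]] : exists p q : {poly R}, [/\ ~~ root p s, (size p <= (2 * k).+1)%N,
      (size q <= (2 * d).+1)%N & p * restr F g = q * restr F P].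
    have [sP _] := restr_top F (dhomog_is_dhomog P); have [sg _] := restr_top F hg.
    have [/factor_theorem[p PE]|Ps] := boolP (root (restr F P) s); last first.
      by exists (restr F P), (restr F g); split=> //; rewrite mulrC.
    have /factor_theorem[q gE] : root (restr F g) s by apply/rootP.
    exists p, q; split; last by rewrite PE gE; ring.
    - apply/negP => /factor_theorem[p' pE]; apply: ndiv; exists p'.
      by rewrite PE pE expr2; ring.
    - move: sP; rewrite PE; have [->|p0] := eqVneq p 0; first by rewrite size_poly0.
      by rewrite size_Mmonic ?monicXsubC // size_XsubC addn2 => /ltnW.
    - move: sg; rewrite gE; have [->|p0] := eqVneq q 0; first by rewrite size_poly0.
      by rewrite size_Mmonic ?monicXsubC // size_XsubC addn2 => /ltnW.
  have [h hE] := restr_lift F sp; have [u uE] := restr_lift F sq.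
  case: (hf c cn k h); first by rewrite (at_a _ _ (dhomog_is_dhomog h)) hE.
  have [v vE] : divides (Q : mpoly 3 R) ((h : mpoly 3 R) * g - (u : mpoly 3 R) * P).
    apply: (restr_eq0 (F := F) (k := k + d)).
      have h2 := dhomogM (dhomog_is_dhomog u) (dhomog_is_dhomog P); rewrite addnC in h2.
      exact: rpredB (dhomogM (dhomog_is_dhomog h) hg) h2.
    by rewrite restrB !restrM hE uE e subrr.
  by exists (u : mpoly 3 R), v; rewrite [v * _]mulrC -vE addrC subrK.
pose f (i : 'I_2) : form R 1 :=
  DHomog (linear_form_homog (vec_of_poly F (if i == 0 then 1 else 'X - s%:P))).
exists 1%N, f => c [i ci] e h ha [u [v /(congr1 (restr F))]].
rewrite !(restrD, restrM) restr_Q mulr0 addr0 PE restr_sum !big_ord_recl big_ord0 /= !restrZ.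
rewrite !restr_vec_of_poly ?size_poly1 ?size_XsubC //.
have -> : lift ord0 ord0 = 1 :> 'I_2 by apply/val_inj.
rewrite (at_a _ _ (dhomog_is_dhomog h)) in ha => E.
have c0 : c 0 = 0.
  have := congr1 (fun p => p.[s]) E; rewrite alg_polyC addr0 !hornerM hornerD hornerC.
  rewrite hornerZ !hornerXsubC subrr !mul0r !mulr0 addr0 => /eqP.
  by rewrite mulf_eq0 (negbTE ha) => /eqP.
have c1 : c 1 = 0.
  have E' : restr F h * (c 1)%:P = restr F u * (('X - s%:P) * p).
    apply: (@mulIf _ ('X - s%:P)); first by rewrite polyXsubC_eq0.
    move: E; rewrite c0 scale0r add0r addr0 -mul_polyC => E.
    by rewrite -mulrA E expr2; ring.
  have := congr1 (fun p => p.[s]) E'; rewrite !hornerM hornerC hornerXsubC subrr mul0r mulr0.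
  by move=> /eqP; rewrite mulf_eq0 (negbTE ha) => /eqP.
have : (i == 0) || (i == 1) by case: i ci => -[|[|?]].
by move=> /orP[] /eqP iE; move: ci; rewrite iE ?c0 ?c1 eqxx.
Qed.

End Multiplicity.

(** The remaining factor h has no real root. *)
Lemma dvdXsubC_real_split (R : realFieldType) (f h : {poly R}) rs s m : real_split f rs h ->
  divides (('X - s%:P) ^+ m) f <-> (m <= count_mem s rs)%N.
Proof.
elim: m f rs => [|m IH] f rs sp; first by split=> // _; exists f; rewrite mul1r.
split=> [[p fE]|mc].
  have srs : s \in rs by rewrite -(root_real_split s sp) fE exprS !rootM root_XsubC eqxx.
  have [g gE spg] := real_split_rem sp srs.
  have : divides (('X - s%:P) ^+ m) g.
    by exists p; apply: (@mulfI _ ('X - s%:P)); rewrite ?polyXsubC_eq0 // -gE fE exprS mulrA.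
  by move/(IH _ _ spg); rewrite (seq.permP (perm_to_rem srs)) /= eqxx.
have srs : s \in rs by rewrite -has_pred1 has_count (leq_trans _ mc).
have [g -> spg] := real_split_rem sp srs.
have /(IH _ _ spg)[p ->] : (m <= count_mem s (rem s rs))%N.
  by move: mc; rewrite (seq.permP (perm_to_rem srs)) /= eqxx.
by exists p; rewrite exprS mulrA.
Qed.

(** * Topology of forms and of quotients *)

Section GeneralTopology.
Variables (Z X Y : topologicalType).

Lemma cts_ptws (I : Type) (f : Z -> {ptws I -> X}) z :
  (forall i, {for z, continuous (fun y => f y i)}) -> {for z, continuous f}.
Proof.
move=> h; apply/cvg_sup => i U [W [[V oV VW] Wz] WU].
apply: (@filterS _ _ _ (f @^-1` W)); first by move=> y; apply: WU.
rewrite -VW; apply: (h i V); apply: open_nbhs_nbhs; split=> //.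
by move: Wz; rewrite -VW.
Qed.

Lemma ptws_cts (I : eqType) (i : I) (f : {ptws I -> X}) :
  {for f, continuous (fun g : {ptws I -> X} => g i)}.
Proof. exact: (@proj_continuous I (fun=> X) i f). Qed.

Lemma cts_initial (S : choiceType) (w : S -> X) (f : Z -> initial_topology w) z :
  {for z, continuous (w \o f)} -> {for z, continuous f}.
Proof.
move=> h U [W [[V oV VW] Wz] WU].
apply: (@filterS _ _ _ (f @^-1` W)); first by move=> y; apply: WU.
rewrite -VW; apply: (h V); apply: open_nbhs_nbhs; split=> //.
by move: Wz; rewrite -VW.
Qed.

Lemma cts_set_type (A : set X) (f : Z -> A) z :
  {for z, continuous (fun y => \val (f y))} -> {for z, continuous f}.
Proof. exact: (@cts_initial _ (set_val : A -> X)). Qed.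

Lemma set_val_cts (A : set X) (x : A) : {for x, continuous (fun y : A => \val y)}.
Proof. exact: (@initial_continuous _ _ (set_val : A -> X)). Qed.

Definition open_map (p : X -> Y) := forall x N, nbhs x N -> nbhs (p x) (p @` N).

Lemma open_mapP (p : X -> Y) : (forall A, open A -> open (p @` A)) -> open_map p.
Proof.
move=> h x N /nbhs_interior; rewrite /interior => Nx.
have := Nx; rewrite nbhsE => -[A [oA Ax] AN].
apply: (@filterS _ _ _ (p @` A)).
  by move=> _ [a /AN /nbhs_singleton aN <-]; exists a.
by apply: open_nbhs_nbhs; split; [exact: h|exists x].
Qed.

Lemma cts_open_map (p : X -> Y) (f : Y -> Z) x : open_map p ->
  {for x, continuous (f \o p)} -> {for p x, continuous f}.
Proof.
move=> op h V hV; have := op x _ (h V hV); apply: filterS.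
by move=> _ [a aV <-].
Qed.

(** Openness is used because, unlike an open map, a quotient map need not
    remain one after taking the product with a space. *)
Lemma cts_open_mapl (T : topologicalType) (p : X -> Y) (f : Y * T -> Z) x t : open_map p ->
  {for (x, t), continuous (fun xt : X * T => f (p xt.1, xt.2))} ->
  {for (p x, t), continuous f}.
Proof.
move=> op h V hV; have [[N M] [/= Nx Mt] NM] := h V hV.
exists (p @` N, M); first by split=> //=; apply: op.
by move=> [_ s] /= [[y Ny <-] Ms]; apply: (NM (y, s)).
Qed.

Lemma cts_open_mapr (T : topologicalType) (p : X -> Y) (f : T * Y -> Z) x t : open_map p ->
  {for (t, x), continuous (fun tx : T * X => f (tx.1, p tx.2))} ->
  {for (t, p x), continuous f}.
Proof.
move=> op h V hV; have [[M N] [/= Mt Nx] MN] := h V hV.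
exists (M, p @` N); first by split=> //=; apply: op.
by move=> [s _] /= [Ms [y Ny <-]]; apply: (MN (s, y)).
Qed.

End GeneralTopology.

(** A quotient by a group of homeomorphisms is an open map. *)
Lemma quotient_open_map (T : topologicalType) (e : equiv_rel T) (I : Type) (g : I -> T -> T) :
  (forall i, continuous (g i)) -> (forall x y, e x y <-> exists i, y = g i x) ->
  open_map (\pi_(quotient_topology {eq_quot e}) : T -> quotient_topology {eq_quot e}).
Proof.
move=> gc ge; apply: open_mapP => A oA.
have -> : open (\pi_(quotient_topology {eq_quot e}) @` A) =
  open (\bigcup_(i in [set: I]) (g i @^-1` A)).
  rewrite {1}/open /= /quotient_open; congr open; apply/seteqP; split=> [x [y Ay /eqmodP]|x [i _ Ax]].
    by rewrite equiv_sym => /ge[i yE]; exists i => //=; rewrite -yE.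
  exists (g i x) => //; apply/eqmodP; rewrite equiv_sym; apply/ge.
  by exists i.
by apply: bigcup_open => i _; apply: open_comp => // x _; apply: gc.
Qed.

Section ContinuousReal.
Variables (R : realType) (Z : topologicalType) (z : Z).
Implicit Types f g : Z -> R.

Lemma cts_cst c : {for z, continuous (fun _ : Z => c : R)}.
Proof. exact: cvg_cst. Qed.

Lemma ctsD f g : {for z, continuous f} -> {for z, continuous g} ->
  {for z, continuous (fun y => f y + g y)}.
Proof. exact: continuousD. Qed.

Lemma ctsM f g : {for z, continuous f} -> {for z, continuous g} ->
  {for z, continuous (fun y => f y * g y)}.
Proof. exact: continuousM. Qed.

Lemma cts_sum I (r : seq I) (p : pred I) (F : I -> Z -> R) :
  (forall i, p i -> {for z, continuous (F i)}) ->
  {for z, continuous (fun y => \sum_(i <- r | p i) F i y)}.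
Proof.
move=> h; elim: r => [|i r IH].
  by under [X in {for z, continuous X}]eq_fun do rewrite big_nil; apply: cts_cst.
under [X in {for z, continuous X}]eq_fun do rewrite big_cons.
by case: ifP => // pi; apply: ctsD => //; apply: h.
Qed.

Lemma cts_prod I (r : seq I) (p : pred I) (F : I -> Z -> R) :
  (forall i, p i -> {for z, continuous (F i)}) ->
  {for z, continuous (fun y => \prod_(i <- r | p i) F i y)}.
Proof.
move=> h; elim: r => [|i r IH].
  by under [X in {for z, continuous X}]eq_fun do rewrite big_nil; apply: cts_cst.
under [X in {for z, continuous X}]eq_fun do rewrite big_cons.
by case: ifP => // pi; apply: ctsM => //; apply: h.
Qed.

Definition coef_cts (G : Z -> mpoly 3 R) :=
  forall m, {for z, continuous (fun y => mcoeff m (G y))}.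

Lemma coef_cts_cst P : coef_cts (fun=> P).
Proof. by move=> m; apply: cts_cst. Qed.

Lemma coef_cts_sum I (r : seq I) (p : pred I) (G : I -> Z -> mpoly 3 R) :
  (forall i, p i -> coef_cts (G i)) -> coef_cts (fun y => \sum_(i <- r | p i) G i y).
Proof.
move=> h m; under [X in {for z, continuous X}]eq_fun do rewrite raddf_sum.
by apply: cts_sum => i pi; apply: h.
Qed.

Lemma coef_ctsZ (c : Z -> R) G : {for z, continuous c} -> coef_cts G ->
  coef_cts (fun y => c y *: G y).
Proof.
move=> hc hG m; under [X in {for z, continuous X}]eq_fun do rewrite mcoeffZ.
exact: ctsM.
Qed.

Lemma coef_ctsM G H : coef_cts G -> coef_cts H -> coef_cts (fun y => G y * H y).
Proof.
move=> hG hH m; under [X in {for z, continuous X}]eq_fun do rewrite mcoeffM.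
by apply: cts_sum => i _; apply: ctsM; [apply: hG|apply: hH].
Qed.

Lemma coef_cts_prod I (r : seq I) (p : pred I) (G : I -> Z -> mpoly 3 R) :
  (forall i, p i -> coef_cts (G i)) -> coef_cts (fun y => \prod_(i <- r | p i) G i y).
Proof.
move=> h; elim: r => [|i r IH].
  have -> : (fun y => \prod_(i <- [::] | p i) G i y) = fun=> 1.
    by apply: funext => y; rewrite big_nil.
  exact: coef_cts_cst.
have [pi|npi] := boolP (p i).
  have -> : (fun y => \prod_(i <- i :: r | p i) G i y) =
            (fun y => G i y * \prod_(i <- r | p i) G i y).
    by apply: funext => y; rewrite big_cons pi.
  exact: coef_ctsM (h i pi) IH.
have -> // : (fun y => \prod_(i <- i :: r | p i) G i y) = (fun y => \prod_(i <- r | p i) G i y).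
by apply: funext => y; rewrite big_cons (negbTE npi).
Qed.

Definition vec_cts (v : Z -> 'rV[R]_3) := forall i, {for z, continuous (fun y => v y 0 i)}.

Lemma coef_cts_linear v : vec_cts v -> coef_cts (fun y => linear_form (v y)).
Proof.
move=> hv; apply: coef_cts_sum => i _; apply: coef_ctsZ; first exact: hv.
exact: coef_cts_cst.
Qed.

Lemma dotv_cts v x : vec_cts v -> {for z, continuous (fun y => dotv (v y) x)}.
Proof. by move=> hv; apply: cts_sum => i _; apply: ctsM; [apply: hv|apply: cts_cst]. Qed.

Lemma cts_vec v : vec_cts v -> {for z, continuous v}.
Proof.
move=> h U [P vP PU].
have : \forall y \near z, forall i, P 0 i (v y 0 i).
  by apply: filter_forall => i; apply: h; apply: vP.
by apply: filterS => y hy; apply: PU => i j; rewrite !ord1.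
Qed.

Lemma vec_ctsP v : {for z, continuous v} -> vec_cts v.
Proof.
move=> h i.
exact: (@continuous_comp _ _ _ v (fun M : 'rV[R]_3 => M 0 i) z h (@coord_continuous _ _ _ 0 i (v z))).
Qed.

End ContinuousReal.

Section FormTopology.
Variables (R : realType) (k : nat).

Definition monomial_form (m : multinom 3) : form R k := insubd 0 (mpolyX R m).

(** Since monomials span the forms, linear maps between spaces of forms are
    continuous for the topology of coefficientwise convergence. *)
Lemma form_monomials (P : form R k) :
  P = \sum_(m : bmultinom 3 k.+1) mcoeff m (P : mpoly 3 R) *: monomial_form m.
Proof.
apply: val_inj; rewrite raddf_sum /= [LHS](mpolywE (k := k.+1)); last first.
  have [->|P0] := eqVneq (P : mpoly 3 R) 0; first by rewrite msize0.
  by rewrite -mlead_deg // ltnS (dhomog_mf (dhomog_is_dhomog P)) ?mlead_supp.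
apply: eq_bigr => m _; rewrite /monomial_form.
have [mk|mk] := eqVneq (mdeg m) k.
  have hX : mpolyX R m \is @ishomog1 3 R k mdeg by rewrite dhomogX; apply/eqP; exact: mk.
  by congr (_ *: _); have /= -> := @insubdK _ _ (form R k) 0 _ hX.
by rewrite (dhomog_nemf_coeff (dhomog_is_dhomog P) mk) !scale0r.
Qed.

Variables (Z : topologicalType) (z : Z).

Lemma cts_form (G : Z -> form R k) :
  coef_cts z (fun y => G y : mpoly 3 R) -> {for z, continuous G}.
Proof.
by move=> h; apply: (@cts_initial _ _ _ (@coefs R k)); apply: cts_ptws => m; apply: h.
Qed.

Lemma form_cts (P : form R k) : coef_cts P (fun S : form R k => S : mpoly 3 R).
Proof.
move=> m.
have h : {for P, continuous (@coefs R k : form R k -> _)} by exact: (@initial_continuous _ _ (@coefs R k)).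
exact: (continuous_comp h (@ptws_cts _ _ m (coefs P))).
Qed.

Lemma coef_cts_lin k' (L : {linear form R k -> form R k'}) (G : Z -> form R k) :
  coef_cts z (fun y => G y : mpoly 3 R) -> coef_cts z (fun y => L (G y) : mpoly 3 R).
Proof.
move=> h; have -> : (fun y => L (G y) : mpoly 3 R) = fun y => \sum_(m : bmultinom 3 k.+1)
    mcoeff m (G y : mpoly 3 R) *: (L (monomial_form m) : mpoly 3 R).
  apply: funext => y; rewrite [in LHS](form_monomials (G y)) linear_sum raddf_sum.
  by apply: eq_bigr => m _; rewrite linearZ.
by apply: coef_cts_sum => m _; apply: coef_ctsZ; [apply: h|apply: coef_cts_cst].
Qed.

End FormTopology.

(** * Multipoles and their symmetric products *)

Section Multipoles.
Variables (R : realType) (k : nat).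
Implicit Types (A : vectors R k) (t : Rstar R).

Lemma nzvec_neq0 (v : nzvec R) : \val v != 0.
Proof. exact: set_mem (valP v). Qed.

Definition vecs A : seq 'rV[R]_3 := [seq \val (A i) | i <- enum 'I_k].

Lemma size_vecs A : size (vecs A) = k.
Proof. by rewrite size_map size_enum_ord. Qed.

Lemma vecs_neq0 A : all (fun v => v != 0) (vecs A).
Proof. by apply/allP => _ /mapP[i _ ->]; apply: nzvec_neq0. Qed.

Lemma prod_formE A : (prod_form A : mpoly 3 R) = \prod_(v <- vecs A) linear_form v.
Proof. by rewrite /vecs big_map big_enum. Qed.

Lemma prod_form_neq0 A : prod_form A != 0.
Proof.
apply/eqP => /(congr1 (fun P : form R k => P : mpoly 3 R)); rewrite prod_formE => /eqP.
exact/negP/prod_linear_form_neq0/vecs_neq0.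
Qed.

Lemma evalp_prod_form A x : evalp (prod_form A) x = \prod_i dotv (\val (A i)) x.
Proof. by rewrite evalp_prod; apply: eq_bigr => i _; rewrite evalp_linear_form. Qed.

Lemma vectors_of_seq vs : size vs = k -> all (fun v => v != 0) vs ->
  exists A, vecs A = vs.
Proof.
move=> svs vs0; have n0 (i : 'I_k) : nth 0 vs i != 0.
  by apply: (allP vs0); apply: mem_nth; rewrite svs.
exists (fun i => mk_nzvec (n0 i)); apply: (@eq_from_nth _ 0); rewrite size_vecs ?svs // => i ik.
by rewrite (nth_map (Ordinal ik)) ?size_enum_ord //= nth_enum_ord.
Qed.

(** The scalar is absorbed into the first vector, so k has to be
    positive. *)
Lemma vectors_of_scaled_seq c vs : (0 < k)%N -> c != 0 -> size vs = k -> all (fun v => v != 0) vs ->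
  exists A, (prod_form A : mpoly 3 R) = c *: \prod_(v <- vs) linear_form v.
Proof.
move=> k0 c0; case: vs => [|v vs] svs; first by rewrite -svs in k0.
move=> /= /andP[v0 vs0].
have [|A AE] := @vectors_of_seq (c *: v :: vs) svs; first by rewrite /= scaler_eq0 negb_or c0 v0.
by exists A; rewrite -[LHS]/(prod_form A : mpoly 3 R) prod_formE AE !big_cons linear_formZ scalerAl.
Qed.

Lemma perm_cano_vecs A A' : perm_eq (map cano (vecs A)) (map cano (vecs A')) ->
  exists s : 'S_k, forall i, exists2 c, c != 0 & \val (A' i) = c *: \val (A (s i)).
Proof.
rewrite perm_sym => p.
pose f (B : vectors R k) : k.-tuple 'rV[R]_3 := [tuple cano (\val (B i)) | i < k].
have fE B : map cano (vecs B) = f B by rewrite /f /= /vecs -map_comp.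
move: p; rewrite !fE => /tuple_permP[s sE]; exists s => i.
have := congr1 (fun x => nth 0 x i) sE; rewrite /= (nth_map i) ?size_enum_ord //.
rewrite (nth_map i) ?size_enum_ord // nth_ord_enum !tnth_mktuple => e.
by apply/cano_eqP; rewrite ?nzvec_neq0.
Qed.

Lemma prod_form_scale A A' (c : 'I_k -> R) (s : 'S_k) :
  (forall i, \val (A' i) = c i *: \val (A (s i))) ->
  prod_form A' = (\prod_i c i) *: prod_form A.
Proof.
move=> e; apply: val_inj => /=; rewrite /prod_linear.
under eq_bigr do rewrite e linear_formZ.
rewrite scaler_prod; congr (_ *: _).
by rewrite [RHS](reindex_inj (@perm_inj _ s)).
Qed.

(** Unique factorization of polynomials. *)
Lemma prod_form_factors A A' c : c != 0 -> c *: prod_form A = prod_form A' ->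
  exists s : 'S_k, forall i, exists2 c, c != 0 & \val (A' i) = c *: \val (A (s i)).
Proof.
move=> c0 /(congr1 (fun P : form R k => P : mpoly 3 R)).
rewrite /= -[prod_linear A]/(prod_form A : mpoly 3 R) -[prod_linear A']/(prod_form A' : mpoly 3 R) !prod_formE => e.
apply: perm_cano_vecs; rewrite perm_sym; apply: (linear_factorization_uniq _ _ _ c0 e) => //.
- exact: vecs_neq0.
- exact: vecs_neq0.
by rewrite !size_vecs.
Qed.

(** Vectors with the same product of linear forms agree up to order and
    scalars, by unique factorization, and the scalars have product 1. *)
Lemma Sigma_equivalentP A A' : Sigma_equivalent A A' <-> prod_form A = prod_form A'.
Proof.
split=> [/asboolP[l [s [pl e]]]|e].
  rewrite (@prod_form_scale A A' (fun i => \val (l i)) s) ?pl ?scale1r // => i.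
  by rewrite e.
have [|s sE] := @prod_form_factors A A' 1 (oner_neq0 _); first by rewrite scale1r.
have [c cE] : exists c : 'I_k -> Rstar R, forall i, \val (A' i) = \val (c i) *: \val (A (s i)).
  have [c cE] := @boolp.choice _ _ (fun i (c : Rstar R) => \val (A' i) = \val c *: \val (A (s i)))
    (fun i => let: ex_intro2 c c0 cE := sE i in ex_intro _ (mk_Rstar c0) cE).
  by exists c.
apply/asboolP; exists c, s; split; last by move=> i; apply: val_inj; rewrite cE.
have := @prod_form_scale A A' _ s cE; rewrite e => /eqP.
rewrite -subr_eq0 -{1}[prod_form A']scale1r -scalerBl scaler_eq0 (negbTE (prod_form_neq0 _)) orbF.
by rewrite subr_eq0 => /eqP.
Qed.

Lemma multipole_eqP A A' : \pi_(multipole R k) A = \pi_(multipole R k) A' <->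
  prod_form A = prod_form A'.
Proof. by split=> [/eqmodP /Sigma_equivalentP|/Sigma_equivalentP h] //; apply/eqmodP. Qed.

Definition param (m : multipole R k) : form R k := prod_form (repr m).

Lemma param_pi A : param (\pi_(multipole R k) A) = prod_form A.
Proof. by apply/multipole_eqP; rewrite reprK. Qed.

Lemma param_inj : injective param.
Proof. by move=> m m' /multipole_eqP; rewrite !reprK. Qed.

Lemma param_neq0 m : param m != 0. Proof. exact: prod_form_neq0. Qed.

Lemma multipoleP (m : multipole R k) : exists A, m = \pi_(multipole R k) A.
Proof. by exists (repr m); rewrite reprK. Qed.

(** The number of factors of a nonzero product is determined by its
    degree. *)
Lemma range_param :
  range param = [set P : form R k | P != 0 /\ completely_factorable P].
Proof.
apply/seteqP; split=> [_ [m _ <-]|P [P0 [s PE]]].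
  split; first exact: param_neq0.
  by exists (vecs (repr m)); apply: prod_formE.
have Pn0 : (P : mpoly 3 R) != 0 by [].
have s0 : all (fun v => v != 0) s.
  move: Pn0; rewrite PE prodf_seq_neq0; apply: sub_all => v.
  by rewrite linear_form_eq0.
have sk : size s = k.
  have hs : (P : mpoly 3 R) \is @ishomog1 3 R (size s) mdeg.
    by rewrite PE; apply: prod_linear_homog_seq.
  exact: (dhomog_uniq Pn0 hs (dhomog_is_dhomog P)).
have [A AE] := vectors_of_seq sk s0.
exists (\pi_(multipole R k) A) => //; rewrite param_pi; apply: val_inj.
by rewrite -[LHS]/(prod_form A : mpoly 3 R) prod_formE AE -PE.
Qed.

(** The image in Sym^k(RP^2) of a multipole remembers its product of linear
    forms up to a scalar. *)
Definition sym_class A : Sym k (RP2 R) := \pi_(Sym k (RP2 R)) (fun i => \pi_(RP2 R) (A i)).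

Lemma RP2_eqP (v w : nzvec R) : \pi_(RP2 R) v = \pi_(RP2 R) w <->
  exists2 c, c != 0 & \val w = c *: \val v.
Proof. by split=> [/eqmodP /asboolP|h] //; apply/eqmodP/asboolP. Qed.

Lemma sym_classP (y : Sym k (RP2 R)) : exists A, y = sym_class A.
Proof.
exists (fun i => repr (repr y i)); rewrite /sym_class -[LHS]reprK; congr (\pi _).
by apply: funext => i; rewrite reprK.
Qed.

Lemma sym_class_eqP A A' : sym_class A = sym_class A' <->
  exists2 c, c != 0 & prod_form A' = c *: prod_form A.
Proof.
split=> [/eqmodP /asboolP[s sE]|[c c0 e]].
  have {}sE i : exists2 c, c != 0 & \val (A' i) = c *: \val (A (s i)).
    by apply/RP2_eqP; rewrite -sE.
  have [c cE] := @boolp.choice _ _ (fun i (c : Rstar R) => \val (A' i) = \val c *: \val (A (s i)))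
    (fun i => let: ex_intro2 c c0 cE := sE i in ex_intro _ (mk_Rstar c0) cE).
  exists (\prod_i \val (c i)); last exact: (@prod_form_scale A A' _ s cE).
  by apply/prodf_neq0 => i _; apply: Rstar_neq0.
have [s sE] := @prod_form_factors A A' c c0 (esym e).
by apply/eqmodP/asboolP; exists s => i; apply/esym/RP2_eqP.
Qed.

Definition proj (m : multipole R k) : Sym k (RP2 R) := sym_class (repr m).

Lemma proj_pi A : proj (\pi_(multipole R k) A) = sym_class A.
Proof.
apply/sym_class_eqP; exists 1; rewrite ?oner_neq0 // scale1r.
by apply/multipole_eqP; rewrite reprK.
Qed.

Lemma proj_eqP m m' : proj m = proj m' <-> exists2 c, c != 0 & param m' = c *: param m.
Proof. exact: sym_class_eqP. Qed.

Lemma prod_form_scale_at i t A : prod_form (scale_at i t A) = \val t *: prod_form A.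
Proof.
have := @prod_form_scale A (scale_at i t A) (fun j => if j == i then \val t else 1) 1%g.
move=> -> => [|j]; last first.
  by rewrite perm1 /scale_at; case: eqP; rewrite ?scale1r.
by congr (_ *: _); rewrite (bigD1 i) //= eqxx big1 ?mulr1 // => j /negbTE ->.
Qed.

Hypothesis k_gt0 : (0 < k)%N.

(** The product of linear forms is multiplied by t whichever vector is
    scaled, so the first one may be taken. *)
Definition act t (m : multipole R k) : multipole R k :=
  \pi_(multipole R k) (scale_at (Ordinal k_gt0) t (repr m)).

Lemma param_act t m : param (act t m) = \val t *: param m.
Proof. by rewrite /act param_pi prod_form_scale_at. Qed.

Lemma act_pi t i A : act t (\pi_(multipole R k) A) = \pi_(multipole R k) (scale_at i t A).
Proof. by apply: param_inj; rewrite param_act !param_pi prod_form_scale_at. Qed.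

Lemma proj_act t m : proj (act t m) = proj m.
Proof. by apply/esym/proj_eqP; exists (\val t); rewrite ?Rstar_neq0 ?param_act. Qed.

Lemma act1 t m : \val t = 1 -> act t m = m.
Proof. by move=> t1; apply: param_inj; rewrite param_act t1 scale1r. Qed.

Lemma actM s t st m : \val st = \val s * \val t -> act st m = act s (act t m).
Proof. by move=> e; apply: param_inj; rewrite !param_act e scalerA. Qed.

End Multipoles.

(** * The maps Phi and Psi *)

Section PhiPsi.
Variables (R : realType) (k : nat) (B : {dot (form R k) for idfun}) (Q : form R 2).
Hypothesis Qirr : irreducible_over_C Q.

Definition perp_proj : 'End(form R k) := daddv_pi (VQperp B Q) (VQ Q k).

Lemma perp_proj_mem P : perp_proj P \in VQperp B Q.
Proof. exact: memv_pi. Qed.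

Lemma perp_proj_sub P : P - perp_proj P \in VQ Q k.
Proof.
have e := @daddv_pi_add _ _ (VQperp B Q) (VQ Q k) P (cap_orthov _ _).
rewrite -[X in X - _]e ?addv_orthov ?memvf // addrAC subrr add0r; exact: memv_pi.
Qed.

Lemma VQperp_eqP P S : P \in VQperp B Q -> S \in VQperp B Q ->
  divides (Q : mpoly 3 R) ((P : mpoly 3 R) - S) -> P = S.
Proof.
move=> hP hS d; apply/eqP; rewrite -subr_eq0 -memv0 -(cap_orthov B (VQ Q k)) memv_cap.
by rewrite memvB //=; apply/VQP; move: d; rewrite -raddfB.
Qed.

Lemma perp_proj_divides (P : form R k) : divides (Q : mpoly 3 R) ((P : mpoly 3 R) - perp_proj P).
Proof. by have /VQP := perp_proj_sub P; rewrite raddfB. Qed.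

(** The complement of V_Q contains exactly one representative of each
    class modulo Q. *)
Lemma perp_projP (P S : form R k) : S \in VQperp B Q ->
  divides (Q : mpoly 3 R) ((P : mpoly 3 R) - S) <-> perp_proj P = S.
Proof.
move=> hS; split=> [d|<-]; last exact: perp_proj_divides.
apply: VQperp_eqP => //; first exact: perp_proj_mem.
have -> : (perp_proj P : mpoly 3 R) - S = ((P : mpoly 3 R) - S) - ((P : mpoly 3 R) - perp_proj P).
  by rewrite opprB [RHS]addrC subrKA.
by apply: dividesB => //; apply: perp_proj_divides.
Qed.

(** An irreducible Q does not divide a product of nonzero linear
    forms. *)
Lemma perp_proj_prod_form_neq0 (A : vectors R k) : perp_proj (prod_form A) != 0.
Proof.
apply/eqP => h; have := perp_proj_divides (prod_form A).
rewrite h subr0 prod_formE -[X in divides _ X]scale1r.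
by move=> /(irr_ndvd_prod Qirr (vecs_neq0 A)) /eqP; rewrite oner_eq0.
Qed.

Lemma Phi_subproof (m : multipole R k) : perp_proj (param m) \in VQperp0 B Q.
Proof. by apply/mem_set; split; [apply: perp_proj_mem|apply: perp_proj_prod_form_neq0]. Qed.

Definition Phi (m : multipole R k) : VQperp0 B Q :=
  exist (fun P => P \in VQperp0 B Q) (perp_proj (param m)) (Phi_subproof m).

Lemma val_Phi m : \val (Phi m) = perp_proj (param m). Proof. by []. Qed.

Lemma VQperp0P (P : VQperp0 B Q) : \val P \in VQperp B Q /\ \val P != 0.
Proof. exact: set_mem (valP P). Qed.

Lemma PhiP m (P : VQperp0 B Q) : Phi m = P <-> divides (Q : mpoly 3 R) ((param m : mpoly 3 R) - \val P).
Proof.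
have [hP _] := VQperp0P P; rewrite (perp_projP _ hP); split=> [<-//|e].
exact: val_inj.
Qed.

Lemma Phi_act k_gt0 t m : \val (Phi (@act R k k_gt0 t m)) = \val t *: \val (Phi m).
Proof. by rewrite !val_Phi param_act linearZ. Qed.

Lemma RP_VQperp_eqP (P S : VQperp0 B Q) : \pi_(RP_VQperp B Q) P = \pi_(RP_VQperp B Q) S <->
  exists2 c, c != 0 & \val S = c *: \val P.
Proof. by split=> [/eqmodP /asboolP|h] //; apply/eqmodP/asboolP. Qed.

(** A representative in each class is chosen; Psi_proj shows independence of
    that choice. *)
Definition Psi (y : Sym k (RP2 R)) : RP_VQperp B Q :=
  \pi_(RP_VQperp B Q) (Phi (\pi_(multipole R k) (fun i => repr (repr y i)))).

Lemma Psi_proj m : Psi (proj m) = \pi_(RP_VQperp B Q) (Phi m).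
Proof.
rewrite /Psi; apply/RP_VQperp_eqP; set m' := \pi _.
have e : proj m' = proj m.
  rewrite proj_pi /sym_class -[RHS]reprK; congr (\pi _); apply: funext => i.
  by rewrite reprK.
have /proj_eqP[c c0 cE] := e.
by exists c => //; rewrite !val_Phi cE linearZ.
Qed.

Lemma dim_VQperp : \dim (VQperp B Q) = (2 * k).+1.
Proof.
have Q0 : Q != 0 := irr_neq0 Qirr.
have := dim_orthov B (VQ Q k); rewrite -(dim_VQ k Q0) addnC => /eqP.
by rewrite eqn_add2l => /eqP.
Qed.

End PhiPsi.

(** * The bundle of multipoles *)

Section MoreTopology.
Variables (X Y Z : topologicalType).

Lemma cts_comp (f : X -> Y) (g : Y -> Z) x : {for x, continuous f} ->
  {for f x, continuous g} -> {for x, continuous (g \o f)}.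
Proof. exact: continuous_comp. Qed.

Lemma cts_near (f g : X -> Y) x : (\forall y \near x, f y = g y) ->
  {for x, continuous g} -> {for x, continuous f}.
Proof.
move=> e h V fV; have gV : nbhs x (g @^-1` V) by apply: h; rewrite -(nbhs_singleton e).
by apply: filterS2 e gV => y /= ->.
Qed.

Lemma open_map_comp (p : X -> Y) (q : Y -> Z) : open_map p -> open_map q -> open_map (q \o p).
Proof. by move=> hp hq x N /hp /hq; rewrite image_comp. Qed.

Lemma open_map_nbhs (p : X -> Y) x (N : set Y) : open_map p -> nbhs x (p @^-1` N) -> nbhs (p x) N.
Proof. by move=> hp /hp; apply: filterS => _ [y Ny <-]. Qed.

Lemma open_nbhs_all (U : set X) : (forall x, U x -> nbhs x U) -> open U.
Proof. by rewrite openE => h x /h. Qed.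

Lemma cts_pair (f : X -> Y) (g : X -> Z) x : {for x, continuous f} -> {for x, continuous g} ->
  {for x, continuous (fun y => (f y, g y))}.
Proof. by move=> hf hg; apply: cvg_pair. Qed.

Lemma nbhs_forall n (x : X) (P : 'I_n -> set X) : (forall i, nbhs x (P i)) ->
  nbhs x [set y | forall i, P i y].
Proof. by move=> h; apply: filter_forall. Qed.

End MoreTopology.

Section MoreTopology2.
Variables (X Y Z : topologicalType).

(** Every neighbourhood of a point of a finite power contains a box. *)
Lemma ptws_open_map n (p : X -> Y) : open_map p ->
  open_map (fun f : {ptws 'I_n -> X} => (fun i => p (f i)) : {ptws 'I_n -> Y}).
Proof.
move=> hp f N fN.
have box : exists2 N' : 'I_n -> set X, (forall i, nbhs (f i) (N' i)) &
    forall g, (forall i, N' i (g i)) -> N g.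
  pose G : set_system {ptws 'I_n -> X} := [set N | exists2 N' : 'I_n -> set X,
    (forall i, nbhs (f i) (N' i)) & forall g, (forall i, N' i (g i)) -> N g].
  have GF : Filter G.
    split.
    - by exists (fun=> setT) => // i; apply: filterT.
    - move=> A C [NA hA AA] [NC hC CC]; exists (fun i => NA i `&` NC i).
        by move=> i; apply: filterI.
      by move=> g hg; split; [apply: AA|apply: CC] => i; case: (hg i).
    - by move=> A C AC [NA hA AA]; exists NA => // g /AA /AC.
  suff : G --> f by apply.
  apply/cvg_sup => i U [W [[V oV VW] Wf] WU].
  exists (fun j => [set x | j = i -> V x]); last first.
    by move=> g /(_ i erefl) gV; apply: WU; rewrite -VW.
  move=> j; have [->|ji] := eqVneq j i.
    have Vf : V (f i) by move: Wf; rewrite -VW.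
    apply: (@filterS _ _ _ V); first by move=> x Vx.
    exact: open_nbhs_nbhs.
  by apply: (@filterS _ _ _ setT); [move=> x _ /eqP; rewrite (negbTE ji)|apply: filterT].
have [N' hN' N'N] := box.
pose pf : {ptws 'I_n -> Y} := fun i => p (f i).
have : nbhs pf [set g : {ptws 'I_n -> Y} | forall i, (p @` N' i) (g i)].
  apply: (@nbhs_forall _ _ _ (fun i => [set g : {ptws 'I_n -> Y} | (p @` N' i) (g i)])) => i.
  exact: (@ptws_cts Y _ i (fun i => p (f i)) _ (hp _ _ (hN' i))).
apply: filterS => g hg.
have [h hE] := @boolp.choice _ _ (fun i x => N' i x /\ p x = g i)
  (fun i => let: ex_intro2 x Nx e := hg i in ex_intro _ x (conj Nx e)).
exists h; first by apply: N'N => i; case: (hE i).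
by apply: funext => i; case: (hE i).
Qed.

End MoreTopology2.

Lemma vec_ctsZ (R : realType) (Z : topologicalType) (z : Z) (c : Z -> R) (v : Z -> 'rV[R]_3) :
  {for z, continuous c} -> vec_cts z v -> {for z, continuous (fun y => c y *: v y)}.
Proof.
move=> hc hv; apply: cts_vec => i.
by under [X in {for z, continuous X}]eq_fun do rewrite mxE; apply: ctsM.
Qed.

Section Totals.
Variable R : realType.

Definition to_Rstar (r : R) : Rstar R := insubd (mk_Rstar (oner_neq0 R)) r.

Lemma to_RstarK r : r != 0 -> \val (to_Rstar r) = r.
Proof. by move=> r0; rewrite insubdK //; apply/mem_set. Qed.

Lemma const1_neq0 : (const_mx 1 : 'rV[R]_3) != 0.
Proof. by apply/eqP => /rowP/(_ 0); rewrite !mxE => /eqP; rewrite oner_eq0. Qed.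

(** Totalized with an arbitrary default value, for use on sets where the
    vector is known not to vanish. *)
Definition to_nzvec (v : 'rV[R]_3) : nzvec R := insubd (mk_nzvec const1_neq0) v.

Lemma to_nzvecK v : v != 0 -> \val (to_nzvec v) = v.
Proof. by move=> v0; rewrite insubdK //; apply/mem_set. Qed.

End Totals.

Section BundleTopology.
Variables (R : realType) (k : nat).
Implicit Types (A : vectors R k).
Local Notation mpi := (\pi_(multipole R k) : vectors R k -> multipole R k).

Lemma vec_cts_entry A i : vec_cts A (fun A' : vectors R k => \val (A' i)).
Proof.
apply: vec_ctsP; apply: (@cts_comp _ _ _ (fun A' : vectors R k => A' i) (fun v : nzvec R => \val v)).
  exact: ptws_cts.
exact: set_val_cts.
Qed.

Lemma coef_cts_prod_form A : coef_cts A (fun A' => prod_form A' : mpoly 3 R).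
Proof. by apply: coef_cts_prod => i _; apply: coef_cts_linear; apply: vec_cts_entry. Qed.

Lemma multipole_open_map : open_map mpi.
Proof.
pose g (p : {p : ('I_k -> Rstar R) * 'S_k | \prod_i \val (p.1 i) = 1}) (A : vectors R k) : vectors R k :=
  fun i => nzscale ((proj1_sig p).1 i) (A ((proj1_sig p).2 i)).
apply: (@quotient_open_map _ (Sigma_equiv R k) _ g).
  move=> [[l s] e] A; apply: cts_ptws => i; apply: cts_set_type => /=.
  by apply: vec_ctsZ; [apply: cts_cst|apply: vec_cts_entry].
move=> A A'; split=> [/asboolP[l [s [e AE]]]|[[[l s] e] AE]].
  by exists (exist _ (l, s) e); apply: funext.
by apply/asboolP; exists l, s; split=> // i; rewrite AE.
Qed.

Lemma RP2_open_map : open_map (\pi_(RP2 R) : nzvec R -> RP2 R).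
Proof.
apply: (@quotient_open_map _ (proportional_equiv (fun v : nzvec R => \val v)) _ (@nzscale R)).
  move=> t v; apply: cts_set_type => /=.
  by apply: vec_ctsZ; [apply: cts_cst|apply: vec_ctsP; apply: set_val_cts].
move=> v w; split=> [/asboolP[t t0 e]|[t ->]].
  by exists (mk_Rstar t0); apply: val_inj.
by apply/asboolP; exists (\val t); rewrite ?Rstar_neq0.
Qed.

Lemma Sym_open_map (X : topologicalType) : open_map (\pi_(Sym k X) : {ptws 'I_k -> X} -> Sym k X).
Proof.
apply: (@quotient_open_map _ (permuted_equiv k X) _ (fun (s : 'S_k) f i => f (s i))).
  by move=> s f; apply: cts_ptws => i; apply: ptws_cts.
move=> f g; split=> [/asboolP[s e]|[s e]]; first by exists s; apply: funext.
by apply/asboolP; exists s => i; rewrite e.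
Qed.

Lemma sym_class_open_map : open_map (@sym_class R k).
Proof. exact: (@open_map_comp _ _ _ (fun A : vectors R k => (fun i => \pi_(RP2 R) (A i)) : {ptws 'I_k -> RP2 R})
  \pi_(Sym k (RP2 R)) (ptws_open_map RP2_open_map) (@Sym_open_map _)). Qed.

Lemma mpi_cts A : {for A, continuous mpi}.
Proof. exact: pi_continuous. Qed.

Lemma sym_class_cts A : {for A, continuous (@sym_class R k)}.
Proof.
apply: (@cts_comp _ _ _ (fun A : vectors R k => (fun i => \pi_(RP2 R) (A i)) : {ptws 'I_k -> RP2 R}) \pi_(Sym k (RP2 R))).
  apply: cts_ptws => i.
  apply: (@cts_comp _ _ _ (fun A' : vectors R k => A' i) \pi_(RP2 R)); first exact: ptws_cts.
  exact: pi_continuous.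
exact: pi_continuous.
Qed.

Lemma proj_cts m : {for m, continuous (@proj R k)}.
Proof.
have [A ->] := multipoleP m; apply: (cts_open_map multipole_open_map).
have -> : @proj R k \o mpi = @sym_class R k by apply: funext => A'; apply: proj_pi.
exact: sym_class_cts.
Qed.

Variable k_gt0 : (0 < k)%N.

Lemma act_cts (tm : Rstar R * multipole R k) :
  {for tm, continuous (fun tm => act k_gt0 tm.1 tm.2)}.
Proof.
case: tm => t m; have [A ->] := multipoleP m.
apply: (cts_open_mapr multipole_open_map).
have -> : (fun tA : Rstar R * vectors R k => act k_gt0 (tA.1, mpi tA.2).1 (tA.1, mpi tA.2).2) =
   mpi \o (fun tA => scale_at (Ordinal k_gt0) tA.1 tA.2).
  by apply: funext => tA; rewrite (act_pi _ _ (Ordinal k_gt0)).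
apply: cts_comp; last exact: mpi_cts.
have v2 i : vec_cts (t, A) (fun tA : Rstar R * vectors R k => \val (tA.2 i)).
  move=> j; apply: (@cts_comp _ _ _ snd (fun A' : vectors R k => (\val (A' i)) 0 j)); first exact: cvg_snd.
  exact: vec_cts_entry.
apply: cts_ptws => i; apply: cts_set_type; rewrite /scale_at; case: (i == Ordinal k_gt0) => /=; last by apply: cts_vec; exact: v2.
apply: vec_ctsZ; last exact: v2.
apply: (@cts_comp _ _ _ fst (fun t : Rstar R => \val t)); first exact: cvg_fst.
exact: set_val_cts.
Qed.

(** Over the set of classes no member of which vanishes at x, scaling every
    form to take the value 1 at x is a section. *)
Section Trivialization.
Variable x : 'rV[R]_3.

Definition sym_lift (y : Sym k (RP2 R)) : vectors R k := fun i => repr (repr y i).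

Lemma sym_liftK y : sym_class (sym_lift y) = y.
Proof.
by rewrite /sym_class -[RHS]reprK; congr (\pi _); apply: funext => i; rewrite reprK.
Qed.

Definition nonvanishing (y : Sym k (RP2 R)) := evalp (prod_form (sym_lift y)) x != 0.

Definition normalize A : vectors R k :=
  fun i => to_nzvec ((dotv (\val (A i)) x)^-1 *: \val (A i)).

Lemma dotv_prod_form_neq0 A i : evalp (prod_form A) x != 0 -> dotv (\val (A i)) x != 0.
Proof. by rewrite evalp_prod_form => /prodf_neq0; apply. Qed.

Lemma val_normalize A i : evalp (prod_form A) x != 0 ->
  \val (normalize A i) = (dotv (\val (A i)) x)^-1 *: \val (A i).
Proof.
move=> h; apply: to_nzvecK; rewrite scaler_eq0 invr_eq0 negb_or nzvec_neq0 andbT.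
exact: dotv_prod_form_neq0.
Qed.

Lemma prod_form_normalize A : evalp (prod_form A) x != 0 ->
  prod_form (normalize A) = (evalp (prod_form A) x)^-1 *: prod_form A.
Proof.
move=> h; rewrite (@prod_form_scale _ _ A _ (fun i => (dotv (\val (A i)) x)^-1) 1%g).
  by rewrite evalp_prod_form prodfV.
by move=> i; rewrite perm1 val_normalize.
Qed.

Lemma nonvanishing_class A : nonvanishing (sym_class A) = (evalp (prod_form A) x != 0).
Proof.
have [c c0 e] : exists2 c, c != 0 & prod_form A = c *: prod_form (sym_lift (sym_class A)).
  by apply/sym_class_eqP; rewrite sym_liftK.
by rewrite /nonvanishing e /= -[RHS]/(evalp (c *: _) x != 0) evalpZ mulf_eq0 (negbTE c0).
Qed.

Lemma evalp_prod_form_cts A : {for A, continuous (fun A' => evalp (prod_form A') x)}.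
Proof.
have -> : (fun A' : vectors R k => evalp (prod_form A') x) =
  fun A' => \prod_i dotv (\val (A' i)) x by apply: funext => A'; apply: evalp_prod_form.
by apply: cts_prod => i _; apply: dotv_cts; apply: vec_cts_entry.
Qed.

Lemma near_evalp_prod_form A : evalp (prod_form A) x != 0 ->
  \forall A' \near A, evalp (prod_form A') x != 0.
Proof.
move=> h; have hn : nbhs (evalp (prod_form A) x) [set r : R | r != 0].
  by apply: open_nbhs_nbhs; split=> //; exact: open_neq.
exact: (@evalp_prod_form_cts A _ hn).
Qed.

Lemma nonvanishing_open : open [set y | nonvanishing y].
Proof.
apply: open_nbhs_all => y; rewrite -(sym_liftK y) /= nonvanishing_class => h.
apply: open_map_nbhs; first exact: sym_class_open_map.
by apply: filterS (near_evalp_prod_form h) => A /=; rewrite nonvanishing_class.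
Qed.

Definition fiber_coord (m : multipole R k) : Rstar R := to_Rstar (evalp (param m) x).

Definition trivial_section (yt : Sym k (RP2 R) * Rstar R) : multipole R k :=
  act k_gt0 yt.2 (mpi (normalize (sym_lift yt.1))).

Lemma nonvanishing_proj m : nonvanishing (proj m) = (evalp (param m) x != 0).
Proof. exact: nonvanishing_class. Qed.

Lemma trivial_section_class A t : evalp (prod_form A) x != 0 ->
  trivial_section (sym_class A, t) = act k_gt0 t (mpi (normalize A)).
Proof.
move=> h; have [c c0 e] : exists2 c, c != 0 & prod_form A = c *: prod_form (sym_lift (sym_class A)).
  by apply/sym_class_eqP; rewrite sym_liftK.
have h' : evalp (prod_form (sym_lift (sym_class A))) x != 0 by have := nonvanishing_class A; rewrite h.
apply: param_inj; rewrite !param_act !param_pi /= !prod_form_normalize // e.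
rewrite /= -[evalp (c *: _) x]/(evalp (c *: (prod_form _ : mpoly 3 R)) x) evalpZ !scalerA invfM.
by congr (_ *: _); rewrite [c^-1 / _]mulrC mulrA divfK.
Qed.

Lemma trivial_section_param y t : nonvanishing y ->
  param (trivial_section (y, t)) = (\val t / evalp (prod_form (sym_lift y)) x) *: prod_form (sym_lift y).
Proof. by move=> h; rewrite param_act param_pi prod_form_normalize // scalerA. Qed.

Lemma trivial_section_proj y t : nonvanishing y -> proj (trivial_section (y, t)) = y.
Proof.
move=> h; rewrite -[RHS]sym_liftK; apply/esym/sym_class_eqP.
exists (\val t / evalp (prod_form (sym_lift y)) x).
  by rewrite mulf_neq0 ?Rstar_neq0 ?invr_eq0.
exact: trivial_section_param.
Qed.

Lemma fiber_coord_trivial_section y t : nonvanishing y -> fiber_coord (trivial_section (y, t)) = t.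
Proof.
move=> h; apply: val_inj; rewrite /fiber_coord trivial_section_param //.
rewrite /= -[evalp _ x]/(evalp (_ *: (prod_form _ : mpoly 3 R)) x) evalpZ divfK //.
by rewrite to_RstarK ?Rstar_neq0.
Qed.

Lemma fiber_coordK m : nonvanishing (proj m) -> trivial_section (proj m, fiber_coord m) = m.
Proof.
rewrite nonvanishing_proj => h; have [A mE] := multipoleP m; rewrite mE proj_pi.
have h' : evalp (prod_form A) x != 0 by move: h; rewrite mE param_pi.
rewrite trivial_section_class //; apply: param_inj; rewrite param_act !param_pi.
by rewrite prod_form_normalize // /fiber_coord to_RstarK param_pi // scalerA mulfV ?scale1r.
Qed.

Lemma fiber_coord_act t m : nonvanishing (proj m) ->
  \val (fiber_coord (act k_gt0 t m)) = \val t * \val (fiber_coord m).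
Proof.
rewrite nonvanishing_proj => h; rewrite /fiber_coord param_act.
have e : evalp (\val t *: param m) x = \val t * evalp (param m) x.
  by rewrite -evalpZ.
by rewrite e !to_RstarK // mulf_neq0 ?Rstar_neq0.
Qed.

Lemma fiber_coord_cts m : nonvanishing (proj m) -> {for m, continuous fiber_coord}.
Proof.
rewrite nonvanishing_proj; have [A ->] := multipoleP m; rewrite param_pi => h.
apply: (cts_open_map multipole_open_map); apply: cts_set_type.
apply: (@cts_near _ _ _ (fun A' => evalp (prod_form A') x)); last exact: evalp_prod_form_cts.
by apply: filterS (near_evalp_prod_form h) => A' h'; rewrite /= /fiber_coord param_pi to_RstarK.
Qed.

Lemma normalize_cts A : evalp (prod_form A) x != 0 -> {for A, continuous normalize}.
Proof.
move=> h; apply: cts_ptws => i; apply: cts_set_type.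
apply: (@cts_near _ _ _ (fun A' : vectors R k => (dotv (\val (A' i)) x)^-1 *: \val (A' i))).
  by apply: filterS (near_evalp_prod_form h) => A' h'; rewrite val_normalize.
apply: vec_ctsZ; last exact: vec_cts_entry.
apply: continuousV; first exact: dotv_prod_form_neq0.
by apply: dotv_cts; apply: vec_cts_entry.
Qed.

Lemma trivial_section_cts y t : nonvanishing y -> {for (y, t), continuous trivial_section}.
Proof.
rewrite -(sym_liftK y) nonvanishing_class; move: (sym_lift y) => A h.
apply: (cts_open_mapl sym_class_open_map).
apply: (@cts_near _ _ _ (fun At : vectors R k * Rstar R => act k_gt0 At.2 (mpi (normalize At.1)))).
  have h1 : \forall At \near (A, t), evalp (prod_form At.1) x != 0.
    exact: (@cvg_fst _ _ (nbhs A) (nbhs t) _ _ (near_evalp_prod_form h)).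
  by apply: filterS h1 => At hAt; rewrite /= trivial_section_class.
apply: (@cts_comp _ _ _ (fun At : vectors R k * Rstar R => (At.2, mpi (normalize At.1))) (fun tm => act k_gt0 tm.1 tm.2)); last exact: act_cts.
apply: cts_pair; first exact: cvg_snd.
apply: (@cts_comp _ _ _ fst (mpi \o normalize)); first exact: cvg_fst.
by apply: cts_comp; [apply: normalize_cts|apply: mpi_cts].
Qed.

End Trivialization.

(** Every product of nonzero linear forms is nonzero at some point, so the
    trivializing open sets cover the base. *)
Theorem multipole_bundle : principal_Rstar_bundle (act k_gt0) (@proj R k).
Proof.
split.
- exact: act1.
- exact: actM.
- exact: act_cts.
- exact: proj_cts.
- split=> [t m|y]; first exact: proj_act.
  have [x h] : exists x, evalp (prod_form (sym_lift y)) x != 0.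
    apply: contrapT => h; have := prod_form_neq0 (sym_lift y).
    suff -> : prod_form (sym_lift y) = 0 by rewrite eqxx.
    apply: val_inj; apply: evalp_eq0 => x; apply/eqP; apply: contrapT => /negP hx.
    by apply: h; exists x.
  exists [set y | nonvanishing x y]; split; first by split; [apply: nonvanishing_open|].
  exists (fiber_coord x), (trivial_section x); split.
  + by apply: continuous_in_subspaceT => m /set_mem; apply: fiber_coord_cts.
  + apply: continuous_in_subspaceT => -[z t] /set_mem[/= hz _].
    exact: trivial_section_cts.
  + by move=> m; apply: fiber_coordK.
  + by move=> z t hz; rewrite trivial_section_proj ?fiber_coord_trivial_section.
  + by move=> t m; apply: fiber_coord_act.
Qed.

Variables (B : {dot (form R k) for idfun}) (Q : form R 2).
Hypothesis Qirr : irreducible_over_C Q.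

Lemma Phi_cts m : {for m, continuous (@Phi R k B Q Qirr)}.
Proof.
have [A ->] := multipoleP m; apply: (cts_open_map multipole_open_map).
apply: cts_set_type; apply: cts_form => /=.
have -> : (fun A' => perp_proj B Q (param (mpi A')) : mpoly 3 R) =
  (fun A' => perp_proj B Q (prod_form A') : mpoly 3 R).
  by apply: funext => A'; rewrite param_pi.
by apply: coef_cts_lin; apply: coef_cts_prod_form.
Qed.

Lemma Psi_cts y : {for y, continuous (@Psi R k B Q Qirr)}.
Proof.
rewrite -(sym_liftK y); move: (sym_lift y) => A.
apply: (@cts_open_map _ _ _ (@sym_class R k) (@Psi R k B Q Qirr) A sym_class_open_map).
have -> : @Psi R k B Q Qirr \o @sym_class R k =
   \pi_(RP_VQperp B Q) \o (@Phi R k B Q Qirr \o mpi).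
  by apply: funext => A'; rewrite /= -proj_pi Psi_proj.
apply: cts_comp; last exact: pi_continuous.
by apply: cts_comp; [apply: mpi_cts|apply: Phi_cts].
Qed.

End BundleTopology.

(** * Compactness and separation *)

(** Small neighbourhoods of a value of a map from a compact space to a Hausdorff
    one have preimages close to the fiber. *)
Lemma closed_map_fiber (X Y : topologicalType) (f : X -> Y) (y : Y) (V : set X) :
  compact [set: X] -> hausdorff_space Y -> (forall x, {for x, continuous f}) ->
  open V -> (forall x, f x = y -> V x) ->
  exists U, open_nbhs y U /\ forall x, U (f x) -> V x.
Proof.
move=> cX hY fc oV fV; exists (~` (f @` (~` V))); split; last first.
  by move=> x /= h; apply: contrapT => nV; apply: h; exists x.
split; last by move=> [x nV /fV].
apply: closed_openC; apply: (compact_closed hY); apply: continuous_compact.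
  by apply: continuous_in_subspaceT => x _; apply: fc.
by apply: (subclosed_compact _ cX) => //; apply: open_closedC.
Qed.

(** Real numbers are separated by disjoint open sets. *)
Lemma separated_hausdorff (R : realType) (X : topologicalType) :
  (forall p q : X, p != q -> exists2 f : X -> R, (forall x, {for x, continuous f}) & f p != f q) ->
  hausdorff_space X.
Proof.
move=> h p q pq; apply/eqP; apply: contraT => /h[f fc /eqP fpq]; exfalso; apply: fpq.
apply: (@norm_hausdorff R R^o) => A C pA qC.
have [x [xA xC]] := pq _ _ (fc p A pA) (fc q C qC).
by exists (f x).
Qed.

Lemma ctsB (R : realType) (Z : topologicalType) (z : Z) (f g : Z -> R) :
  {for z, continuous f} -> {for z, continuous g} -> {for z, continuous (fun y => f y - g y)}.
Proof. exact: continuousB. Qed.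

Lemma cts_sqr (R : realType) (Z : topologicalType) (z : Z) (f : Z -> R) :
  {for z, continuous f} -> {for z, continuous (fun y => f y ^+ 2)}.
Proof. by move=> h; apply: ctsM. Qed.

Lemma near_neq0 (R : realType) (Z : topologicalType) (z : Z) (f : Z -> R) :
  {for z, continuous f} -> f z != 0 -> \forall y \near z, f y != 0.
Proof.
move=> h fz; have hn : nbhs (f z) [set r : R | r != 0].
  by apply: open_nbhs_nbhs; split=> //; exact: open_neq.
exact: (h _ hn).
Qed.

Lemma near_gt0 (R : realType) (Z : topologicalType) (z : Z) (f : Z -> R) :
  {for z, continuous f} -> 0 < f z -> \forall y \near z, 0 < f y.
Proof.
move=> h fz; have hn : nbhs (f z) [set r : R | 0 < r].
  by apply: open_nbhs_nbhs; split=> //; exact: open_gt.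
exact: (h _ hn).
Qed.

Section Compactness.
Variables (R : realType) (k : nat).

(** The image of the unit sphere. *)
Lemma RP2_compact : compact [set: RP2 R].
Proof.
pose S := [set v : 'rV[R]_3 | dotv v v = 1].
have idc (v : 'rV[R]_3) : vec_cts v (fun w => w) by apply: vec_ctsP.
have dvc (v : 'rV[R]_3) : {for v, continuous (fun w => dotv w w)}.
  by apply: cts_sum => i _; apply: ctsM; apply: idc.
have Scl : closed S.
  have -> : S = (fun w => dotv w w) @^-1` [set 1] by [].
  apply: closed_comp; first by move=> v _; apply: dvc.
  exact: closed_eq.
have Sb : bounded_set S.
  exists 1; split; first exact: num_real.
  move=> M M1 v /= vS; apply: (le_trans _ (ltW M1)).
  have [v0|/mx_norm_neq0[[i j] /=]] := eqVneq (mx_norm v) 0.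
    by rewrite -[`|v|]/(mx_norm v) v0.
  rewrite ord1 -[`|v|]/(mx_norm v) => ->.
  rewrite -(@ler_pXn2r _ 2) ?nnegrE // expr1n real_normK ?num_real // -vS.
  rewrite /dotv (bigD1 j) //= -expr2 lerDl; apply: sumr_ge0 => l _.
  by rewrite -expr2 sqr_ge0.
have cS : compact S by apply: bounded_closed_compact.
have -> : [set: RP2 R] = (\pi_(RP2 R) \o @to_nzvec R) @` S.
  apply/seteqP; split=> // y _; have yE := reprK y; set v := repr y in yE.
  have d0 := dotv_self_gt0 (nzvec_neq0 v).
  pose c := (Num.sqrt (dotv (\val v) (\val v)))^-1.
  have c0 : c != 0 by rewrite invr_eq0 sqrtr_eq0 -ltNge.
  exists (c *: \val v).
    rewrite /S /= dotvZl dotvZr mulrA -expr2 exprVn sqr_sqrtr ?ltW // mulVf //.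
    exact: lt0r_neq0.
  rewrite -yE; apply/RP2_eqP; exists c^-1; first by rewrite invr_eq0.
  by rewrite to_nzvecK ?scalerA ?mulVf ?scale1r // scaler_eq0 negb_or c0 nzvec_neq0.
apply: continuous_compact => //; apply: continuous_in_subspaceT => v /set_mem vS.
have v0 : v != 0 by apply/eqP => v0; move: vS => /=; rewrite /S v0 /= dotv0r => /esym/eqP; rewrite oner_eq0.
apply: cts_comp; last exact: pi_continuous.
apply: cts_set_type; apply: (@cts_near _ _ _ id); last exact: cvg_id.
have : \forall w \near v, w != 0.
  apply: filterS (near_neq0 (dvc v) _); last by rewrite vS oner_eq0.
  by move=> w; apply: contraNneq => ->; rewrite dotv0r.
by apply: filterS => w w0; rewrite to_nzvecK.
Qed.

(** A continuous image of the compact space (RP^2)^k. *)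
Lemma Sym_compact : compact [set: Sym k (RP2 R)].
Proof.
have -> : [set: Sym k (RP2 R)] = (\pi_(Sym k (RP2 R)) : {ptws 'I_k -> RP2 R} -> _) @` setT.
  by apply/seteqP; split=> // y _; exists (repr y) => //; apply: reprK.
apply: continuous_compact.
  by apply: continuous_in_subspaceT => f _; apply: pi_continuous.
have := @tychonoff 'I_k (fun=> RP2 R) (fun=> setT) (fun=> RP2_compact).
congr compact; apply/seteqP; split=> // f _.
Qed.

Variables (B : {dot (form R k) for idfun}) (Q : form R 2).

Lemma perp_open_map : open_map (\pi_(RP_VQperp B Q) : VQperp0 B Q -> RP_VQperp B Q).
Proof.
have sc (t : Rstar R) (P : VQperp0 B Q) : \val t *: \val P \in VQperp0 B Q.
  have [hP P0] := VQperp0P P; apply/mem_set; split; first exact: memvZ.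
  by rewrite scaler_eq0 negb_or Rstar_neq0.
pose g t P : VQperp0 B Q := exist (fun P => P \in VQperp0 B Q) _ (sc t P).
apply: (@quotient_open_map _ (proportional_equiv (fun P : VQperp0 B Q => \val P)) _ g).
  move=> t P; apply: cts_set_type => /=; apply: cts_form => /=; apply: coef_ctsZ; first exact: cts_cst.
  move=> m; apply: (@cts_comp _ _ _ (fun P : VQperp0 B Q => \val P) (fun S : form R k => mcoeff m (S : mpoly 3 R))).
    exact: set_val_cts.
  exact: form_cts.
move=> P S; split=> [/asboolP[t t0 e]|[t ->]].
  by exists (mk_Rstar t0); apply: val_inj.
by apply/asboolP; exists (\val t); rewrite ?Rstar_neq0.
Qed.

Lemma val_perp_cts (P : VQperp0 B Q) : coef_cts P (fun S : VQperp0 B Q => (\val S : form R k) : mpoly 3 R).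
Proof.
move=> m; apply: (@cts_comp _ _ _ (fun P : VQperp0 B Q => \val P) (fun S : form R k => mcoeff m (S : mpoly 3 R))).
  exact: set_val_cts.
exact: form_cts.
Qed.

Definition coef_vec (P : form R k) (m : bmultinom 3 k.+1) : R := mcoeff m (P : mpoly 3 R).

Lemma coef_vec_neq0 (P : form R k) : P != 0 -> exists m, coef_vec P m != 0.
Proof.
move=> P0; apply: contrapT => h; move: P0; rewrite (form_monomials P) big1 ?eqxx // => m _.
have [e|e] := eqVneq (coef_vec P m) 0; last by exfalso; apply: h; exists m.
by rewrite -/(coef_vec P m) e scale0r.
Qed.

(** The squared 2 x 2 minors of two forms, normalised so as to depend on the
    second one only up to proportionality. *)
Definition wedge (P S : form R k) : R :=
  (\sum_m \sum_m' (coef_vec P m * coef_vec S m' - coef_vec P m' * coef_vec S m) ^+ 2) /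
  (\sum_m coef_vec S m ^+ 2).

Lemma sum_coef_gt0 (P : form R k) : P != 0 -> 0 < \sum_m coef_vec P m ^+ 2.
Proof.
move=> /coef_vec_neq0[m m0]; rewrite (bigD1 m) //= ltr_pwDl //.
  by rewrite exprn_even_gt0.
by apply: sumr_ge0 => i _; apply: sqr_ge0.
Qed.

Lemma wedgeZ P S c : c != 0 -> wedge P (c *: S) = wedge P S.
Proof.
move=> c0; have cE m : coef_vec (c *: S) m = c * coef_vec S m by rewrite /coef_vec /= mcoeffZ.
rewrite /wedge; have -> : \sum_m coef_vec (c *: S) m ^+ 2 = c ^+ 2 * \sum_m coef_vec S m ^+ 2.
  by rewrite mulr_sumr; apply: eq_bigr => m _; rewrite cE exprMn.
have -> : \sum_m \sum_m' (coef_vec P m * coef_vec (c *: S) m' - coef_vec P m' * coef_vec (c *: S) m) ^+ 2 =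
   c ^+ 2 * \sum_m \sum_m' (coef_vec P m * coef_vec S m' - coef_vec P m' * coef_vec S m) ^+ 2.
  rewrite mulr_sumr; apply: eq_bigr => m _; rewrite mulr_sumr; apply: eq_bigr => m' _.
  by rewrite !cE; ring.
by rewrite -mulf_div divff ?mul1r // expf_neq0.
Qed.

Lemma wedge_self P : wedge P P = 0.
Proof.
rewrite /wedge big1 ?mul0r // => m _; rewrite big1 // => m' _.
by rewrite mulrC subrr expr0n.
Qed.

Lemma wedge_eq0 P S : P != 0 -> S != 0 -> wedge P S = 0 -> exists2 c, c != 0 & S = c *: P.
Proof.
move=> P0 S0 /eqP; rewrite mulf_eq0 invr_eq0 (gt_eqF (sum_coef_gt0 S0)) orbF.
rewrite psumr_eq0; last by move=> m _; apply: sumr_ge0 => m' _; apply: sqr_ge0.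
move=> /allP h; have [m m0] := coef_vec_neq0 P0.
have {}h m' : coef_vec S m' = coef_vec S m / coef_vec P m * coef_vec P m'.
  have := h m (mem_index_enum _); rewrite /= psumr_eq0; last by move=> i _; apply: sqr_ge0.
  move=> /allP/(_ m' (mem_index_enum _)) /=; rewrite sqrf_eq0 subr_eq0 => /eqP e.
  by apply: (mulfI m0); rewrite e; field.
have SE : S = (coef_vec S m / coef_vec P m) *: P.
  move: h; set a := _ / _ => h.
  rewrite [LHS]form_monomials [in RHS](form_monomials P) scaler_sumr; apply: eq_bigr => m' _.
  by rewrite scalerA -[mcoeff m' S]/(coef_vec S m') h.
exists (coef_vec S m / coef_vec P m) => //; apply: contraNneq S0 => c0.
by rewrite SE c0 scale0r.
Qed.

(** The wedge with P is a continuous function on the projective space that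
    vanishes at the class of P only. *)
Lemma RP_VQperp_hausdorff : hausdorff_space (RP_VQperp B Q).
Proof.
apply: (@separated_hausdorff R) => p q; rewrite -[p]reprK -[q]reprK.
set P := repr p; move: (repr q) => S pS.
have [_ P0] := VQperp0P P.
pose f (y : RP_VQperp B Q) := wedge (\val P) (\val (repr y)).
have fE S' : f (\pi_(RP_VQperp B Q) S') = wedge (\val P) (\val S').
  have [c c0 e] : exists2 c, c != 0 & \val (repr (\pi_(RP_VQperp B Q) S')) = c *: \val S'.
    by apply/RP_VQperp_eqP; rewrite reprK.
  by rewrite /f e wedgeZ.
exists f; last first.
  rewrite !fE wedge_self eq_sym; apply/eqP => e0.
  have [_ S0] := VQperp0P S; have [c c0 cE] := wedge_eq0 P0 S0 e0.
  by move/eqP: pS; apply; apply/RP_VQperp_eqP; exists c.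
move=> y; rewrite -[y]reprK; move: (repr y) => S'; apply: (cts_open_map perp_open_map).
have -> : f \o \pi_(RP_VQperp B Q) = fun S' => wedge (\val P) (\val S') by apply: funext => T; apply: fE.
have cv m : {for S', continuous (fun T : VQperp0 B Q => coef_vec (\val T) m)} by apply: val_perp_cts.
apply: ctsM.
  apply: cts_sum => m _; apply: cts_sum => m' _.
  by apply: cts_sqr; apply: ctsB; apply: ctsM; [apply: cts_cst|apply: cv|apply: cts_cst|apply: cv].
have [_ S'0] := VQperp0P S'.
apply: continuousV; first by rewrite gt_eqF ?sum_coef_gt0.
by apply: cts_sum => m _; apply: cts_sqr; apply: cv.
Qed.

End Compactness.

Section HasCardBij.
Variables (T T' : eqType) (f : T -> T') (S : set T) (S' : set T').

Lemma has_card_bij n : (forall x, S x -> S' (f x)) ->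
  (forall x y, S x -> S y -> f x = f y -> x = y) ->
  (forall y, S' y -> exists2 x, S x & f x = y) ->
  has_card n S <-> has_card n S'.
Proof.
move=> fS fi fs; split=> [[s [us <- hs]]|[s [us <- hs]]].
  exists (map f s); split; rewrite ?size_map //.
    by rewrite map_inj_in_uniq // => x y /hs Sx /hs Sy; apply: fi.
  move=> y; split=> [/fs[x /hs xs <-]|/mapP[x /hs Sx ->]]; first exact: map_f.
  exact: fS.
have [t tE tS] : exists2 t, map f t = s & forall x, x \in t -> S x.
  have : forall y, y \in s -> S' y by move=> y /hs.
  elim: s {us hs} => [|y s IH] h; first by exists [::].
  have [t <- tS] := IH (fun z zs => h z (@mem_behead _ (y :: s) z zs)).
  have [x Sx <-] := fs y (h y (mem_head y s)); exists (x :: t) => // z.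
  by rewrite inE => /orP[/eqP ->|/tS].
exists t; split; first by apply: (@map_uniq _ _ f); rewrite tE.
  by rewrite -tE size_map.
move=> x; split=> [Sx|/tS //]; have : f x \in map f t by rewrite tE; apply/hs/fS.
by move=> /mapP[x' /[dup] x't /tS Sx' /(fi _ _ Sx Sx') ->].
Qed.

End HasCardBij.

Lemma has_card_I (T : eqType) (S : set T) n : has_card n S -> (S #= `I_n)%card.
Proof.
move=> [[|x0 s] [us <- hs]].
  by rewrite II0 card_eq0; apply/eqP; rewrite -subset0 => x /hs.
have -> : S = nth x0 (x0 :: s) @` `I_(size (x0 :: s)).
  apply/seteqP; split=> [x /hs xs|_ [i /= ik <-]]; last by apply/hs/mem_nth.
  by exists (index x (x0 :: s)); rewrite ?nth_index // /mkset index_mem.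
apply: inj_card_eq => i j /set_mem /= ik /set_mem /= jk /eqP.
by rewrite nth_uniq // => /eqP.
Qed.

Lemma has_card_eq (T T' : eqType) (S : set T) (S' : set T') n :
  has_card n S -> has_card n S' -> (S #= S')%card.
Proof.
move=> /has_card_I h /has_card_I h'; by rewrite (card_eql h) card_eq_sym.
Qed.

Lemma has_card_inj (T T' : eqType) (S : set T) (S' : set T') n m :
  has_card n S -> has_card m S' -> (S #= S')%card -> n = m.
Proof.
move=> /has_card_I h /has_card_I h' e; apply/card_eq_II.
by rewrite -(card_eql h) (card_eql e).
Qed.

(** * Quadratic polynomials and elliptic linear forms *)

Section Quadratics.
Variable R : rcfType.
Implicit Types q : {poly R}.

Definition disc q := q`_1 ^+ 2 - 4 * q`_0 * q`_2.

Lemma horner3 q x : (size q <= 3)%N -> q.[x] = q`_0 + q`_1 * x + q`_2 * x ^+ 2.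
Proof.
by move=> sq; rewrite (horner_coef_wide _ sq) !big_ord_recl big_ord0 /=; ring.
Qed.

Lemma disc_lt0_size q : (size q <= 3)%N -> disc q < 0 -> size q = 3%N.
Proof.
move=> sq d0; apply/eqP; rewrite eqn_leq sq /= ltnNge; apply/negP => s2.
by move: d0; rewrite /disc [q`_2]nth_default // mulr0 subr0 ltNge sqr_ge0.
Qed.

Lemma disc_lt0_nonroot q x : (size q <= 3)%N -> disc q < 0 -> ~~ root q x.
Proof.
move=> sq d0; apply/negP => /rootP; rewrite horner3 // => e.
have : disc q = (2 * q`_2 * x + q`_1) ^+ 2.
  apply/eqP; rewrite -subr_eq0.
  have -> : disc q - (2 * q`_2 * x + q`_1) ^+ 2 = - 4 * q`_2 * (q`_0 + q`_1 * x + q`_2 * x ^+ 2).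
    by rewrite /disc; ring.
  by rewrite e mulr0.
by move=> dE; move: d0; rewrite dE ltNge sqr_ge0.
Qed.

Lemma disc_ge0_split q : size q = 3%N -> 0 <= disc q ->
  exists r s, q = q`_2 *: (('X - r%:P) * ('X - s%:P)) /\ (r == s) = (disc q == 0).
Proof.
move=> sq d0; have q2 : q`_2 != 0 by rewrite -[2%N]/(3.-1) -sq -lead_coefE lead_coef_eq0 -size_poly_eq0 sq.
pose w := Num.sqrt (disc q); have w2 : w ^+ 2 = disc q by rewrite sqr_sqrtr.
exists ((- q`_1 + w) / (2 * q`_2)), ((- q`_1 - w) / (2 * q`_2)); split.
  apply: poly_ext => x; rewrite horner3 ?sq // hornerZ hornerM !hornerXsubC.
  have q0E : q`_0 = (q`_1 ^+ 2 - w ^+ 2) / (4 * q`_2) by rewrite w2 /disc; field.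
  by rewrite q0E; field.
have q20 : 2 * q`_2 != 0 by rewrite mulf_neq0 // pnatr_eq0.
rewrite (inj_eq (mulIf (invr_neq0 q20))) (inj_eq (addrI _)) -w2 sqrf_eq0.
by rewrite -addr_eq0 -mulr2n mulrn_eq0.
Qed.

Lemma disc_split a r s : disc (a *: (('X - r%:P) * ('X - s%:P))) = a ^+ 2 * (r - s) ^+ 2.
Proof.
have e : ('X - r%:P) * ('X - s%:P) = 'X^2 - (r + s) *: 'X + (r * s)%:P.
  by apply: poly_ext => x; rewrite hornerM !hornerXsubC !hornerE; ring.
by rewrite /disc e !coefZ !coefD !coefN !coefZ !coefX !coefXn !coefC /=; ring.
Qed.

Lemma real_splitM (f g : {poly R}) rs rs' h h' : real_split f rs h -> real_split g rs' h' ->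
  real_split (f * g) (rs ++ rs') (h * h').
Proof.
move=> [fE hr] [gE hr']; split; first by rewrite big_cat /= mulrACA -fE -gE.
by move=> x; rewrite rootM negb_or hr hr'.
Qed.

Lemma quadratic_real_split q : size q = 3%N ->
  exists rs h, [/\ real_split q rs h, size rs = (2 * (0 <= disc q)%R)%N &
    uniq rs = (disc q != 0)].
Proof.
move=> sq; case: (leP 0 (disc q)) => d0 /=.
  have [r [s [qE rs]]] := disc_ge0_split sq d0; exists [:: r; s], (q`_2)%:P.
  split=> //; last by rewrite /= inE andbT rs.
  split; first by rewrite !big_cons big_nil mulr1 {1}qE -mul_polyC mulrC.
  move=> x; rewrite rootC -[2%N]/(3.-1) -sq -lead_coefE lead_coef_eq0 -size_poly_eq0 sq //.
exists [::], q; split; rewrite ?lt_eqF //=.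
by split=> [|x]; [rewrite big_nil mul1r|apply: disc_lt0_nonroot; rewrite ?sq].
Qed.

End Quadratics.

Section Elliptic.
Variables (R : realType) (Q : form R 2) (F : conic_frame Q).

Definition vdisc (v : 'rV[R]_3) : R := disc (restr F (linear_form v)).

(** A line meets the conic where the restriction of its linear form
    vanishes. A line through the point at infinity, for which the restriction
    has degree less than 2, is not elliptic and its discriminant is a square. *)
Lemma elliptic_vdisc v : elliptic Q v <-> vdisc v < 0.
Proof.
have sv := size_restr_linear F v; split=> [ev|d0]; last first.
  by apply: (elliptic_restr (disc_lt0_size sv d0)) => x; apply: disc_lt0_nonroot.
rewrite ltNge; apply/negP => d0.
have [_ top] := restr_top F (linear_form_homog v).
have [s3|s3] := eqVneq (size (restr F (linear_form v))) 3.
  have [r [s [qE _]]] := disc_ge0_split s3 d0.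
  have rt : root (restr F (linear_form v)) r.
    by rewrite qE; apply/rootP; rewrite hornerZ hornerM hornerXsubC subrr mul0r mulr0.
  have /eqP := fr_pt_isotropic F r; apply/negP/ev; first exact: fr_pt_neq0.
  by move/rootP: rt; rewrite restrE evalp_linear_form.
have /eqP := fr_b_isotropic F; apply/negP/ev; first exact: fr_b_neq0.
by rewrite -evalp_linear_form -top nth_default // -ltnS ltn_neqAle s3.
Qed.

Lemma restr_coef_cts k (Z : topologicalType) (z : Z) (G : Z -> form R k) j :
  coef_cts z (fun y => G y : mpoly 3 R) -> {for z, continuous (fun y => (restr F (G y))`_j)}.
Proof.
move=> h; have -> : (fun y => (restr F (G y))`_j) = fun y => \sum_(m : bmultinom 3 k.+1)
    mcoeff m (G y : mpoly 3 R) * (restr F (monomial_form R k m))`_j.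
  apply: funext => y; rewrite [in LHS](form_monomials (G y)) raddf_sum restr_sum coef_sum.
  by apply: eq_bigr => m _; rewrite /= restrZ coefZ.
by apply: cts_sum => m _; apply: ctsM; [apply: h|apply: cts_cst].
Qed.

Lemma vdisc_cts (Z : topologicalType) (z : Z) (v : Z -> 'rV[R]_3) : vec_cts z v ->
  {for z, continuous (fun y => vdisc (v y))}.
Proof.
move=> hv; have hc j : {for z, continuous (fun y => (restr F (linear_form (v y)))`_j)}.
  exact: (@restr_coef_cts 1 _ _ (fun y => DHomog (linear_form_homog (v y))) j (coef_cts_linear hv)).
apply: ctsB; first by apply: cts_sqr; apply: hc.
by apply: ctsM; [apply: ctsM; [apply: cts_cst|apply: hc]|apply: hc].
Qed.

End Elliptic.

Section Frames.
Variables (R : realType) (Q : form R 2).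
Hypothesis Qirr : irreducible_over_C Q.

Lemma indefinite_frame : ~ definite Q -> inhabited (conic_frame Q).
Proof.
move=> /indefinite_isotropic[b b0 Qb].
by have [F _] := exists_conic_frame Qirr b0 Qb; exists.
Qed.

(** A frame whose point at infinity lies off the curve P = 0, so that
    restriction to the conic keeps the full degree of P. *)
Lemma exists_frame_off k (P : form R k) : ~ definite Q -> ~ divides (Q : mpoly 3 R) P ->
  exists F : conic_frame Q, evalp P (fr_b F) != 0.
Proof.
move=> /indefinite_frame[F0] nd; have : restr F0 P != 0.
  by apply/eqP => /(restr_eq0 (dhomog_is_dhomog P)).
move=> /infinite_field_nonroot[t]; rewrite /root restrE => Pt.
have [F FE] := exists_conic_frame Qirr (fr_pt_neq0 F0 t) (fr_pt_isotropic F0 t).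
by exists F; rewrite FE.
Qed.

(** Ellipticity is thus an open condition. The function is constant for a
    definite form, all lines being elliptic then. *)
Lemma ellipticity_function : exists2 D : 'rV[R]_3 -> R,
  (forall v, {for v, continuous D}) & forall v, elliptic Q v <-> D v < 0.
Proof.
have [Qdef|/indefinite_frame[F]] := pselect (definite Q).
  exists (fun=> -1); first by move=> v; apply: cts_cst.
  by move=> v; split=> _; [rewrite oppr_lt0|apply: definite_elliptic].
exists (vdisc F); last by move=> v; apply: elliptic_vdisc.
by move=> v; apply: vdisc_cts; apply: vec_ctsP.
Qed.

(** The quadratic polynomial t^2 + 1 has no real root. *)
Lemma exists_elliptic : exists2 v, v != 0 & elliptic Q v.
Proof.
have [Qdef|/indefinite_frame[F]] := pselect (definite Q).
  by exists (const_mx 1); [apply: const1_neq0|apply: definite_elliptic].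
pose q : {poly R} := 'X^2 + 1%:P.
have sq : size q = 3%N by rewrite size_XnaddC.
have rq := restr_vec_of_poly F (eq_leq sq).
exists (vec_of_poly F q).
  by rewrite -linear_form_eq0; apply/eqP => h; move: sq; rewrite -rq h restr0 size_poly0.
apply/(elliptic_vdisc F); rewrite /vdisc rq /disc /q !coefD !coefXn !coefC /=; lra.
Qed.

End Frames.

(** The splitting according to the partner of a root also proves
    finiteness in the presence of multiple roots. *)
Lemma factor_set_finite (R : realType) (Q : form R 2) (F : conic_frame Q) k (f : {poly R}) :
  irreducible_over_C Q -> size f = ((2 * k).+1)%N -> finite_set (factor_set F k f).
Proof.
move=> Qirr sf; have f0 : f != 0 by rewrite -size_poly_gt0 sf.
have [rs [h sp]] := exists_real_split f0.
have no_root k' (f' : {poly R}) : size f' = ((2 * k').+1)%N -> real_split f' [::] h -> finite_set (factor_set F k' f').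
  move=> sf' sp'; have c := card_factor_set F Qirr (m := 0) sf' sp' isT erefl.
  by exists (double_fact 0); apply: has_card_I.
elim: k f rs sf f0 sp => [|k IH] f rs sf f0 sp.
  case: rs sp => [|r0 rs] sp; last by have := real_split_size sp; rewrite sf.
  exact: no_root.
case: rs sp => [|r0 rs] sp; first exact: no_root.
apply: (@sub_finite_set _ _ (\bigcup_(r in [set` rs]) ((fun G => linear_form (vec_of_poly F (('X - r0%:P) * ('X - r%:P))) * G) @`
    factor_set F k ((\prod_(s <- rem r rs) ('X - s%:P)) * h)))).
  by move=> G /(factor_set_split F Qirr _ sf sp)[r rrs [G' G'f ->]]; exists r => //; exists G'.
apply: bigcup_finite => [|r rrs]; first exact: finite_seq.
apply: finite_image; have fE : f = ('X - r0%:P) * ('X - r%:P) * ((\prod_(s <- rem r rs) ('X - s%:P)) * h).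
  by case: sp => -> _; rewrite big_cons (big_rem r) //= !mulrA.
have f'0 : (\prod_(s <- rem r rs) ('X - s%:P)) * h != 0.
  by apply: contraNneq f0 => e; rewrite fE e mulr0.
apply: (IH _ (rem r rs)) => //; last by split=> //; case: sp.
have /eqP := sf; rewrite fE size_mul // ?mulf_neq0 ?polyXsubC_eq0 //.
rewrite size_Mmonic ?monicXsubC ?polyXsubC_eq0 // !size_XsubC.
by move: (size (_ * h)) => n /eqP; lia.
Qed.

(** * Fibers of Phi and of Psi *)

Section Fibers.
Variables (R : realType) (k : nat) (B : {dot (form R k) for idfun}) (Q : form R 2).
Hypotheses (Qirr : irreducible_over_C Q) (k_gt0 : (0 < k)%N).
Local Notation Phi := (@Phi R k B Q Qirr).
Local Notation Psi := (@Psi R k B Q Qirr).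
Local Notation ppi := (\pi_(RP_VQperp B Q) : VQperp0 B Q -> RP_VQperp B Q).
Implicit Types (P : VQperp0 B Q) (m : multipole R k) (A : vectors R k).

Lemma VQperp0_ndivides P : ~ divides (Q : mpoly 3 R) (\val P : form R k).
Proof.
have [hP P0] := VQperp0P P => d; move/eqP: P0; apply.
by apply: (@VQperp_eqP _ _ B Q); rewrite ?mem0v ?subr0.
Qed.

Lemma Phi_restrP (F : conic_frame Q) m P :
  Phi m = P <-> restr F (param m) = restr F (\val P : form R k).
Proof.
split=> [/PhiP/restr_divides //|e]; apply/PhiP.
by apply: (restr_inj _ _ e); apply: dhomog_is_dhomog.
Qed.

Lemma Phi_surj P : exists m, Phi m = P.
Proof.
have nd := @VQperp0_ndivides P.
have [Qdef|/(indefinite_frame Qirr)[F]] := pselect (definite Q).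
  have [c [vs [svs vs0 d]]] := definite_factorization (\val P) Qirr Qdef.
  have c0 : c != 0 by apply/eqP => c0; apply: nd; move: d; rewrite c0 scale0r subr0.
  have [A AE] := vectors_of_scaled_seq k_gt0 c0 svs vs0.
  exists (\pi_(multipole R k) A); apply/PhiP; rewrite param_pi AE -opprB.
  exact: dividesN.
have f0 : restr F (\val P : form R k) != 0 by apply/eqP => /(restr_eq0 (dhomog_is_dhomog _)).
have [sf _] := restr_top F (dhomog_is_dhomog (\val P)).
have [c [vs [c0 svs vs0 e]]] := indefinite_factorization F f0 sf.
have [A AE] := vectors_of_scaled_seq k_gt0 c0 svs vs0.
by exists (\pi_(multipole R k) A); apply/(Phi_restrP F); rewrite param_pi AE.
Qed.

Lemma projP (y : Sym k (RP2 R)) : exists m, y = proj m.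
Proof. by have [A ->] := sym_classP y; exists (\pi_(multipole R k) A); rewrite proj_pi. Qed.

(** Two classes over the same point of the projective space differ by a
    scalar, which the action on multipoles absorbs. *)
Lemma Psi_fiberP y P : Psi y = ppi P <-> exists2 m, y = proj m & Phi m = P.
Proof.
split=> [|[m -> <-]]; last exact: Psi_proj.
have [m ->] := projP y; rewrite Psi_proj => /RP_VQperp_eqP[c c0 cE].
exists (act k_gt0 (mk_Rstar c0) m); first by rewrite proj_act.
by apply: val_inj; rewrite Phi_act cE.
Qed.

Lemma Psi_surj (z : RP_VQperp B Q) : exists y, Psi y = z.
Proof.
have [m e] := Phi_surj (repr z); exists (proj m).
by rewrite Psi_proj e reprK.
Qed.

(** The projection is a bijection between the two fibers: the action of
    t <> 1 moves every element of a fiber of Phi to another fiber. *)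
Lemma card_Phi_Psi P n :
  has_card n (Phi @^-1` [set P]) <-> has_card n (Psi @^-1` [set ppi P]).
Proof.
apply: (has_card_bij (f := @proj R k)) => [m /= <-|m m' /= e e' /proj_eqP[c c0 cE]|y /Psi_fiberP[m -> e]].
- exact: Psi_proj.
- apply: param_inj; suff -> : m' = m by [].
  apply: param_inj; have := congr1 (fun S : VQperp0 B Q => \val S) e.
  have := congr1 (fun S : VQperp0 B Q => \val S) e'; rewrite !val_Phi cE linearZ /= => e2 e1.
  have [_ P0] := VQperp0P P; move: e2; rewrite e1 => /eqP.
  rewrite -[X in _ == X]scale1r -subr_eq0 -scalerBl scaler_eq0 (negbTE P0) orbF subr_eq0 => /eqP ->.
  by rewrite scale1r.
- by exists m.
Qed.

Lemma factor_set_param (F : conic_frame Q) (f : {poly R}) (G : mpoly 3 R) :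
  factor_set F k f G -> exists2 m : multipole R k, (param m : mpoly 3 R) = G & restr F (param m) = f.
Proof.
move=> [c [vs [c0 svs vs0 GE e]]].
have [A AE] := vectors_of_scaled_seq k_gt0 c0 svs vs0.
exists (\pi_(multipole R k) A); rewrite param_pi AE ?GE //.
by rewrite -GE.
Qed.

Lemma param_factor_set (F : conic_frame Q) m : factor_set F k (restr F (param m)) (param m).
Proof.
exists 1, (vecs (repr m)); split; rewrite ?oner_neq0 ?size_vecs ?vecs_neq0 //.
by rewrite scale1r -prod_formE.
Qed.

Lemma card_Phi_factor_set (F : conic_frame Q) P n :
  has_card n (Phi @^-1` [set P]) <-> has_card n (factor_set F k (restr F (\val P : form R k))).
Proof.
apply: (has_card_bij (f := fun m => param m : mpoly 3 R)) => [m /= /(Phi_restrP F) <-|m m' _ _ e|G].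
- exact: param_factor_set.
- by apply: param_inj; apply: val_inj.
- by move=> /factor_set_param[m e1 e2]; exists m => //; apply/(Phi_restrP F).
Qed.

Lemma size_prod_form_restr (F : conic_frame Q) A (f : {poly R}) :
  restr F (prod_form A) = f -> size f = ((2 * k).+1)%N ->
  forall i, size (restr F (linear_form (\val (A i)))) = 3%N.
Proof.
move=> <- sf i; apply: (@size_restr_full _ _ F Qirr 1 (vecs A)); rewrite ?oner_neq0 ?vecs_neq0 //.
  by rewrite scale1r -prod_formE size_vecs.
by apply: map_f; rewrite mem_enum.
Qed.

(** A quadratic factor has two real roots or none, according to the sign of
    its discriminant. *)
Lemma prod_form_real_split (F : conic_frame Q) A :
  (forall i, size (restr F (linear_form (\val (A i)))) = 3%N) ->
  exists rs h, [/\ real_split (restr F (prod_form A)) rs h &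
    size rs = (2 * #|[pred i | (0 <= vdisc F (\val (A i)))%R]|)%N].
Proof.
move=> s3; rewrite -[X in restr F X]/(\prod_i linear_form (\val (A i))) restr_prod.
have -> : #|[pred i | (0 <= vdisc F (\val (A i)))%R]| = (\sum_i (0 <= vdisc F (\val (A i)))%R)%N.
  by rewrite -sum1_card big_mkcond.
elim/big_rec2: _ => [|i n f _ [rs [h [sp srs]]]].
  by exists [::], 1; split=> //; split; [rewrite big_nil mulr1|move=> x; rewrite root1].
have [rs' [h' [sp' srs' _]]] := quadratic_real_split (s3 i).
exists (rs' ++ rs), (h' * h); split; first exact: real_splitM.
by rewrite size_cat srs srs' mulnDr.
Qed.

Lemma real_split_even (F : conic_frame Q) P rs h :
  evalp (\val P : form R k) (fr_b F) != 0 -> real_split (restr F (\val P : form R k)) rs h ->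
  exists n, size rs = (2 * n)%N.
Proof.
move=> Pb sp; have [m /(Phi_restrP F) e] := Phi_surj P; have [A mE] := multipoleP m.
rewrite mE param_pi in e.
have sf : size (restr F (\val P : form R k)) = ((2 * k).+1)%N.
  have [le top] := restr_top F (dhomog_is_dhomog (\val P)).
  apply/eqP; rewrite eqn_leq le ltnNge; apply/negP => le'.
  by move: Pb; rewrite -top nth_default ?eqxx.
have [rs' [h' [sp' srs']]] := prod_form_real_split (size_prod_form_restr e sf).
rewrite e in sp'; rewrite (perm_size (real_split_uniq sp sp')) srs'.
by eexists.
Qed.

Lemma size_restr_off (F : conic_frame Q) P : evalp (\val P : form R k) (fr_b F) != 0 ->
  size (restr F (\val P : form R k)) = ((2 * k).+1)%N.
Proof.
move=> Pb; have [le top] := restr_top F (dhomog_is_dhomog (\val P)).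
apply/eqP; rewrite eqn_leq le ltnNge; apply/negP => le'.
by move: Pb; rewrite -top nth_default ?eqxx.
Qed.

Lemma card_Phi_uniq (F : conic_frame Q) P rs h n :
  evalp (\val P : form R k) (fr_b F) != 0 -> real_split (restr F (\val P : form R k)) rs h ->
  uniq rs -> size rs = (2 * n)%N -> has_card (double_fact n) (Phi @^-1` [set P]).
Proof.
move=> Pb sp urs srs; apply/(card_Phi_factor_set F).
exact: card_factor_set (size_restr_off Pb) sp urs srs.
Qed.

(** By linear_factors_uniq_modQ the class contains no other product of linear
    forms, and the product determines the multipole. *)
Lemma card_Phi_elliptic P A : Phi (\pi_(multipole R k) A) = P ->
  (forall i j, i != j -> elliptic Q (\val (A i)) \/ elliptic Q (\val (A j))) ->
  has_card 1 (Phi @^-1` [set P]).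
Proof.
move=> AP h; apply: (@has_card1 _ _ (\pi_(multipole R k) A)) => // m; have [A' ->] := multipoleP m => A'P.
have cnt : (count (fun v => ~~ `[< elliptic Q v >]) (vecs A) <= 1)%N.
  rewrite count_map -size_filter; set s := seq.filter _ _.
  have us : uniq s by rewrite filter_uniq ?enum_uniq.
  case sE : s => [|i [|j s']] //; exfalso.
  have [ii jj] : i \in s /\ j \in s by rewrite sE !inE !eqxx orbT.
  have ij : i != j by move: us; rewrite sE /= inE negb_or => /andP[/andP[]].
  move: ii jj; rewrite !mem_filter /= => /andP[/asboolPn ii _] /andP[/asboolPn jj _].
  by case: (h i j ij).
have d : divides (Q : mpoly 3 R) (1 *: \prod_(w <- vecs A') linear_form w - \prod_(v <- vecs A) linear_form v).
  rewrite scale1r -!prod_formE.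
  move/PhiP: AP; move/PhiP: A'P; rewrite !param_pi => d1 d2.
  by have := dividesB d1 d2; rewrite opprB addrA subrK.
have sz : size (vecs A) = size (vecs A') by rewrite !size_vecs.
have := linear_factors_uniq_modQ Qirr (vecs_neq0 A) (vecs_neq0 A') sz (oner_neq0 _) cnt d.
move=> /perm_cano_vecs[s sE].
have [c cE] := @boolp.choice _ _ (fun i (c : Rstar R) => \val (A' i) = \val c *: \val (A (s i)))
    (fun i => let: ex_intro2 c c0 cE := sE i in ex_intro _ (mk_Rstar c0) cE).
have e := @prod_form_scale _ _ A A' _ s cE.
have [hP P0] := VQperp0P P.
have := congr1 (fun S : VQperp0 B Q => \val S) A'P.
have := congr1 (fun S : VQperp0 B Q => \val S) AP; rewrite !val_Phi !param_pi e linearZ /= => -> /eqP.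
rewrite -[X in _ == X]scale1r -subr_eq0 -scalerBl scaler_eq0 (negbTE P0) orbF subr_eq0 => /eqP c1.
by apply/multipole_eqP; rewrite e c1 scale1r.
Qed.

(** In a frame whose point at infinity lies off P = 0, the fiber consists of
    the factorizations of a polynomial of degree 2 k. *)
Lemma Phi_finite_fibers : ~ definite Q -> finite_fibers Phi.
Proof.
move=> nQ P; have [F Pb] := exists_frame_off Qirr nQ (@VQperp0_ndivides P).
apply: (@sub_finite_set _ _ ((fun m => param m : mpoly 3 R) @^-1` (factor_set F k (restr F (\val P : form R k))))).
  by move=> m /= /(Phi_restrP F) <-; apply: param_factor_set.
apply: finite_preimage; first by move=> m m' _ _ e; apply: param_inj; apply: val_inj.
exact: factor_set_finite (size_restr_off Pb).
Qed.

End Fibers.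

(** * Perturbing roots *)

Section Perturbation.
Variables (R : realType) (Z : topologicalType) (z : Z).

Definition poly_cts (f : Z -> {poly R}) := forall j, {for z, continuous (fun y => (f y)`_j)}.

Lemma poly_cts_cst p : poly_cts (fun=> p).
Proof. by move=> j; apply: cts_cst. Qed.

Lemma poly_ctsD f g : poly_cts f -> poly_cts g -> poly_cts (fun y => f y + g y).
Proof.
move=> hf hg j; have -> : (fun y => (f y + g y)`_j) = (fun y => (f y)`_j + (g y)`_j).
  by apply: funext => y; rewrite coefD.
exact: ctsD.
Qed.

Lemma poly_ctsM f g : poly_cts f -> poly_cts g -> poly_cts (fun y => f y * g y).
Proof.
move=> hf hg j; under [X in {for z, continuous X}]eq_fun do rewrite coefM.
by apply: cts_sum => i _; apply: ctsM.
Qed.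

Lemma poly_cts_prod I (r : seq I) (f : I -> Z -> {poly R}) : (forall i, poly_cts (f i)) ->
  poly_cts (fun y => \prod_(i <- r) f i y).
Proof.
move=> h; elim: r => [|i r IH].
  have -> : (fun y => \prod_(i <- [::]) f i y) = fun=> 1.
    by apply: funext => y; rewrite big_nil.
  exact: poly_cts_cst.
have -> : (fun y => \prod_(i <- i :: r) f i y) = (fun y => f i y * \prod_(i <- r) f i y).
  by apply: funext => y; rewrite big_cons.
exact: poly_ctsM (h i) IH.
Qed.

Lemma poly_cts_const (c : Z -> R) : {for z, continuous c} -> poly_cts (fun y => (c y)%:P).
Proof.
move=> h j; under [X in {for z, continuous X}]eq_fun do rewrite coefC.
by case: eqP => _; [exact: h|apply: cts_cst].
Qed.

Lemma poly_cts_XsubC (c : Z -> R) : {for z, continuous c} -> poly_cts (fun y => 'X - (c y)%:P).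
Proof.
move=> h; have -> : (fun y => 'X - (c y)%:P) = fun y => 'X + (- 1 * c y)%:P.
  by apply: funext => y; rewrite mulN1r polyCN.
apply: poly_ctsD; first exact: poly_cts_cst.
by apply: poly_cts_const; apply: ctsM => //; apply: cts_cst.
Qed.

End Perturbation.

Section Spread.
Variable R : realType.

Lemma avoid_finite (bad : seq R) d : 0 < d -> exists d', [/\ 0 < d', d' <= d &
  forall e, 0 < e -> e < d' -> e \notin bad].
Proof.
move=> d0; elim: bad => [|b bad [d' [d'0 d'd h]]]; first by exists d; split.
have [b0|b0] := leP b 0.
  exists d'; split=> // e e0 ed; rewrite inE negb_or h // andbT.
  by rewrite gt_eqF // (le_lt_trans b0).
exists (Num.min d' b); split; first by rewrite lt_min d'0.
  by rewrite ge_min d'd.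
by move=> e e0; rewrite lt_min => /andP[ed eb]; rewrite inE negb_or h // andbT lt_eqF.
Qed.

(** Different roots, and equal ones in different positions, become distinct
    for all but finitely many e. *)
Definition spread (rs : seq R) (e : R) : seq R := mkseq (fun i => rs`_i + e * i%:R) (size rs).

Lemma spread0 rs : spread rs 0 = rs.
Proof.
apply: (@eq_from_nth _ 0); first by rewrite size_mkseq.
by move=> i; rewrite size_mkseq => ik; rewrite nth_mkseq // mul0r addr0.
Qed.

Lemma spread_uniq rs d : 0 < d -> exists d', [/\ 0 < d', d' <= d &
  forall e, 0 < e -> e < d' -> uniq (spread rs e)].
Proof.
pose bad := [seq (rs`_ij.1 - rs`_ij.2) / (ij.2%:R - ij.1%:R) |
   ij <- [seq (i, j) | i <- iota 0 (size rs), j <- iota 0 (size rs)]].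
move=> /(avoid_finite bad)[d' [d'0 d'd h]]; exists d'; split=> // e e0 ed.
apply/mkseq_uniqP => i j; rewrite !inE => ik jk eq.
have [//|ij] := eqVneq i j; have /negP := h e e0 ed; case.
apply/mapP; exists (i, j); first by apply/allpairsP; exists (i, j); rewrite !mem_iota !add0n ik jk.
have ij0 : j%:R - i%:R != 0 :> R by rewrite subr_eq0 eqr_nat eq_sym.
apply: (mulIf ij0); rewrite divfK // mulrBr.
by move=> /=; lra.
Qed.

Lemma spread_cts rs : poly_cts (0 : R) (fun e => \prod_(s <- spread rs e) ('X - s%:P)).
Proof.
have -> : (fun e : R => \prod_(s <- spread rs e) ('X - s%:P)) =
   (fun e => \prod_(i <- iota 0 (size rs)) ('X - (rs`_i + e * i%:R)%:P)).
  by apply: funext => e; rewrite big_map.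
apply: poly_cts_prod => i; apply: poly_cts_XsubC; apply: ctsD; first exact: cts_cst.
by apply: ctsM; [exact: cvg_id|apply: cts_cst].
Qed.

Lemma size_spread_prod rs (h h' : {poly R}) e : size h = size h' ->
  size ((\prod_(s <- spread rs e) ('X - s%:P)) * h) = size ((\prod_(s <- rs) ('X - s%:P)) * h').
Proof.
have [->|h0] := eqVneq h 0.
  by rewrite size_poly0 => /esym/eqP; rewrite size_poly_eq0 => /eqP ->; rewrite !mulr0.
move=> hh; have h'0 : h' != 0 by rewrite -size_poly_eq0 -hh size_poly_eq0.
by rewrite !size_monicM ?monic_prod_XsubC // !size_prod_XsubC size_mkseq hh.
Qed.

End Spread.

Section Lifting.
Variables (R : realType) (k : nat) (B : {dot (form R k) for idfun}) (Q : form R 2).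
Hypothesis Qirr : irreducible_over_C Q.
Variable F : conic_frame Q.

Lemma restr_monomial j : exists P : form R k, (j < (2 * k).+1)%N -> restr F P = 'X^j.
Proof.
have [jk|_] := boolP (j < (2 * k).+1)%N; last by exists 0.
have [|P PE] := @restr_lift _ _ F k 'X^j; first by rewrite size_polyXn.
by exists P.
Qed.

Definition lift_monomial j : form R k := perp_proj B Q (projT1 (cid (restr_monomial j))).

(** The linear section of restriction with values in the orthogonal
    complement of the multiples of Q. *)
Definition frame_lift (p : {poly R}) : form R k := \sum_(j < (2 * k).+1) p`_j *: lift_monomial j.

Lemma frame_lift_mem p : frame_lift p \in VQperp B Q.
Proof. by apply: memv_suml => j _; apply: memvZ; apply: perp_proj_mem. Qed.

Lemma restr_frame_lift (p : {poly R}) : (size p <= (2 * k).+1)%N -> restr F (frame_lift p) = p.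
Proof.
move=> sp; rewrite /frame_lift raddf_sum restr_sum.
have -> : \sum_(j < (2 * k).+1) restr F (p`_j *: lift_monomial j) = \poly_(j < (2 * k).+1) p`_j.
  rewrite poly_def; apply: eq_bigr => j _; rewrite restrZ; congr (_ *: _).
  rewrite -(projT2 (cid (restr_monomial j)) (ltn_ord j)); apply/esym/restr_divides.
  exact: perp_proj_divides.
by apply/polyP => j; rewrite coef_poly; case: ltnP => // jk; rewrite nth_default // (leq_trans sp).
Qed.

Lemma frame_lift_restr P : P \in VQperp B Q -> frame_lift (restr F P) = P.
Proof.
move=> hP; apply: (@VQperp_eqP _ _ B Q); [exact: frame_lift_mem|exact: hP|].
apply: (restr_inj (F := F) (k := k)); try exact: dhomog_is_dhomog.
by rewrite restr_frame_lift //; case: (restr_top F (dhomog_is_dhomog P)).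
Qed.

Lemma frame_lift_cts (Z : topologicalType) (z : Z) (f : Z -> {poly R}) : poly_cts z f ->
  coef_cts z (fun y => frame_lift (f y) : mpoly 3 R).
Proof.
move=> hf; have -> : (fun y => frame_lift (f y) : mpoly 3 R) =
   fun y => \sum_(j < (2 * k).+1) (f y)`_j *: (lift_monomial j : mpoly 3 R).
  by apply: funext => y; rewrite raddf_sum.
by apply: coef_cts_sum => j _; apply: coef_ctsZ; [apply: hf|apply: coef_cts_cst].
Qed.

(** Composing with the continuous section frame_lift carries a small
    deformation of the restriction over to the form. *)
Lemma perturb (U : set (VQperp0 B Q)) (P : VQperp0 B Q) (f : R -> {poly R}) :
  nbhs P U -> evalp (\val P : form R k) (fr_b F) != 0 ->
  f 0 = restr F (\val P : form R k) -> poly_cts 0 f -> (forall e, (size (f e) <= (2 * k).+1)%N) ->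
  exists2 d, 0 < d & forall e, `|e| < d -> exists P' : VQperp0 B Q,
    [/\ U P', evalp (\val P' : form R k) (fr_b F) != 0 & restr F (\val P' : form R k) = f e].
Proof.
move=> PU Pb f0 fc fs; have [hP P0] := VQperp0P P.
have [sP topP] := restr_top F (dhomog_is_dhomog (\val P)).
have top e : evalp (frame_lift (f e)) (fr_b F) = (f e)`_(2 * k).
  have [_ <-] := restr_top F (dhomog_is_dhomog (frame_lift (f e))).
  by rewrite restr_frame_lift.
have near0 : \forall e \near (0 : R), (f e)`_(2 * k) != 0.
  by apply: (near_neq0 (fc _)); rewrite f0 topP.
have lift_ok e : (f e)`_(2 * k) != 0 -> frame_lift (f e) \in VQperp0 B Q.
  move=> fe; apply/mem_set; split; first exact: frame_lift_mem.
  by apply: contraNneq fe => l0; rewrite -top l0 evalp0.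
pose G e : VQperp0 B Q := insubd P (frame_lift (f e)).
have GE e : (f e)`_(2 * k) != 0 -> \val (G e) = frame_lift (f e).
  by move=> /lift_ok h; rewrite insubdK.
have G0 : G 0 = P.
  by apply: val_inj; rewrite GE f0 ?topP // frame_lift_restr.
have Gc : {for (0 : R), continuous G}.
  apply: cts_set_type; apply: (@cts_near _ _ _ (fun e => frame_lift (f e))).
    by apply: filterS near0 => e; apply: GE.
  by apply: cts_form; apply: frame_lift_cts.
have GU : \forall e \near (0 : R), U (G e) by apply: Gc; rewrite G0.
have hN : nbhs (0 : R) ([set e | (f e)`_(2 * k) != 0] `&` [set e | U (G e)]) by apply: filterI.
have [d /= d0 hd] := (nbhs_ballP (0 : R) _).1 hN.
exists d => // e ed; have [|fe Ue] := hd e; first by rewrite /ball /= sub0r normrN.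
by exists (G e); split; rewrite ?GE ?top ?restr_frame_lift.
Qed.

End Lifting.

(** * The degree of Psi *)

Section Degree.
Variables (R : realType) (k : nat) (B : {dot (form R k) for idfun}) (Q : form R 2).
Hypotheses (Qirr : irreducible_over_C Q) (k_gt0 : (0 < k)%N).
Local Notation Phi := (@Phi R k B Q Qirr).
Local Notation Psi := (@Psi R k B Q Qirr).
Local Notation ppi := (\pi_(RP_VQperp B Q) : VQperp0 B Q -> RP_VQperp B Q).
Implicit Types (P : VQperp0 B Q) (A : vectors R k).

(** The n sections provide the n points of each fiber. *)
Lemma evenly_covered_card n z : evenly_covered Psi n z ->
  exists2 U, open_nbhs z U & forall w, U w -> has_card n (Psi @^-1` [set w]).
Proof.
move=> [U [oU [s [_ _ sec inj cover]]]]; exists U => // w Uw.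
exists [seq s i w | i <- enum 'I_n]; split.
- by rewrite map_inj_uniq ?enum_uniq // => i j; apply: inj.
- by rewrite size_map size_enum_ord.
- move=> y; split=> [/= yw|/mapP[i _ ->]]; last exact: sec.
  have : (Psi @^-1` U) y by rewrite /= yw.
  rewrite cover => -[i _ [w' Uw' e]]; move: yw; rewrite -e sec // => ->.
  by apply: map_f; rewrite mem_enum.
Qed.

Lemma ppi_cts P : {for P, continuous ppi}.
Proof. exact: pi_continuous. Qed.

(** The real roots are moved apart while the factor without real roots may
    be deformed as well. *)
Lemma perturb_roots (F : conic_frame Q) P (U : set (VQperp0 B Q)) rs (h : R -> {poly R}) : nbhs P U ->
  evalp (\val P : form R k) (fr_b F) != 0 ->
  restr F (\val P : form R k) = (\prod_(r <- rs) ('X - r%:P)) * h 0 ->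
  poly_cts 0 h -> (forall e, size (h e) = size (h 0)) -> (forall e x, 0 < e -> ~~ root (h e) x) ->
  exists (P' : VQperp0 B Q) rs' h', [/\ U P', evalp (\val P' : form R k) (fr_b F) != 0,
    real_split (restr F (\val P' : form R k)) rs' h', uniq rs' & size rs' = size rs].
Proof.
move=> PU Pb fE hc hs hr; pose f e := (\prod_(s <- spread rs e) ('X - s%:P)) * h e.
have [||e|d d0 hd] := @perturb _ _ B Q F U P f PU Pb.
- by rewrite /f spread0 fE.
- by apply: poly_ctsM => //; apply: spread_cts.
- by rewrite (@size_spread_prod _ _ _ (h 0)) // -fE; have [] := restr_top F (dhomog_is_dhomog (\val P)).
have [d' [d'0 d'd hu]] := spread_uniq rs d0.
have e0 : 0 < d' / 2 by rewrite divr_gt0.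
have ed : d' / 2 < d' by rewrite ltr_pdivrMr // ltr_pMr // ltr1n.
have [|P' [UP' P'b P'f]] := hd (d' / 2).
  by rewrite gtr0_norm // (lt_le_trans ed).
have sp : real_split (restr F (\val P' : form R k)) (spread rs (d' / 2)) (h (d' / 2)).
  by rewrite /real_split P'f; split=> // x; apply: hr.
by exists P', (spread rs (d' / 2)), (h (d' / 2)); split; rewrite ?hu ?size_mkseq.
Qed.

(** Near the value there is one with simple real roots, whose fiber has
    (2 m - 1)!! elements. In the definite case every fiber has one element. *)
Lemma evenly_covered_odd n z : evenly_covered Psi n z -> odd n.
Proof.
move=> /evenly_covered_card[U [oU Uz] hU].
have [Qdef|nQ] := pselect (definite Q).
  have := hU z Uz; rewrite -[z]reprK => /(card_Phi_Psi Qirr k_gt0) hc.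
  have [m mP] := Phi_surj Qirr k_gt0 (repr z); have [A mE] := multipoleP m.
  have c1 : has_card 1 (Phi @^-1` [set repr z]).
    by apply: (@card_Phi_elliptic _ _ _ _ _ _ A); rewrite -?mE // => i j _; left; apply: definite_elliptic.
  by rewrite (has_card_uniq hc c1).
have [F Pb] := exists_frame_off Qirr nQ (@VQperp0_ndivides _ _ _ _ (repr z)).
have PU : nbhs (repr z) (ppi @^-1` U).
  by apply: ppi_cts; apply: open_nbhs_nbhs; split=> //; rewrite reprK.
have f0 : restr F (\val (repr z) : form R k) != 0.
  by rewrite -size_poly_gt0 (size_restr_off Pb).
have [rs [h sp]] := exists_real_split f0.
have [P' [rs' [h' [UP' P'b sp' urs _]]]] := perturb_roots PU Pb sp.1
  (@poly_cts_cst _ _ _ h) (fun=> erefl) (fun _ x _ => sp.2 x).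
have [m srs] := real_split_even Qirr k_gt0 P'b sp'.
have c := card_Phi_uniq Qirr k_gt0 P'b sp' urs srs.
move: (hU _ UP') => /(card_Phi_Psi Qirr k_gt0) c'.
by rewrite (has_card_uniq c' c) odd_double_fact.
Qed.

Lemma ellipticZ c (v : 'rV[R]_3) : c != 0 -> elliptic Q v -> elliptic Q (c *: v).
Proof.
move=> c0 ev x x0; rewrite dotvZl => /eqP; rewrite mulf_eq0 (negbTE c0) /= => /eqP.
exact: ev.
Qed.

Lemma sym_class_factors A A' : sym_class A = sym_class A' ->
  exists s : 'S_k, forall i, exists2 c, c != 0 & \val (A' i) = c *: \val (A (s i)).
Proof. by move=> /sym_class_eqP[c c0 e]; apply: (prod_form_factors c0 (esym e)). Qed.

Definition all_elliptic A := forall i, elliptic Q (\val (A i)).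

Lemma Psi_class A : Psi (sym_class A) = ppi (Phi (\pi_(multipole R k) A)).
Proof. by rewrite -Psi_proj proj_pi. Qed.

(** The elliptic factors determine the product in its class. *)
Lemma Psi_elliptic_inj A y : all_elliptic A -> Psi y = Psi (sym_class A) -> y = sym_class A.
Proof.
move=> h; rewrite Psi_class => /(Psi_fiberP _ k_gt0)[m ->] mA.
have [s [_ s1 hs]] : has_card 1 (Phi @^-1` [set Phi (\pi_(multipole R k) A)]).
  by apply: (@card_Phi_elliptic _ _ _ _ _ _ A) => // i j _; left; apply: h.
rewrite -proj_pi; congr proj; move/hs: mA.
have : (Phi @^-1` [set Phi (\pi_(multipole R k) A)]) (\pi_(multipole R k) A) by [].
by move/hs; case: s s1 {hs} => [|x [|]] //= _; rewrite !mem_seq1 => /eqP -> /eqP ->.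
Qed.

Lemma near_all_elliptic A : all_elliptic A -> \forall A' \near A, all_elliptic A'.
Proof.
have [D Dc DE] := ellipticity_function Qirr; move=> h.
apply: (@nbhs_forall {ptws 'I_k -> nzvec R} k A (fun i => [set A' : vectors R k | elliptic Q (\val (A' i))])) => i.
have : \forall A' \near A, 0 < - D (\val (A' i)).
  apply: near_gt0; last by rewrite oppr_gt0; apply/DE/h.
  have -> : (fun A' : vectors R k => - D (\val (A' i))) = (fun A' => -1 * D (\val (A' i))).
    by apply: funext => A'; rewrite mulN1r.
  apply: ctsM; first exact: cts_cst.
  apply: (@cts_comp _ _ _ (fun A' : vectors R k => \val (A' i)) D); last exact: Dc.
  by apply: cts_vec; apply: vec_cts_entry.
by move=> hn; apply: (@filterS _ _ (nbhs_filter A) _ _ _ hn) => A'; rewrite /= oppr_gt0 => /DE.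
Qed.

(** The classes of products of elliptic forms make up an open set E, and Psi
    maps the complement of E, which is compact, to a closed set. On the
    complement U of the latter Psi has a unique inverse; this inverse is
    continuous because Psi is closed. *)
Lemma evenly_covered_one : exists z, evenly_covered Psi 1 z.
Proof.
have [v0 v0n0 ev0] := exists_elliptic Qirr.
pose E := [set y | exists2 A : vectors R k, y = sym_class A & all_elliptic A].
have oE : open E.
  apply: open_nbhs_all => _ [A -> hA]; apply: open_map_nbhs; first exact: sym_class_open_map.
  by apply: filterS (near_all_elliptic hA) => A' hA'; exists A'.
pose A0 : vectors R k := fun=> mk_nzvec v0n0.
have cP y : {for y, continuous Psi} by apply: Psi_cts.
(* The values all of whose preimages lie in E. *)
pose U := ~` (Psi @` (~` E)).
have UE y : U (Psi y) -> E y.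
  by move=> Uy; apply: contrapT => nE; apply: Uy; exists y.
have oU : open U.
  apply: closed_openC; apply: (compact_closed (@RP_VQperp_hausdorff _ _ B Q)).
  apply: continuous_compact; first by apply: continuous_in_subspaceT => x _; apply: cP.
  by apply: (subclosed_compact _ (@Sym_compact R k)) => //; apply: open_closedC.
have U0 : U (Psi (sym_class A0)).
  move=> [y nE /(Psi_elliptic_inj (A := A0)) yE]; apply: nE; exists A0; last by [].
  by apply: yE.
have [s sK] := boolp.choice (fun z => @Psi_surj R k B Q Qirr k_gt0 z).
have inj y z : U z -> Psi y = z -> y = s z.
  move=> Uz yz; have [A sA hA] : E (s z) by apply: UE; rewrite sK.
  by rewrite sA; apply: Psi_elliptic_inj => //; rewrite -sA sK.
exists (Psi (sym_class A0)), U; split=> //; exists (fun=> s).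
have sU : s @` U = Psi @^-1` U.
  apply/seteqP; split=> [_ [z Uz <-]|y Uy]; first by rewrite /= sK.
  by exists (Psi y) => //; apply/esym/inj.
split.
- move=> _; apply: continuous_in_subspaceT => z /set_mem Uz N; rewrite nbhsE => -[V [oV Vs] VN].
  have [|W [[oW Wz] hW]] := @closed_map_fiber _ _ Psi z V (@Sym_compact R k) (@RP_VQperp_hausdorff _ _ B Q) cP oV.
    by move=> y /(inj _ _ Uz) ->.
  apply: (@filterS _ _ _ W); last exact: open_nbhs_nbhs.
  by move=> w Ww; apply: VN; apply: hW; rewrite sK.
- by move=> _; rewrite sU; apply: open_comp => // y _; apply: cP.
- by move=> _ z _; apply: sK.
- by move=> i j z _ _; rewrite !ord1.
- rewrite -sU; apply/seteqP; split=> [y|y [i _]] //.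
  by move=> sy; exists ord0.
Qed.

Theorem Psi_degree_one : degree_one Psi.
Proof.
split; [by move=> y; apply: Psi_cts|exact: evenly_covered_one|exact: evenly_covered_odd].
Qed.

End Degree.

(** * Ramification *)

Lemma uniq_count (T : eqType) (s : seq T) : ~~ uniq s -> exists x, (1 < count_mem x s)%N.
Proof.
elim: s => [|x s IH] //=; rewrite negb_and negbK => /orP[xs|/IH[y y2]].
  by exists x; rewrite eqxx add1n ltnS -has_count has_pred1.
by exists y; apply: (leq_trans y2); apply: leq_addl.
Qed.

Lemma count_uniq (T : eqType) (s : seq T) x : (1 < count_mem x s)%N -> ~~ uniq s.
Proof. by apply: contraTN => us; rewrite count_uniq_mem // -leqNgt leq_b1. Qed.

Section Ramification.
Variables (R : realType) (k : nat) (B : {dot (form R k) for idfun}) (Q : form R 2).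
Hypotheses (Qirr : irreducible_over_C Q) (k_gt0 : (0 < k)%N).
Local Notation Phi := (@Phi R k B Q Qirr).
Local Notation Psi := (@Psi R k B Q Qirr).
Local Notation ppi := (\pi_(RP_VQperp B Q) : VQperp0 B Q -> RP_VQperp B Q).
Implicit Types (P : VQperp0 B Q) (A : vectors R k).

Section OneFrame.
Variables (F : conic_frame Q) (P : VQperp0 B Q) (rs : seq R) (h : {poly R}).
Hypotheses (Pb : evalp (\val P : form R k) (fr_b F) != 0)
  (sp : real_split (restr F (\val P : form R k)) rs h).

Definition frame_point s : nzvec R := mk_nzvec (fr_pt_neq0 F s).

Lemma line_mult_count (a : nzvec R) l s m : l != 0 -> \val a = l *: fr_pt F s ->
  line_mult_ge (\val P : form R k) Q a m <-> (m <= count_mem s rs)%N.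
Proof. move=> l0 aE.
by split=> [/(line_mult_geP Pb m l0 aE)/(dvdXsubC_real_split _ _ sp)|/(dvdXsubC_real_split _ _ sp)/(line_mult_geP Pb m l0 aE)]. Qed.

Lemma line_mult_frame_point s m :
  line_mult_ge (\val P : form R k) Q (frame_point s) m <-> (m <= count_mem s rs)%N.
Proof. by apply: (@line_mult_count _ 1); rewrite ?oner_neq0 ?scale1r. Qed.

(** The order of vanishing of the restriction at a root is the number of its
    occurrences in rs. *)
Lemma discriminantP : discriminant B Q P <-> ~~ uniq rs.
Proof.
split=> [[a am]|/uniq_count[s s2]]; last by exists (frame_point s); apply/line_mult_frame_point.
have [s [l [l0 aE]]] := line_mult_ge_point Pb (isT : (0 < 2)%N) am.
by move/(line_mult_count _ l0 aE): am; apply: count_uniq.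
Qed.

Lemma discriminant_curvesP : discriminant_curves B Q P <-> ~~ uniq rs.
Proof.
split=> [[a am]|/uniq_count[s s2]].
  have [s [l [l0 aE]]] := point_mult_ge_point Pb (isT : (0 < 2)%N) am.
  by move/(point_mult_ge2P (\val P) l0 aE)/(dvdXsubC_real_split _ _ sp): am; apply: count_uniq.
have aE : \val (frame_point s) = 1 *: fr_pt F s by rewrite scale1r.
by exists (frame_point s); apply/(point_mult_ge2P (\val P) (oner_neq0 R) aE)/(dvdXsubC_real_split _ _ sp).
Qed.

(** A line of multiplicity 2 that is the only one shared: t occurs twice in
    rs and no other number does. *)
Lemma single_double_lineP : single_double_line B Q P <-> exists t, perm_eq rs [:: t; t].
Proof.
split=> [[a [a2 a3 ab]]|[t pt]].
  have [t [l [l0 aE]]] := line_mult_ge_point Pb (isT : (0 < 2)%N) a2.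
  exists t; have rst : all (pred1 t) rs.
    apply/allP => s srs /=; have : proportional (fun v : nzvec R => \val v) a (frame_point s).
      by apply: ab; apply/line_mult_frame_point; rewrite -has_count has_pred1.
    by move=> /asboolP[c c0]; rewrite aE scalerA => /fr_pt_inj ->.
  have c2 : count_mem t rs = 2%N.
    apply/eqP; rewrite eqn_leq; apply/andP; split; last exact/(line_mult_count _ l0 aE).
    by rewrite leqNgt; apply/negP => c3; apply: a3; apply/(line_mult_count _ l0 aE).
  have -> : rs = nseq 2 t by rewrite -c2 (all_pred1P _ _ rst) count_nseq /= eqxx mul1n.
  by [].
have cE s : count_mem s rs = count_mem s [:: t; t] by apply/seq.permP.
exists (frame_point t); split.
- by apply/line_mult_frame_point; rewrite cE /= eqxx.
- by move/line_mult_frame_point; rewrite cE /= eqxx.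
- move=> b b1; have [s [l [l0 bE]]] := line_mult_ge_point Pb (isT : (0 < 1)%N) b1.
  move/(line_mult_count _ l0 bE): b1; rewrite cE /= addn0.
  by case: (t =P s) => // ts _; apply/asboolP; exists l; rewrite // bE ts.
Qed.

End OneFrame.

Lemma near_off (F : conic_frame Q) P : evalp (\val P : form R k) (fr_b F) != 0 ->
  \forall P' \near P, evalp (\val P' : form R k) (fr_b F) != 0.
Proof.
have top P' : evalp (\val P' : form R k) (fr_b F) = (restr F (\val P' : form R k))`_(2 * k).
  by have [_ ->] := restr_top F (dhomog_is_dhomog (\val P')).
move=> Pb; have hn : \forall P' \near P, (restr F (\val P' : form R k))`_(2 * k) != 0.
  apply: near_neq0; last by rewrite -top.
  have := @restr_coef_cts R Q F k _ P (fun P' : VQperp0 B Q => \val P') (2 * k)%N (@val_perp_cts R k B Q P).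
  by apply.
by apply: (@filterS _ _ (nbhs_filter P) _ _ _ hn) => P'; rewrite top.
Qed.

(** A neighbourhood on which all fibers have n elements contains an open
    one. *)
Lemma unramified n P : nbhs P [set P' | has_card n (Phi @^-1` [set P'])] ->
  ~ ramification_set Phi P.
Proof.
rewrite nbhsE => -[U [oU UP] hU] ram; apply: (ram U) => // P1 P2 /hU h1 /hU h2.
exact: has_card_eq h1 h2.
Qed.

Lemma discZ c (q : {poly R}) : disc (c *: q) = c ^+ 2 * disc q.
Proof. by rewrite /disc !coefZ; ring. Qed.

Lemma vdiscZ (F : conic_frame Q) c v : vdisc F (c *: v) = c ^+ 2 * vdisc F v.
Proof. by rewrite /vdisc linear_formZ restrZ discZ. Qed.

Lemma vdisc_entry_cts (F : conic_frame Q) A i :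
  {for A, continuous (fun A' : vectors R k => vdisc F (\val (A' i)))}.
Proof. by apply: vdisc_cts; apply: vec_cts_entry. Qed.

Lemma near_vdisc_lt0 (F : conic_frame Q) A i : vdisc F (\val (A i)) < 0 ->
  \forall A' \near A, vdisc F (\val (A' i)) < 0.
Proof.
move=> h; have hn : \forall A' \near A, 0 < -1 * vdisc F (\val (A' i)).
  apply: near_gt0; last by rewrite mulN1r oppr_gt0.
  by apply: ctsM; [apply: cts_cst|apply: vdisc_entry_cts].
by apply: (@filterS _ _ (nbhs_filter A) _ _ _ hn) => A'; rewrite mulN1r oppr_gt0.
Qed.

Lemma near_vdisc_gt0 (F : conic_frame Q) A i : 0 < vdisc F (\val (A i)) ->
  \forall A' \near A, 0 < vdisc F (\val (A' i)).
Proof. by move=> h; apply: near_gt0 => //; apply: vdisc_entry_cts. Qed.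

(** Passing to unordered classes is an open map. *)
Lemma class_image_open (W : set (vectors R k)) : (forall A, W A -> nbhs A W) ->
  open (@sym_class R k @` W).
Proof.
move=> hW; apply: open_nbhs_all => _ [A WA <-]; apply: open_map_nbhs; first exact: sym_class_open_map.
by apply: (@filterS _ _ (nbhs_filter A) _ _ _ (hW A WA)) => A' WA'; exists A'.
Qed.

(** Apply the closedness of Psi to the open set of the classes of members
    of W. *)
Lemma fiber_condition (W : set (vectors R k)) P : (forall A, W A -> nbhs A W) ->
  (forall A, Phi (\pi_(multipole R k) A) = P -> W A) ->
  \forall P' \near P, forall m, Phi m = P' -> exists2 A, W A & sym_class A = proj m.
Proof.
move=> hW PW.
have [|y|U [[oU UP] hU]] := @closed_map_fiber _ _ Psi (ppi P) (@sym_class R k @` W)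
  (@Sym_compact R k) (@RP_VQperp_hausdorff _ _ B Q) _ (class_image_open hW).
- by move=> y; apply: Psi_cts.
- move=> /(Psi_fiberP _ k_gt0)[m -> mP]; exists (repr m) => //.
  by apply: PW; rewrite reprK.
have hn : nbhs P (ppi @^-1` U) by apply: ppi_cts; apply: open_nbhs_nbhs; split.
apply: (@filterS _ _ (nbhs_filter P) _ _ _ hn) => P' UP' m mP'.
have [A WA AE] : (@sym_class R k @` W) (proj m) by apply: hU; rewrite Psi_proj mP'.
by exists A.
Qed.

Lemma restr_param_scale (F : conic_frame Q) A m P : Phi m = P -> sym_class A = proj m ->
  exists2 c, c != 0 & restr F (prod_form A) = c *: restr F (\val P : form R k).
Proof.
move=> /(Phi_restrP _ F) <- /esym/sym_class_eqP[c c0 e]; exists c => //.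
by rewrite e -restrZ.
Qed.

Lemma real_splitZ c (f : {poly R}) rs h : c != 0 -> real_split f rs h -> real_split (c *: f) rs (c *: h).
Proof. by move=> c0 [-> hr]; split=> [|x]; [rewrite scalerAr|rewrite rootZ]. Qed.

(** A quadratic polynomial whose discriminant vanishes is proportional to a
    square. *)
Lemma double_root_vdisc0 (F : conic_frame Q) A i : size (restr F (linear_form (\val (A i)))) = 3%N ->
  vdisc F (\val (A i)) = 0 -> exists r, divides (('X - r%:P) ^+ 2) (restr F (prod_form A)).
Proof.
move=> s3 d0; have [|r [s [qE rs]]] := disc_ge0_split s3; first by rewrite -/(vdisc _ _) d0.
move: rs qE; rewrite -/(vdisc _ _) d0 eqxx => /eqP <- qE; exists r.
rewrite -[X in restr F X]/(\prod_i linear_form (\val (A i))) restr_prod (bigD1 i) //= qE.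
by rewrite -expr2 -scalerAl scalerAr; eexists.
Qed.

(** At P, no discriminant of a factor vanishes and exactly m of them are
    positive, for each factorization. Both properties persist nearby; hence a
    nearby P' has 2 m real roots counted with multiplicity. They are simple: with
    a double root t, the polynomial would have a factorization containing
    (X - t)^2, whose discriminant vanishes. *)
Lemma near_card_uniq (F : conic_frame Q) P rs h : evalp (\val P : form R k) (fr_b F) != 0 ->
  real_split (restr F (\val P : form R k)) rs h -> uniq rs ->
  exists n, nbhs P [set P' | has_card n (Phi @^-1` [set P'])].
Proof.
move=> Pb sp urs; have [m srs] := real_split_even Qirr k_gt0 Pb sp; exists (double_fact m).
pose W : set (vectors R k) := [set A | (forall i, vdisc F (\val (A i)) != 0) /\
  #|[pred i | (0 <= vdisc F (\val (A i)))%R]| = m].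
have hW A : W A -> nbhs A W.
  move=> [A0 Am]; have hn : nbhs A [set A' : vectors R k | forall i,
      vdisc F (\val (A' i)) != 0 /\ (0 <= vdisc F (\val (A' i))) = (0 <= vdisc F (\val (A i)))].
    apply: (@nbhs_forall {ptws 'I_k -> nzvec R} k A (fun i => [set A' : vectors R k |
      vdisc F (\val (A' i)) != 0 /\ (0 <= vdisc F (\val (A' i))) = (0 <= vdisc F (\val (A i)))])) => i.
    have [d0|d0|d0] := ltgtP 0 (vdisc F (\val (A i))).
    - by apply: (@filterS _ _ (nbhs_filter A) _ _ _ (near_vdisc_gt0 d0)) => A' d'; rewrite /= gt_eqF ?ltW.
    - by apply: (@filterS _ _ (nbhs_filter A) _ _ _ (near_vdisc_lt0 d0)) => A' d'; rewrite /= lt_eqF // leNgt d'.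
    - by have := A0 i; rewrite -d0 eqxx.
  apply: (@filterS _ _ (nbhs_filter A) _ _ _ hn) => A' hA'; split=> [i|]; first by case: (hA' i).
  by rewrite -Am; apply: eq_card => i; rewrite !inE; case: (hA' i).
have PW A : Phi (\pi_(multipole R k) A) = P -> W A.
  move=> /(Phi_restrP _ F); rewrite param_pi => e.
  have s3 := size_prod_form_restr Qirr e (size_restr_off Pb).
  have [rs' [h' [sp' srs']]] := prod_form_real_split s3; rewrite e in sp'.
  split=> [i|]; last first.
    by move: srs'; rewrite -(perm_size (real_split_uniq sp sp')) srs => /eqP; rewrite eqn_mul2l /= => /eqP.
  apply/eqP => /(double_root_vdisc0 (s3 i))[r]; rewrite e => /(dvdXsubC_real_split _ _ sp) /count_uniq.
  by rewrite urs.
have near1 := fiber_condition hW PW; have near2 := near_off Pb.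
apply: (@filterS _ _ (nbhs_filter P) _ _ _ (@filterI _ _ (nbhs_filter P) _ _ near1 near2)) => P' [hP' P'b] /=.
have sf := size_restr_off P'b.
have [rs' [h' sp']] : exists rs h, real_split (restr F (\val P' : form R k)) rs h.
  by apply: exists_real_split; rewrite -size_poly_gt0 sf.
have srs' : size rs' = (2 * m)%N.
  have [m' mP'] := Phi_surj Qirr k_gt0 P'; have [A [_ Am] Ae] := hP' m' mP'.
  have [c c0 e] := restr_param_scale F mP' Ae.
  have s3 := size_prod_form_restr Qirr e (etrans (size_scale _ c0) sf).
  have [rs'' [h'' [sp'' srs'']]] := prod_form_real_split s3; rewrite e in sp''.
  by rewrite (perm_size (real_split_uniq (real_splitZ c0 sp') sp'')) srs'' Am.
apply: (card_Phi_uniq Qirr k_gt0 P'b sp') => //.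
apply: contraT => /uniq_count[t] /(dvdXsubC_real_split _ _ sp')[g gE].
have g0 : g != 0 by apply/eqP => g0; move: sf; rewrite gE g0 mulr0 size_poly0.
have X2 : size (('X - t%:P) ^+ 2) = 3%N by rewrite size_exp_XsubC.
have sg : (size g <= (2 * k.-1).+1)%N.
  have := sf; rewrite gE size_mul ?expf_neq0 ?polyXsubC_eq0 // X2.
  by move: (size g) k_gt0 => n; lia.
have [c [vs [c0 svs vs0 e]]] := indefinite_factorization F g0 sg.
pose v0 := vec_of_poly F (('X - t%:P) ^+ 2).
have v0E : restr F (linear_form v0) = ('X - t%:P) ^+ 2 by rewrite restr_vec_of_poly // X2.
have v00 : v0 != 0.
  by apply/eqP => v00; move: X2; rewrite -v0E v00 linear_form0 restr0 size_poly0.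
have [||A' A'E] := @vectors_of_seq R k (c *: v0 :: vs); first by rewrite /= svs prednK.
  by rewrite /= scaler_eq0 negb_or c0 v00.
have A'P : Phi (\pi_(multipole R k) A') = P'.
  apply/(Phi_restrP _ F); rewrite param_pi prod_formE A'E big_cons restrM linear_formZ restrZ v0E gE -e restrZ.
  by rewrite -scalerAl scalerAr.
have [A'' [A''0 _] A''E] := hP' _ A'P; rewrite proj_pi in A''E.
have [s sE] := sym_class_factors (esym A''E).
have : c *: v0 \in vecs A' by rewrite A'E mem_head.
move=> /mapP[i0 _ i0E]; have [d d0] := sE (s^-1%g i0); rewrite permKV -i0E => A''i.
have := A''0 (s^-1%g i0); rewrite A''i !vdiscZ /vdisc v0E.
have -> : ('X - t%:P) ^+ 2 = 1 *: (('X - t%:P) * ('X - t%:P)) by rewrite scale1r expr2.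
by rewrite disc_split subrr expr0n /= !mulr0 eqxx.
Qed.

(** Exactly one factor of each factorization of P is not elliptic, namely
    the one restricting to a multiple of (X - t)^2. So nearby factorizations have
    at most one non-elliptic factor, which makes them unique. *)
Lemma near_card_single (F : conic_frame Q) P rs h t : evalp (\val P : form R k) (fr_b F) != 0 ->
  real_split (restr F (\val P : form R k)) rs h -> perm_eq rs [:: t; t] ->
  nbhs P [set P' | has_card 1 (Phi @^-1` [set P'])].
Proof.
move=> Pb sp rst.
pose W : set (vectors R k) := [set A | forall i j, i != j ->
  vdisc F (\val (A i)) < 0 \/ vdisc F (\val (A j)) < 0].
have hW A : W A -> nbhs A W.
  move=> hA; have hn : nbhs A [set A' : vectors R k | forall i,
      vdisc F (\val (A i)) < 0 -> vdisc F (\val (A' i)) < 0].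
    apply: (@nbhs_forall {ptws 'I_k -> nzvec R} k A (fun i => [set A' : vectors R k |
      vdisc F (\val (A i)) < 0 -> vdisc F (\val (A' i)) < 0])) => i.
    case: (ltP (vdisc F (\val (A i))) 0) => d0.
      by apply: (@filterS _ _ (nbhs_filter A) _ _ _ (near_vdisc_lt0 d0)) => A' /=.
    by apply: (@filterS _ _ (nbhs_filter A) setT) => //; apply: filterT.
  apply: (@filterS _ _ (nbhs_filter A) _ _ _ hn) => A' hA' i j /hA[/hA'|/hA'] d; by [left|right].
have PW A : Phi (\pi_(multipole R k) A) = P -> W A.
  move=> /(Phi_restrP _ F); rewrite param_pi => e.
  have s3 := size_prod_form_restr Qirr e (size_restr_off Pb).
  have [rs' [h' [sp' srs']]] := prod_form_real_split s3; rewrite e in sp'.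
  move: srs'; rewrite -(perm_size (real_split_uniq sp sp')) (perm_size rst) => c2 i j ij.
  case: (ltP (vdisc F (\val (A i))) 0) => di; first by left.
  case: (ltP (vdisc F (\val (A j))) 0) => dj; first by right.
  have /card_le1_eqP c1 : (#|[pred i | (0 <= vdisc F (\val (A i)))%R]| <= 1)%N.
    by rewrite -(@leq_pmul2l 2) // -c2.
  by move/eqP: ij; case; apply: c1; rewrite inE.
apply: (@filterS _ _ (nbhs_filter P) _ _ _ (fiber_condition hW PW)) => P' hP' /=.
have [m' mP'] := Phi_surj Qirr k_gt0 P'; have [A WA Ae] := hP' m' mP'.
have [s sE] := sym_class_factors (A' := repr m') Ae.
apply: (card_Phi_elliptic (A := repr m')); first by rewrite reprK.
have ell i : vdisc F (\val (A (s i))) < 0 -> elliptic Q (\val (repr m' i)).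
  by have [c c0 ->] := sE i; move=> /elliptic_vdisc; apply: ellipticZ.
move=> i j ij; have [|d|d] := WA (s i) (s j); first by rewrite (inj_eq perm_inj).
  by left; apply: ell.
by right; apply: ell.
Qed.

(** Nearby P1 is obtained by separating the 2 m real roots, and P2 by
    replacing (X - t)^2 by (X - t)^2 + e^2 and separating the others. Their fibers
    have (2 m - 1)!! and (2 m - 3)!! elements, and m > 1 because t, t are not all
    the real roots. *)
Lemma ramified (F : conic_frame Q) P rs h : evalp (\val P : form R k) (fr_b F) != 0 ->
  real_split (restr F (\val P : form R k)) rs h -> ~~ uniq rs ->
  ~ (exists t, perm_eq rs [:: t; t]) -> ramification_set Phi P.
Proof.
move=> Pb sp /uniq_count[t t2] nst U [oU UP] hU.
have PU : nbhs P U by apply: open_nbhs_nbhs.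
have [rs' rsE] : exists rs', perm_eq rs [:: t, t & rs'].
  have trs : t \in rs by rewrite -has_pred1 has_count (ltn_trans _ t2).
  have trs' : t \in rem t rs by rewrite -has_pred1 has_count count_rem trs /= eqxx subn_gt0.
  exists (rem t (rem t rs)); apply: (perm_trans (perm_to_rem trs)).
  by rewrite perm_cons perm_to_rem.
have [m srs] := real_split_even Qirr k_gt0 Pb sp.
have [P1 [rs1 [h1 [UP1 P1b sp1 urs1 srs1]]]] := perturb_roots PU Pb sp.1
  (@poly_cts_cst _ _ _ h) (fun=> erefl) (fun _ x _ => sp.2 x).
have c1 := card_Phi_uniq Qirr k_gt0 P1b sp1 urs1 (etrans srs1 srs).
(* The double root t leaves the real axis as the pair t + i e, t - i e. *)
pose q e : {poly R} := ('X - t%:P) ^+ 2 + (e ^+ 2)%:P.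
have sq e : size (q e) = 3%N.
  by rewrite /q size_addl size_exp_XsubC // (leq_ltn_trans (size_polyC_leq1 _)).
have h0 : h != 0 by apply/eqP => h0; have := sp.2 0; rewrite h0 root0.
have [||e|e x e0|P2 [rs2 [h2 [UP2 P2b sp2 urs2 srs2]]]] := @perturb_roots _ _ _ _ F P U rs' (fun e => q e * h) PU Pb.
- case: sp => -> _; rewrite (perm_big _ rsE) /= !big_cons /q expr0n addr0 expr2; ring.
- apply: poly_ctsM; last exact: poly_cts_cst.
  apply: poly_ctsD; first exact: poly_cts_cst.
  by apply: poly_cts_const; apply: cts_sqr; apply: cvg_id.
- by rewrite !size_mul ?sq // -size_poly_gt0 sq.
- rewrite rootM (negbTE (sp.2 x)) orbF; apply/negP => /rootP.
  rewrite /q hornerD hornerC horner_exp hornerXsubC => q0.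
  by have := sqr_ge0 (x - t); have : 0 < e ^+ 2 by [rewrite exprn_gt0]; lra.
have rs'0 : rs' <> [::] by move=> rs'0; apply: nst; exists t; rewrite -rs'0.
have srs' : ((size rs').+2 = 2 * m)%N by rewrite -srs (perm_size rsE).
case: m srs srs' c1 => [|m] // srs srs' c1.
have {}srs' : size rs' = (2 * m)%N by move: srs'; rewrite mulnS => -[].
have c2 := card_Phi_uniq Qirr k_gt0 P2b sp2 urs2 (etrans srs2 srs').
have := has_card_inj c1 c2 (hU _ _ UP1 UP2); rewrite double_factS => /eqP.
rewrite -[X in _ == X]mul1n eqn_mul2r (gtn_eqF (double_fact_gt0 m)) /= eqSS muln_eq0 /= => /eqP m0.
by apply: rs'0; apply: size0nil; rewrite srs' m0.
Qed.

(** In a frame adapted to P the cases are: simple real roots, one double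
    root only, and the rest. *)
Theorem ramification_discriminant : ~ definite Q ->
  ramification_set Phi = discriminant B Q `\` single_double_line B Q.
Proof.
move=> nQ; apply/seteqP; split=> P.
  have [F Pb] := exists_frame_off Qirr nQ (@VQperp0_ndivides _ _ _ _ P).
  have [rs [h sp]] : exists rs h, real_split (restr F (\val P : form R k)) rs h.
    by apply: exists_real_split; rewrite -size_poly_gt0 (size_restr_off Pb).
  move=> ram; split.
    apply/(discriminantP Pb sp)/negP => urs.
    by have [n hn] := near_card_uniq Pb sp urs; apply: (unramified hn).
  by move=> /(single_double_lineP Pb sp)[t rst]; apply: (unramified (near_card_single Pb sp rst)).
have [F Pb] := exists_frame_off Qirr nQ (@VQperp0_ndivides _ _ _ _ P).
have [rs [h sp]] : exists rs h, real_split (restr F (\val P : form R k)) rs h.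
  by apply: exists_real_split; rewrite -size_poly_gt0 (size_restr_off Pb).
move=> [/(discriminantP Pb sp) nu ns]; apply: (ramified Pb sp nu) => st.
exact/ns/(single_double_lineP Pb sp).
Qed.

Theorem discriminant_eq_curves : ~ definite Q -> discriminant B Q = discriminant_curves B Q.
Proof.
move=> nQ; apply/funext => P; apply/propext.
have [F Pb] := exists_frame_off Qirr nQ (@VQperp0_ndivides _ _ _ _ P).
have [rs [h sp]] : exists rs h, real_split (restr F (\val P : form R k)) rs h.
  by apply: exists_real_split; rewrite -size_poly_gt0 (size_restr_off Pb).
by rewrite (discriminantP Pb sp) (discriminant_curvesP Pb sp).
Qed.

End Ramification.

(** * Algebraic dependence *)

Section PolynomialFunctions.
Variables (R : realType) (n : nat).

Definition polyfun (f : ('I_n -> R) -> R) := exists T : mpoly n R, forall u, f u = meval u T.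

Lemma polyfun_cst c : polyfun (fun=> c).
Proof. by exists (mpolyC n c) => u; rewrite mevalC. Qed.

Lemma polyfun_var i : polyfun (fun u => u i).
Proof. by exists (mpolyX R (mnm1 i)) => u; rewrite mevalXU. Qed.

Lemma polyfunD f g : polyfun f -> polyfun g -> polyfun (fun u => f u + g u).
Proof. by move=> [S hS] [T hT]; exists (S + T) => u; rewrite mevalD hS hT. Qed.

Lemma polyfunM f g : polyfun f -> polyfun g -> polyfun (fun u => f u * g u).
Proof. by move=> [S hS] [T hT]; exists (S * T) => u; rewrite mevalM hS hT. Qed.

Lemma polyfun_sum I (r : seq I) (F : I -> ('I_n -> R) -> R) : (forall i, polyfun (F i)) ->
  polyfun (fun u => \sum_(i <- r) F i u).
Proof.
move=> h; elim: r => [|i r IH].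
  by exists 0 => u; rewrite big_nil meval0.
have [T hT] := polyfunD (h i) IH; exists T => u; rewrite big_cons; exact: hT.
Qed.

Lemma polyfun_prod I (r : seq I) (F : I -> ('I_n -> R) -> R) : (forall i, polyfun (F i)) ->
  polyfun (fun u => \prod_(i <- r) F i u).
Proof.
move=> h; elim: r => [|i r IH].
  by exists 1 => u; rewrite big_nil meval1.
have [T hT] := polyfunM (h i) IH; exists T => u; rewrite big_cons; exact: hT.
Qed.

Lemma polyfunX f e : polyfun f -> polyfun (fun u => f u ^+ e).
Proof.
move=> h; elim: e => [|e IH]; first by exists 1 => u; rewrite meval1.
have [T hT] := polyfunM h IH; exists T => u; rewrite exprS; exact: hT.
Qed.

Lemma polyfun_comp N (P : mpoly N R) (g : 'I_N -> ('I_n -> R) -> R) : (forall i, polyfun (g i)) ->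
  polyfun (fun u => meval (fun i => g i u) P).
Proof.
move=> h; have [T hT] : polyfun (fun u => \sum_(m <- msupp P) mcoeff m P * \prod_i g i u ^+ m i).
  apply: polyfun_sum => m; apply: polyfunM; first exact: polyfun_cst.
  by apply: polyfun_prod => i; apply: polyfunX.
by exists T => u; rewrite mevalE.
Qed.

End PolynomialFunctions.

Lemma msizeM_bound (R : idomainType) n (p q : mpoly n R) d e :
  (msize p <= d.+1)%N -> (msize q <= e.+1)%N -> (msize (p * q) <= (d + e).+1)%N.
Proof.
have [->|p0] := eqVneq p 0; first by rewrite mul0r msize0.
have [->|q0] := eqVneq q 0; first by rewrite mulr0 msize0.
by rewrite msizeM //; lia.
Qed.

Lemma msizeX_bound (R : idomainType) n (p : mpoly n R) d e :
  (msize p <= d.+1)%N -> (msize (p ^+ e) <= (e * d).+1)%N.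
Proof.
move=> h; elim: e => [|e IH]; first by rewrite expr0 msize1.
by rewrite exprS mulSn; apply: msizeM_bound.
Qed.

Lemma msize_prod_bound (R : idomainType) n I (r : seq I) (p : I -> mpoly n R) d :
  (forall i, msize (p i) <= d.+1)%N -> (msize (\prod_(i <- r) p i)%R <= (size r * d).+1)%N.
Proof.
move=> h; elim: r => [|i r IH]; first by rewrite big_nil msize1.
by rewrite big_cons mulSn; apply: msizeM_bound.
Qed.

(** Each exponent is bounded by the degree. *)
Lemma card_bmultinom n L : (#|{: bmultinom n L.+1}| <= L.+1 ^ n)%N.
Proof.
pose f (m : bmultinom n L.+1) : {ffun 'I_n -> 'I_L.+1} := [ffun i => inord ((m : multinom n) i)].
have fi : injective f.
  move=> m m' e; apply: val_inj; apply/mnmP => i.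
  have bd (p : bmultinom n L.+1) : ((p : multinom n) i < L.+1)%N.
    apply: leq_ltn_trans (bmdeg p); rewrite mdegE (bigD1 i) //=; exact: leq_addr.
  by have := congr1 (fun g : {ffun 'I_n -> 'I_L.+1} => val (g i)) e; rewrite /= !ffunE !inordK ?bd.
by have := leq_card f fi; rewrite card_ffun !card_ord.
Qed.

(** Counting monomials: if the T j have degree at most D, the M^(n + 1)
    monomials in them with exponents below M lie in the space of polynomials of
    degree less than L, where L = (n + 1) M D + 1, of dimension at most L^n. As L
    is at most c M for a constant c, taking M = c^n + 1 makes the number of
    monomials exceed the dimension. *)
Lemma algebraic_dependence (R : realType) n (T : 'I_n.+1 -> mpoly n R) :
  exists2 G : mpoly n.+1 R, G != 0 & forall u, meval (fun j => meval u (T j)) G = 0.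
Proof.
pose D := (\max_j msize (T j))%N; have TD j : (msize (T j) <= D.+1)%N.
  by apply: leqW; apply: (@leq_bigmax _ (fun j => msize (T j))).
pose c := (n.+1 * D).+1; pose M := (c ^ n).+1; pose L := (n.+1 * (M * D)).+1.
have LM : (L ^ n < M ^ n.+1)%N.
  have LcM : (L <= c * M)%N by rewrite /L /c; nia.
  have : (L ^ n <= (c * M) ^ n)%N by case: (n) => [|n']; rewrite ?expn0 // leq_exp2r.
  by move=> /leq_ltn_trans; apply; rewrite expnMn expnS ltn_pmul2r ?expn_gt0.
pose I := {ffun 'I_n.+1 -> 'I_M}; pose J := bmultinom n L.
pose mon (e : I) : mpoly n R := \prod_j T j ^+ e j.
have mon_size e : (msize (mon e) <= L)%N.
  have := @msize_prod_bound R n 'I_n.+1 (enum 'I_n.+1) (fun j => T j ^+ e j) (M * D).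
  rewrite size_enum_ord big_enum; apply => j.
  apply: (leq_trans (msizeX_bound (e j) (TD j))); rewrite ltnS leq_mul2r (ltnW (ltn_ord (e j))) orbT //.
(* The rows of A are the monomials in the T j; a row vector in its kernel is a relation. *)
pose A : 'M[R]_(#|{: I}|, #|{: J}|) := \matrix_(i, j) mcoeff (enum_val j : J) (mon (enum_val i)).
have : kermx A != 0.
  rewrite kermx_eq0 -row_leq_rank -ltnNge; apply: (leq_ltn_trans (rank_leq_col _)).
  have -> : #|{: I}| = (M ^ n.+1)%N by rewrite card_ffun !card_ord.
  exact: (leq_ltn_trans (card_bmultinom n (n.+1 * (M * D))) LM).
case/rowV0Pn => v /sub_kermxP vA v0.
pose mm (e : I) : multinom n.+1 := Multinom (mktuple (fun j => nat_of_ord (e j))).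
have mm_inj : injective mm.
  move=> e e' /(congr1 (fun m : multinom n.+1 => m : 'I_n.+1 -> nat)) h.
  apply/ffunP => j; apply: val_inj; have := congr1 (fun f => f j) h.
  by rewrite /= !mnmE.
pose w (e : I) := v 0 (enum_rank e).
pose G : mpoly n.+1 R := \sum_(e : I) w e *: mpolyX R (mm e).
exists G.
  have [i vi] : exists i, v 0 i != 0.
    apply: contrapT => h; move/eqP: v0; apply; apply/rowP => i; rewrite mxE.
    by apply/eqP; apply: contrapT => /negP hi; apply: h; exists i.
  apply: contraNneq vi => G0; have := congr1 (mcoeff (mm (enum_val i))) G0.
  rewrite mcoeff0 raddf_sum (bigD1 (enum_val i)) //= mcoeffZ mcoeffX eqxx mulr1 /w enum_valK.
  by rewrite big1 ?addr0 => [->//|e ne]; rewrite mcoeffZ mcoeffX (inj_eq mm_inj) (negbTE ne) mulr0.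
have rel : \sum_(e : I) w e *: mon e = 0.
  have sz : (msize (\sum_(e : I) w e *: mon e)%R <= L)%N.
    apply: (leq_trans (msize_sum _ _ _)); apply/bigmax_leqP => e _.
    exact: leq_trans (msizeZ_le _ _) (mon_size e).
  rewrite (mpolywE sz) big1 // => m _.
  have := congr1 (fun B : 'rV_ _ => B 0 (enum_rank m)) vA; rewrite !mxE => e.
  suff -> : mcoeff m (\sum_(e : I) w e *: mon e) = 0 by rewrite scale0r.
  rewrite raddf_sum -[RHS]e (reindex (enum_val : 'I_#|{: I}| -> I)) /=; last first.
    by apply: onW_bij; apply: enum_val_bij.
  by apply: eq_bigr => i _; rewrite mcoeffZ mxE enum_rankK /w enum_valK.
move=> u; have := congr1 (meval u) rel; rewrite meval0 raddf_sum /= => e.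
rewrite -[RHS]e raddf_sum /=; apply: eq_bigr => f _.
rewrite !mevalZ mevalX rmorph_prod /=; congr (_ * _); apply: eq_bigr => j _.
by rewrite rmorphXn /= mnmE.
Qed.

Lemma poly_eq0_small (R : realType) (p : {poly R}) d : 0 < d ->
  (forall e, 0 < e -> e < d -> p.[e] = 0) -> p = 0.
Proof.
move=> d0 h; apply/eqP; apply: contraT => p0.
pose s : seq R := [seq d / i.+2%:R | i <- iota 0 (size p)].
have us : uniq s.
  rewrite map_inj_uniq ?iota_uniq // => i j /(mulfI (lt0r_neq0 d0)) /invr_inj /eqP.
  by rewrite eqr_nat => /eqP[].
have al : all (root p) s.
  apply/allP => _ /mapP[i _ ->]; apply/rootP/h; first by rewrite divr_gt0.
  by rewrite ltr_pdivrMr ?ltr0n // ltr_pMr // ltr1n.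
by have := max_poly_roots p0 al us; rewrite size_map size_iota ltnn.
Qed.

(** * Codimension of the discriminant *)

Section Codimension.
Variables (R : realType) (k : nat) (B : {dot (form R k) for idfun}) (Q : form R 2).
Hypotheses (Qirr : irreducible_over_C Q) (k_gt0 : (0 < k)%N).
Variable F : conic_frame Q.
Local Notation lift := (frame_lift B F).
Local Notation N := (\dim {: form R k}).

Lemma polyfun_lift n (f : ('I_n -> R) -> {poly R}) (T : mpoly N R) :
  (forall j, polyfun (fun u => (f u)`_j)) -> polyfun (fun u => poly_function T (lift (f u))).
Proof.
move=> hf; apply: polyfun_comp => i.
have [S hS] : polyfun (fun u => \sum_(j < (2 * k).+1) (f u)`_j * coord (vbasis {: form R k}) i (lift_monomial B F j)).
  by apply: polyfun_sum => j; apply: polyfunM; [apply: hf|apply: polyfun_cst].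
exists S => u; rewrite -hS /frame_lift linear_sum; apply: eq_bigr => j _.
by rewrite linearZ.
Qed.

(** On the image of each parametrization the T j satisfy a relation; the
    product of the two relations holds on S. *)
Lemma dependent_on_images (S : set (form R k)) n (f g : ('I_n -> R) -> {poly R}) :
  (forall j, polyfun (fun u => (f u)`_j)) -> (forall j, polyfun (fun u => (g u)`_j)) ->
  (forall P, S P -> exists u, P = lift (f u) \/ P = lift (g u)) ->
  forall T : 'I_n.+1 -> mpoly N R, ~ alg_independent_on S T.
Proof.
move=> hf hg hS T ind.
have [Tf hTf] := boolp.choice (fun j => polyfun_lift (T j) hf).
have [Tg hTg] := boolp.choice (fun j => polyfun_lift (T j) hg).
have [G1 G10 hG1] := algebraic_dependence Tf; have [G2 G20 hG2] := algebraic_dependence Tg.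
have /eqP : G1 * G2 = 0.
  apply: ind => P /hS[u [->|->]]; rewrite mevalM.
    have -> : (fun i => poly_function (T i) (lift (f u))) = (fun j => meval u (Tf j)) by apply: funext.
    by rewrite hG1 mul0r.
  have -> : (fun i => poly_function (T i) (lift (g u))) = (fun j => meval u (Tg j)) by apply: funext.
  by rewrite hG2 mulr0.
by rewrite mulf_eq0 (negbTE G10) (negbTE G20).
Qed.

(** Coefficients of the restriction, as polynomial functions on the space
    of forms. *)
Definition frame_coef (j : nat) : mpoly N R :=
  \sum_(i < N) (restr F ((vbasis {: form R k})`_i : form R k))`_j *: mpolyX R (mnm1 i).

Lemma frame_coefE j (P : form R k) : poly_function (frame_coef j) P = (restr F P)`_j.
Proof.
rewrite /poly_function raddf_sum /=.
rewrite [in RHS](coord_vbasis (memvf P)) raddf_sum restr_sum coef_sum.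
by apply: eq_bigr => i _; rewrite mevalZ mevalXU /= restrZ coefZ mulrC.
Qed.

Definition positive_part (v : 'I_(2 * k) -> R) : {poly R} := \sum_(j < 2 * k) v j *: 'X^(j.+1).

Lemma coef_positive_part v (j : 'I_(2 * k)) : (positive_part v)`_j.+1 = v j.
Proof.
rewrite /positive_part coef_sum (bigD1 j) //= coefZ coefXn eqxx mulr1 big1 ?addr0 // => i ij.
by rewrite coefZ coefXn eqSS eq_sym val_eqE (negbTE ij) mulr0.
Qed.

Lemma size_positive_part v : (size (positive_part v) <= (2 * k).+1)%N.
Proof.
apply: (leq_trans (size_sum _ _ _)); apply/bigmax_leqP => j _.
by apply: (leq_trans (size_scale_leq _ _)); rewrite size_polyXn ltnS.
Qed.

(** A relation between the coefficients of positive degree holds on a short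
    segment that leaves f0 in an arbitrary direction, hence on the whole line:
    it holds everywhere and is trivial. *)
Lemma independent_of_directions (S : set (form R k)) (f0 : {poly R}) :
  (size f0 <= (2 * k).+1)%N ->
  (forall v, exists2 d, 0 < d & forall e, 0 < e -> e < d ->
     exists c0, S (lift (c0%:P + (f0 + e *: positive_part v)))) ->
  exists T : 'I_(2 * k) -> mpoly N R, alg_independent_on S T.
Proof.
move=> s0 hS; exists (fun j => frame_coef j.+1) => G hG.
apply: mpoly_eq0_of_meval => w; pose p (j : 'I_(2 * k)) := f0`_j.+1.
have [d d0 hd] := hS (fun j => w j - p j).
have [q hq] := meval_line G p (fun j => w j - p j).
have q0 : q = 0.
  apply: (poly_eq0_small d0) => e e0 ed; have [c0 /hG Sc] := hd e e0 ed.
  rewrite hq -[RHS]Sc; apply: meval_eq => j; rewrite frame_coefE restr_frame_lift.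
    by rewrite !coefD coefC coefZ coef_positive_part add0r.
  apply: (leq_trans (size_polyD _ _)); rewrite geq_max (leq_trans (size_polyC_leq1 _)) //=.
  apply: (leq_trans (size_polyD _ _)); rewrite geq_max s0 /=.
  exact: leq_trans (size_scale_leq _ _) (size_positive_part _).
have := hq 1; rewrite q0 horner0 => /esym e; rewrite -[RHS]e; apply: meval_eq => j.
by rewrite mul1r addrC subrK.
Qed.

(** Bounds, on the disc of radius two, for the perturbation and its derivative. *)
Definition part_norm (v : 'I_(2 * k) -> R) : R := \sum_(j < 2 * k) `|v j| * (j.+1%:R * 2 ^+ j.+1).

Lemma part_norm_ge0 v : 0 <= part_norm v.
Proof. by apply: sumr_ge0 => j _; rewrite !mulr_ge0 ?ler0n ?exprn_ge0. Qed.

Lemma horner_part_le v x : `|x| <= 2 -> `|(positive_part v).[x]| <= part_norm v.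
Proof.
move=> x2; rewrite /positive_part horner_sum; apply: (le_trans (ler_norm_sum _ _ _)).
apply: ler_sum => j _; rewrite hornerZ hornerXn normrM; apply: ler_wpM2l => //.
rewrite normrX; apply: (le_trans (_ : _ <= 2 ^+ j.+1)); first by rewrite lerXn2r ?nnegrE.
by rewrite ler_peMl ?exprn_ge0 // ler1n.
Qed.

Lemma horner_deriv_part_le v x : `|x| <= 2 -> `|(positive_part v)^`().[x]| <= part_norm v.
Proof.
move=> x2; rewrite /positive_part raddf_sum /= horner_sum; apply: (le_trans (ler_norm_sum _ _ _)).
apply: ler_sum => j _; rewrite derivZ derivXn hornerZ hornerMn hornerXn normrM; apply: ler_wpM2l => //.
rewrite normrMn normrX -[X in X <= _]mulr_natl /=; apply: ler_wpM2l; first exact: ler0n.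
apply: (le_trans (_ : _ <= 2 ^+ j)); first by rewrite lerXn2r ?nnegrE.
by rewrite exprS ler_peMl ?exprn_ge0 // ler1n.
Qed.

Lemma coef_part_le v j : `|(positive_part v)`_j| <= part_norm v.
Proof.
rewrite /positive_part coef_sum; apply: (le_trans (ler_norm_sum _ _ _)).
apply: ler_sum => i _; rewrite coefZ coefXn normrM; apply: ler_wpM2l => //.
have one : 1 <= i.+1%:R * 2 ^+ i.+1 :> R by rewrite mulr_ege1 ?ler1n // exprn_ege1 // ler1n.
by case: eqP => _; rewrite ?normr1 ?normr0 // (le_trans ler01).
Qed.

Lemma small_perturbation v : exists2 d, 0 < d & forall e, 0 < e -> e < d ->
  [/\ forall x, `|x| <= 2 -> `|(e *: positive_part v).[x]| <= 8^-1,
      forall x, `|x| <= 2 -> `|(e *: positive_part v)^`().[x]| <= 8^-1 &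
      forall j, `|(e *: positive_part v)`_j| <= 8^-1].
Proof.
pose C := part_norm v; have C0 : 0 <= C by apply: part_norm_ge0.
exists (8^-1 / (C + 1)); first by rewrite divr_gt0 ?ltr_wpDl // invr_gt0.
move=> e e0; rewrite ltr_pdivlMr ?ltr_wpDl // => ed.
have eC y : `|y| <= C -> `|e * y| <= 8^-1.
  move=> yC; rewrite normrM gtr0_norm //; apply: (le_trans _ (ltW ed)).
  by rewrite ler_pM2l // (le_trans yC) // lerDl.
split=> [x x2|x x2|j].
- by rewrite hornerZ eC ?horner_part_le.
- by rewrite derivZ hornerZ eC ?horner_deriv_part_le.
- by rewrite coefZ eC ?coef_part_le.
Qed.

Lemma double_root_divides (f : {poly R}) t : f.[t] = 0 -> f^`().[t] = 0 ->
  divides (('X - t%:P) ^+ 2) f.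
Proof.
move=> /rootP/factor_theorem[g ->]; rewrite derivM derivXsubC mulr1 hornerD hornerM hornerXsubC subrr mulr0 add0r.
by move=> /rootP/factor_theorem[g' ->]; exists g'; rewrite expr2 -mulrA mulrC.
Qed.

Lemma lift_neq0 (f : {poly R}) : (size f <= (2 * k).+1)%N -> f != 0 -> lift f != 0.
Proof. by move=> sf; apply: contra_neq => e; rewrite -(restr_frame_lift B F sf) e restr0. Qed.

Lemma lift_perp0 (f : {poly R}) : (size f <= (2 * k).+1)%N -> f`_(2 * k) != 0 ->
  exists P : VQperp0 B Q, [/\ \val P = lift f, restr F (\val P : form R k) = f &
    evalp (\val P : form R k) (fr_b F) != 0].
Proof.
move=> sf top; have f0 : f != 0 by apply: contraNneq top => ->; rewrite coef0.
have hP : lift f \in VQperp0 B Q.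
  by apply/mem_set; split; [apply: frame_lift_mem|apply: lift_neq0].
exists (exist (fun P => P \in VQperp0 B Q) _ hP); split=> //=; first exact: restr_frame_lift.
by have [_ <-] := restr_top F (dhomog_is_dhomog (lift f)); rewrite restr_frame_lift.
Qed.

End Codimension.

Section DiscriminantCodimension.
Variables (R : realType) (k : nat) (B : {dot (form R k) for idfun}) (Q : form R 2).
Hypotheses (Qirr : irreducible_over_C Q) (k_gt0 : (0 < k)%N) (nQ : ~ definite Q).
Local Notation Phi := (@Phi R k B Q Qirr).

Lemma disc_square (s c : R) : disc (('X - s%:P) ^+ 2 + c%:P) = - 4 * c.
Proof.
have e : ('X - s%:P) ^+ 2 + c%:P = 'X^2 - (2 * s) *: 'X + (s ^+ 2 + c)%:P.
  by apply: poly_ext => x; rewrite !hornerD hornerN hornerZ !hornerC horner_exp hornerXsubC hornerXn hornerX; ring.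
by rewrite /disc e !coefD !coefN !coefZ !coefX !coefXn !coefC /=; ring.
Qed.

(** Tangency of a line to the conic does not depend on the parametrization:
    a tangent line is a limit of elliptic ones without being elliptic. *)
Lemma tangent_frame_change (F F' : conic_frame Q) s :
  vdisc F (vec_of_poly F' (('X - s%:P) ^+ 2)) = 0.
Proof.
pose p (c : R) : {poly R} := ('X - s%:P) ^+ 2 + c%:P.
have sp c : (size (p c) <= 3)%N.
  apply: (leq_trans (size_polyD _ _)); rewrite geq_max size_exp_XsubC /=.
  by rewrite (leq_trans (size_polyC_leq1 _)).
pose v c := vec_of_poly F' (p c).
have dv c : vdisc F' (v c) = - 4 * c by rewrite /vdisc restr_vec_of_poly // disc_square.
have v0 : vec_of_poly F' (('X - s%:P) ^+ 2) = v 0 by rewrite /v /p addr0.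
have vc : vec_cts (0 : R) v.
  have pc : poly_cts (0 : R) p.
    apply: poly_ctsD; first exact: poly_cts_cst.
    by apply: poly_cts_const; apply: cvg_id.
  move=> i; have -> : (fun c => v c 0 i) = fun c => (p c)`_0 * fr_x F' 0 i + (p c)`_1 * fr_y F' 0 i + (p c)`_2 * fr_z F' 0 i.
    by apply: funext => c; rewrite !mxE.
  by apply: ctsD; [apply: ctsD|]; apply: ctsM; (try exact: pc); apply: cts_cst.
rewrite v0; apply/eqP; rewrite eq_le; apply/andP; split; rewrite leNgt; apply/negP.
  move=> /(near_gt0 (vdisc_cts (F := F) vc)) hn.
  have [d /= d0 hd] := (nbhs_ballP (0 : R) _).1 hn.
  have : 0 < vdisc F (v (d / 2)).
    apply: hd; rewrite /ball /= sub0r normrN gtr0_norm ?divr_gt0 //.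
    by rewrite ltr_pdivrMr // ltr_pMr // ltr1n.
  have /(elliptic_vdisc F) : elliptic Q (v (d / 2)).
    apply/(elliptic_vdisc F'); rewrite dv mulNr oppr_lt0 !mulr_gt0 ?invr_gt0 //.
  by move=> h1 h2; have := lt_trans h1 h2; rewrite ltxx.
by move=> /elliptic_vdisc /(elliptic_vdisc F'); rewrite dv mulr0 ltxx.
Qed.

Lemma tangent_restr (F : conic_frame Q) v : vdisc F v = 0 ->
  exists c a, restr F (linear_form v) = c *: ('X - a%:P) ^+ 2 \/ restr F (linear_form v) = c%:P.
Proof.
move=> d0; have sv := size_restr_linear F v.
have [s3|s3] := eqVneq (size (restr F (linear_form v))) 3.
  have [|r [s [qE rs]]] := disc_ge0_split s3; first by rewrite -/(vdisc _ _) d0.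
  move: rs qE; rewrite -/(vdisc _ _) d0 eqxx => /eqP <- qE.
  by eexists; exists r; left; rewrite expr2; exact: qE.
have s2 : (size (restr F (linear_form v)) <= 2)%N by rewrite -ltnS ltn_neqAle s3.
have q2 : (restr F (linear_form v))`_2 = 0 by rewrite nth_default.
have q1 : (restr F (linear_form v))`_1 = 0.
  by apply/eqP; rewrite -sqrf_eq0; move: d0; rewrite /vdisc /disc q2 mulr0 subr0 => ->.
exists (restr F (linear_form v))`_0, 0; right; apply: poly_ext => x.
by rewrite horner3 // q1 q2 hornerC !mul0r !addr0.
Qed.

(** In a frame F' adapted to P the restriction is a multiple of (t - s)^2,
    i.e. P is congruent modulo Q to the product of a linear form, tangent to the
    conic, and a form of degree k - 1. In the given frame F the tangent line
    restricts to a multiple of a square, or to a constant if it is the tangent at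
    infinity; only then does the degree drop by 2. *)
Lemma discriminant_cover (F : conic_frame Q) (P : VQperp0 B Q) : discriminant B Q P ->
  exists2 h : {poly R}, (size h <= (2 * k).-1)%N &
    (exists a, restr F (\val P : form R k) = ('X - a%:P) ^+ 2 * h) \/
    restr F (\val P : form R k) = h.
Proof.
have [F' Pb] := exists_frame_off Qirr nQ (@VQperp0_ndivides _ _ _ _ P).
have sf := size_restr_off Pb.
have [rs [h sp]] : exists rs h, real_split (restr F' (\val P : form R k)) rs h.
  by apply: exists_real_split; rewrite -size_poly_gt0 sf.
move=> /(discriminantP Pb sp)/uniq_count[s] /(dvdXsubC_real_split _ _ sp)[g gE].
have g0 : g != 0 by apply/eqP => g0; move: sf; rewrite gE g0 mulr0 size_poly0.
have sg : (size g <= (2 * k.-1).+1)%N.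
  have := sf; rewrite gE size_mul ?expf_neq0 ?polyXsubC_eq0 // size_exp_XsubC.
  by move: (size g) k_gt0 => n; lia.
have [H HE] := restr_lift F' sg.
pose v := vec_of_poly F' (('X - s%:P) ^+ 2).
have vE : restr F' (linear_form v) = ('X - s%:P) ^+ 2 by rewrite restr_vec_of_poly // size_exp_XsubC.
have hom' : linear_form v * (H : mpoly 3 R) \is @ishomog1 3 R (1 + k.-1) mdeg.
  by apply: dhomogM; [apply: linear_form_homog|apply: dhomog_is_dhomog].
have hom : linear_form v * (H : mpoly 3 R) \is @ishomog1 3 R k mdeg.
  by move: hom'; rewrite add1n prednK.
have fE : restr F (\val P : form R k) = restr F (linear_form v) * restr F H.
  rewrite -restrM; apply: restr_divides; apply: (restr_inj (F := F') (k := k)) => //.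
    exact: dhomog_is_dhomog.
  by rewrite restrM vE HE.
have [sH _] := restr_top F (dhomog_is_dhomog H).
have [c [a cE]] := tangent_restr (tangent_frame_change F F' s).
exists (c *: restr F H).
  apply: (leq_trans (size_scale_leq _ _)); apply: (leq_trans sH).
  by move: k_gt0; lia.
case: cE => cE; [left; exists a|right]; rewrite fE -/v cE.
  by rewrite -scalerAl scalerAr.
by rewrite mul_polyC.
Qed.

Definition pad n (u : 'I_n -> R) (i : nat) : R := if insub i is Some j then u j else 0.

Lemma polyfun_pad n i : polyfun (fun u : 'I_n -> R => pad u i).
Proof. by rewrite /pad; case: insubP => [j _ _|_]; [apply: polyfun_var|apply: polyfun_cst]. Qed.

Lemma padE n (u : nat -> R) i : (i < n)%N -> pad (fun j : 'I_n => u j) i = u i.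
Proof. by move=> ik; rewrite /pad insubT. Qed.

Definition cofactor (u : 'I_(2 * k) -> R) : {poly R} := \poly_(j < (2 * k).-1) pad u j.+1.

(** The first parameter is the root and the others are the coefficients of
    the cofactor. *)
Definition with_double_root (u : 'I_(2 * k) -> R) : {poly R} := ('X - (pad u 0)%:P) ^+ 2 * cofactor u.

Lemma polyfun_cofactor j : polyfun (fun u => (cofactor u)`_j).
Proof.
have [jk|jk] := ltnP j (2 * k).-1.
  have [T hT] := polyfun_pad (2 * k) j.+1; exists T => u; rewrite coef_poly jk; exact: hT.
by exists 0 => u; rewrite coef_poly ltnNge jk meval0.
Qed.

Lemma polyfun_coefM n (f g : ('I_n -> R) -> {poly R}) : (forall j, polyfun (fun u => (f u)`_j)) ->
  (forall j, polyfun (fun u => (g u)`_j)) -> forall j, polyfun (fun u => (f u * g u)`_j).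
Proof.
move=> hf hg j; have [T hT] : polyfun (fun u => \sum_(i < j.+1) (f u)`_i * (g u)`_(j - i)).
  by apply: polyfun_sum => i; apply: polyfunM.
by exists T => u; rewrite coefM.
Qed.

Lemma polyfun_with_double_root j : polyfun (fun u => (with_double_root u)`_j).
Proof.
apply: polyfun_coefM; last exact: polyfun_cofactor.
have h i : polyfun (fun u : 'I_(2 * k) -> R => ('X - (pad u 0)%:P)`_i).
  have [T hT] : polyfun (fun u : 'I_(2 * k) -> R => (i == 1%N)%:R + (- (i == 0%N)%:R) * pad u 0).
    apply: polyfunD; first exact: polyfun_cst.
    by apply: polyfunM; [apply: polyfun_cst|apply: polyfun_pad].
  exists T => u; rewrite -hT coefB coefX coefC; case: (i == 0%N); rewrite ?mulN1r ?oppr0 ?mul0r //.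
by move=> i; apply: (@polyfun_coefM _ _ _ h h i).
Qed.

(** The two families of the covering are parametrized by 2 k numbers each, more
    than the second one needs. *)
Lemma discriminant_dependent (F : conic_frame Q) (S : set (form R k)) : S `<=` set_val @` discriminant B Q ->
  forall T : 'I_(2 * k).+1 -> mpoly (\dim {: form R k}) R, ~ alg_independent_on S T.
Proof.
move=> SD; apply: (@dependent_on_images R k B Q F S (2 * k) with_double_root cofactor).
- exact: polyfun_with_double_root.
- exact: polyfun_cofactor.
move=> _ /SD[P /(discriminant_cover F)[h sh hE] <-].
have [hP _] := VQperp0P P; rewrite -[set_val P]/(\val P) -(frame_lift_restr F hP).
have hc a : cofactor (fun i => if i == 0%N :> nat then a else h`_i.-1) = h.
  apply/polyP => j; rewrite coef_poly; case: ltnP => jk; last by rewrite nth_default // (leq_trans sh).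
  by rewrite (@padE _ (fun i => if i == 0%N then a else h`_i.-1)) //; move: k_gt0 jk; lia.
case: hE => [[a aE]|hE].
  exists (fun i => if i == 0%N :> nat then a else h`_i.-1); left.
  rewrite /with_double_root hc aE (@padE _ (fun i => if i == 0%N then a else h`_i.-1)) //.
  by move: k_gt0; lia.
by exists (fun i => if i == 0%N :> nat then 0 else h`_i.-1); right; rewrite hc hE.
Qed.

(** Vertical translation turns a critical point into a double root. *)
Lemma critical_to_double (F : conic_frame Q) (g : {poly R}) t : (size g <= (2 * k).+1)%N ->
  g`_(2 * k) != 0 -> g^`().[t] = 0 ->
  exists (P : VQperp0 B Q) rs h, [/\ \val P = frame_lift B F ((- g.[t])%:P + g),
    evalp (\val P : form R k) (fr_b F) != 0,
    restr F (\val P : form R k) = (- g.[t])%:P + g,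
    real_split (restr F (\val P : form R k)) rs h & (1 < count_mem t rs)%N].
Proof.
move=> sg top gt; pose f := (- g.[t])%:P + g.
have sf : (size f <= (2 * k).+1)%N.
  by rewrite (leq_trans (size_polyD _ _)) // geq_max sg (leq_trans (size_polyC_leq1 _)).
have [|P [PE Pf Pb]] := lift_perp0 B F sf.
  by rewrite coefD coefC muln_eq0 /= eqn0Ngt k_gt0 add0r.
have [rs [h sp]] : exists rs h, real_split (restr F (\val P : form R k)) rs h.
  by apply: exists_real_split; rewrite -size_poly_gt0 (size_restr_off Pb).
exists P, rs, h; split=> //; apply/(dvdXsubC_real_split _ _ sp); rewrite Pf.
apply: double_root_divides; first by rewrite hornerD hornerC addNr.
by rewrite derivD derivC add0r.
Qed.

Lemma size_base_perturb (f0 : {poly R}) (e : R) (v : 'I_(2 * k) -> R) : (size f0 <= (2 * k).+1)%N ->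
  (size (f0 + e *: positive_part v)%R <= (2 * k).+1)%N.
Proof.
move=> s0; rewrite (leq_trans (size_polyD _ _)) // geq_max s0 /=.
exact: leq_trans (size_scale_leq _ _) (size_positive_part _).
Qed.

(** The derivative of a small perturbation of X^(2 k) changes sign between -1
    and 1, so there is a critical point. *)
Lemma discriminant_independent (F : conic_frame Q) :
  exists T : 'I_(2 * k) -> mpoly (\dim {: form R k}) R,
    alg_independent_on (set_val @` discriminant B Q) T.
Proof.
apply: (@independent_of_directions R k B Q F _ 'X^(2 * k)); first by rewrite size_polyXn.
move=> v; have [d d0 hd] := small_perturbation v; exists d => // e e0 ed.
have [_ bd bc] := hd e e0 ed; set g := 'X^(2 * k) + _.
have dg x : g^`().[x] = x ^+ (2 * k).-1 * (2 * k)%:R + (e *: positive_part v)^`().[x].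
  by rewrite derivD derivXn hornerD hornerMn hornerXn mulr_natr.
have k2 : (2 : R) <= (2 * k)%:R by rewrite ler_nat leq_pmulr.
have oddk : odd (2 * k).-1 by move: k_gt0; lia.
have [t _ /rootP gt] : exists2 t, -1 <= t <= 1 & root g^`() t.
  apply: Num.Theory.poly_ivt; first lra.
  rewrite !dg -signr_odd oddk expr1 expr1n mul1r mulN1r.
  have := bd 1; have := bd (-1); rewrite normrN normr1 !ler_norml => /(_ _)/andP[|b1 b2]; first lra.
  by move=> /(_ _)/andP[|b3 b4]; lra.
have top : g`_(2 * k) != 0.
  have := bc (2 * k)%N; rewrite coefD coefXn eqxx ler_norml => /andP[b1 b2].
  by apply/lt0r_neq0; rewrite /=; lra.
have [P [rs [h [PE Pb _ sp t2]]]] := critical_to_double F (size_base_perturb _ _ (eq_leq (size_polyXn _ _))) top gt.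
exists (- g.[t]); exists P => //.
by apply/(discriminantP Pb sp); apply: count_uniq t2.
Qed.

(** The polynomial X^(2 k) - 2 X^2 has a strict local maximum at 0 and takes
    a negative value at 1 and a positive one at 2. After a small perturbation
    there is a critical point t in [-1/2, 1/2], and the value at t is taken again
    between 1 and 2: adding a constant yields a double root at t and a further
    real root, so that t, t are not all the real roots. *)
Lemma ramification_independent (F : conic_frame Q) : (1 < k)%N ->
  exists T : 'I_(2 * k) -> mpoly (\dim {: form R k}) R,
    alg_independent_on (set_val @` ramification_set Phi) T.
Proof.
move=> k1; pose f0 : {poly R} := 'X^(2 * k) - 2 *: 'X^2.
have sf0 : (size f0 <= (2 * k).+1)%N.
  rewrite (leq_trans (size_polyD _ _)) // geq_max size_polyXn leqnn /= size_polyN.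
  by rewrite (leq_trans (size_scale_leq _ _)) // size_polyXn; move: k1; lia.
apply: (@independent_of_directions R k B Q F _ f0) => // v.
have [d d0 hd] := small_perturbation v; exists d => // e e0 ed.
have [bv bd bc] := hd e e0 ed; set g := f0 + _.
have gv x : g.[x] = x ^+ (2 * k) - 2 * x ^+ 2 + (e *: positive_part v).[x].
  by rewrite hornerD /f0 hornerD hornerN hornerZ !hornerXn.
have dg x : g^`().[x] = x ^+ (2 * k).-1 * (2 * k)%:R - 4 * x + (e *: positive_part v)^`().[x].
  rewrite derivD /f0 derivB derivZ !derivXn !hornerD hornerN hornerZ !hornerMn !hornerXn.
  by congr (_ - _ + _); [rewrite mulr_natr|rewrite /=; ring].
have oddk : odd (2 * k).-1 by move: k_gt0; lia.
(* The derivative of X^(2 k) is at most 1 at 1/2, against 4 x = 2 for the other term. *)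
have small : (2^-1 : R) ^+ (2 * k).-1 * (2 * k)%:R <= 1.
  rewrite exprVn mulrC ler_pdivrMr ?exprn_gt0 // mul1r -natrX ler_nat.
  have := ltn_expl (2 * k).-1 (isT : (1 < 2)%N).
  by move: k_gt0; move: (2 ^ _)%N; lia.
have small0 : 0 <= (2^-1 : R) ^+ (2 * k).-1 * (2 * k)%:R by rewrite mulr_ge0 ?exprn_ge0 ?invr_ge0 ?ler0n.
have [t /andP[t1 t2] rt] : exists2 t, - 2^-1 <= t <= 2^-1 & root (- g^`()) t.
  apply: Num.Theory.poly_ivt; first lra.
  rewrite !hornerN !dg exprNn -signr_odd oddk expr1 mulN1r !mulNr.
  have := bd 2^-1; have := bd (- 2^-1); rewrite normrN ger0_norm ?invr_ge0 // !ler_norml => /(_ _)/andP[|b1 b2]; first lra.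
  move=> /(_ _)/andP[|b3 b4]; first lra.
  move: small small0; set y := _ * _%:R => *; lra.
have gt : g^`().[t] = 0 by move/rootP: rt; rewrite hornerN => /eqP; rewrite oppr_eq0 => /eqP.
have top : g`_(2 * k) != 0.
  have := bc (2 * k)%N; rewrite coefD /f0 coefB coefZ !coefXn eqxx.
  have -> : ((2 * k)%N == 2%N) = false by apply/eqP; move: k1; lia.
  rewrite ler_norml => /andP[b1 b2].
  by apply/lt0r_neq0; rewrite /=; lra.
have [P [rs [h [PE Pb Pf sp tt]]]] := critical_to_double F (size_base_perturb _ _ sf0) top gt.
exists (- g.[t]); exists P => //.
apply: (@ramified R k B Q Qirr k_gt0 F P rs h Pb sp (count_uniq tt)).
have tn : `|t| <= 2 by rewrite ler_norml; lra.
have tt2 : t ^+ 2 <= 4^-1.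
  have : 0 <= (2^-1 - t) * (2^-1 + t) by rewrite mulr_ge0 ?subr_ge0 // addrC -lerBlDr sub0r.
  by rewrite expr2; lra.
have tk0 : 0 <= t ^+ (2 * k) by rewrite exprM exprn_ge0 ?sqr_ge0.
have tk1 : t ^+ (2 * k) <= 1 by rewrite exprM exprn_ile1 ?sqr_ge0 //; lra.
have t20 := sqr_ge0 t.
have p2 : (16 : R) <= 2 ^+ (2 * k).
  have -> : (16 : R) = 2 ^+ 4 by rewrite -natrX.
  by rewrite ler_weXn2l ?ler1n // (leq_mul (leqnn 2) k1).
have fE x : ((- g.[t])%:P + g).[x] = - g.[t] + g.[x] by rewrite hornerD hornerC.
have [s /andP[s1 s2] rs_s] : exists2 s, 1 <= s <= 2 & root ((- g.[t])%:P + g) s.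
  apply: Num.Theory.poly_ivt; first lra.
  rewrite !fE !gv expr1n.
  have w x : `|x| <= 2 -> - 8^-1 <= (e *: positive_part v).[x] <= 8^-1.
    by rewrite -ler_norml; apply: bv.
  have /andP[b1 b2] := w t tn.
  have /andP[b3 b4] : - 8^-1 <= (e *: positive_part v).[1] <= 8^-1 by apply: w; rewrite normr1; lra.
  have /andP[b5 b6] : - 8^-1 <= (e *: positive_part v).[2] <= 8^-1 by apply: w; rewrite ger0_norm.
  lra.
have srs : s \in rs by rewrite -(root_real_split s sp) Pf.
have trs : t \in rs by rewrite -has_pred1 has_count (ltn_trans _ tt).
move=> [x rsx]; move: srs trs; rewrite !(perm_mem rsx) !inE !orbb => /eqP sx /eqP tx.
by move: s1 t2; rewrite sx tx; lra.
Qed.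

Theorem codimension_discriminant : codimension_one_in (VQperp B Q) (set_val @` discriminant B Q).
Proof.
have [F] := indefinite_frame Qirr nQ.
exists (2 * k)%N; first exact: dim_VQperp.
split; first exact: discriminant_independent F.
exact: discriminant_dependent F _ (fun=> id).
Qed.

Theorem codimension_ramification : (1 < k)%N ->
  codimension_one_in (VQperp B Q) (set_val @` ramification_set Phi).
Proof.
move=> k1; have [F] := indefinite_frame Qirr nQ.
exists (2 * k)%N; first exact: dim_VQperp.
split; first exact: ramification_independent F k1.
apply: discriminant_dependent F _ _ => _ [P + <-].
by rewrite (ramification_discriminant B Qirr k_gt0 nQ) => -[dP _]; exists P.
Qed.

End DiscriminantCodimension.

Theorem theorem14 (R : realType) (Q : form R 2) (k : nat)
    (B : {dot (form R k) for idfun})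
    (Qirr : irreducible_over_C Q) (k_gt0 : (0 < k)%N) :
  (exists param : multipole R k -> form R k,
    [/\ (forall A : vectors R k, param (\pi_(multipole R k) A) = prod_form A),
        injective param &
        range param = [set P : form R k | P != 0 /\ completely_factorable P]]) /\
  exists (act : Rstar R -> multipole R k -> multipole R k)
         (proj : multipole R k -> Sym k (RP2 R))
         (Phi : multipole R k -> VQperp0 B Q)
         (Psi : Sym k (RP2 R) -> RP_VQperp B Q),
    [/\ (forall t (i : 'I_k) (A : vectors R k),
           act t (\pi_(multipole R k) A) =
           \pi_(multipole R k) (scale_at i t A)),
        (forall A : vectors R k,
           proj (\pi_(multipole R k) A) =
           \pi_(Sym k (RP2 R)) (fun i => \pi_(RP2 R) (A i))),
        (forall A : vectors R k,
           prod_form A - \val (Phi (\pi_(multipole R k) A)) \in VQ Q k) &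
        (forall m, Psi (proj m) = \pi_(RP_VQperp B Q) (Phi m))] /\
    [/\ principal_Rstar_bundle act proj,
        (forall t m, \val (Phi (act t m)) = \val t *: \val (Phi m)),
        \dim (VQperp B Q) = (2 * k).+1,
        set_surj setT setT Psi &
        degree_one Psi] /\
    (~ definite Q ->
      [/\ finite_fibers Phi,
          ramification_set Phi =
            discriminant B Q `\`
            single_double_line B Q,
          discriminant B Q =
            discriminant_curves B Q,
          codimension_one_in (VQperp B Q)
            (set_val @` discriminant B Q) &
          (1 < k)%N ->
          codimension_one_in (VQperp B Q)
            (set_val @` ramification_set Phi)]).
Proof.
split.
  by exists (@param R k); split; [exact: param_pi|exact: param_inj|exact: range_param].
exists (act k_gt0), (@proj R k), (@Phi R k B Q Qirr), (@Psi R k B Q Qirr); split.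
  split.
  - by move=> t i A; apply: act_pi.
  - exact: proj_pi.
  - by move=> A; rewrite val_Phi param_pi perp_proj_sub.
  - exact: Psi_proj.
split.
  split.
  - exact: multipole_bundle.
  - exact: Phi_act.
  - exact: dim_VQperp.
  - by move=> z _; have [y yz] := Psi_surj Qirr k_gt0 z; exists y.
  - exact: Psi_degree_one.
move=> nQ; split.
- exact: Phi_finite_fibers.
- exact: ramification_discriminant.
- exact: discriminant_eq_curves.
- exact: codimension_discriminant.
- exact: codimension_ramification.
Qed.
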